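(* Let $r \in \mathbb{N}$ and let $\phi(a_1,\ldots,a_r)$ be a sentence of topological first order logic $\mathrm{TFOL}$ with constant symbols $a_1,\ldots,a_r$. For $n \in \mathbb{N}$ let $T_{\phi,r}(n)$ be the number of topologies $\mathcal{U}$ on the set $[r+n]=\{1,\ldots,r+n\}$ such that the structure $([r+n],\mathcal{U},E,1,\ldots,r)$ satisfies $\phi$, where $E(x,U)$ holds iff $x\in U$ and the constant $a_i$ is interpreted as $i$ (hard-wired constants). Then: (i) for every positive integer $m$, the sequence $T^m_{\phi,r}(n)=T_{\phi,r}(n) \bmod m$ is ultimately periodic; i.e. $T_{\phi,r}(n)$ is MC-finite; (ii) for given $\phi$ and $m$, the sequence $T^m_{\phi,r}(n)$ is computable in fixed parameter tractable ($\mathrm{FPT}$) time, where the parameters are $\phi$, $r$ and $m$ (i.e. in time $f(\phi,r,m)\cdot n^{O(1)}$ for some function $f$).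
   Context: A finite topological space $(X,\mathcal{U})$ ($\mathcal{U}$ the family of open sets) is identified with the two-sorted relational structure $(X,\mathcal{U},E)$, where $E\subseteq X\times\mathcal{U}$ and $E(x,U)$ means $x\in U$. $\mathrm{TFOL}$ is the first-order logic over such two-sorted structures: variables range over elements of $X$ and over elements of $\mathcal{U}$ (open sets), atomic formulas are equalities and $E(x,U)$, closed under Boolean connectives and first-order quantification over both sorts; constant symbols $a_1,\dots,a_r$ denote elements of $X$. A sequence of integers $s(n)$ is MC-finite if for every $m\in\mathbb{N}^+$ there are $p_m,q_m\in\mathbb{N}^+$ and $c_{i,m}\in\mathbb{Z}$ such that $s(n+p_m)\equiv\sum_{i=0}^{p_m-1}c_{i,m}s(n+i) \pmod m$ for all $n\ge q_m$; equivalently, $s(n)\bmod m$ is ultimately periodic for every $m$. *)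

(* Defs.v *)
From mathcomp Require Import all_boot all_order all_algebra.

Set Implicit Arguments.
Unset Strict Implicit.
Unset Printing Implicit Defensive.

(* Syntax of TFOL with r constant symbols. Formulas are well scoped: in       *)
(* [formula r p u] the free point variables are 'I_p and the free open-set    *)
(* variables are 'I_u (de Bruijn indices; a quantifier binds index ord0).     *)

Inductive term (r p : nat) : Type :=
| Var of 'I_p
| Cst of 'I_r.

Arguments Var {r p} _.
Arguments Cst {r p} _.

Inductive formula (r : nat) : nat -> nat -> Type :=
| EqPoint p u of term r p & term r p : formula r p u
| EqOpen p u of 'I_u & 'I_u : formula r p u
| Mem p u of term r p & 'I_u : formula r p u
| Not p u of formula r p u : formula r p u
| And p u of formula r p u & formula r p u : formula r p u
| Or p u of formula r p u & formula r p u : formula r p u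
| Imp p u of formula r p u & formula r p u : formula r p u
| ExPoint p u of formula r p.+1 u : formula r p u
| AllPoint p u of formula r p.+1 u : formula r p u
| ExOpen p u of formula r p u.+1 : formula r p u
| AllOpen p u of formula r p u.+1 : formula r p u.

Definition sentence (r : nat) : Type := formula r 0 0.

Definition env_cons (T : Type) (n : nat) (x : T) (v : 'I_n -> T) : 'I_n.+1 -> T :=
  fun i => if unlift ord0 i is Some j then v j else x.

Definition env_nil (T : Type) : 'I_0 -> T :=
  fun i => False_rect T (notF (ltn_ord i)).

(* Satisfaction in a finite two-sorted structure (X, U, E, c).                *)
Section Satisfaction.
Variables (r : nat) (X U : finType) (E : X -> U -> bool) (c : 'I_r -> X).

Definition eval_term (p : nat) (v : 'I_p -> X) (t : term r p) : X :=
  match t with Var i => v i | Cst a => c a end.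

Fixpoint sat (p u : nat) (phi : formula r p u) :
    ('I_p -> X) -> ('I_u -> U) -> bool :=
  match phi in formula _ p u return ('I_p -> X) -> ('I_u -> U) -> bool with
  | EqPoint _ _ s t => fun v w => eval_term v s == eval_term v t
  | EqOpen _ _ i j => fun v w => w i == w j
  | Mem _ _ t i => fun v w => E (eval_term v t) (w i)
  | Not _ _ a => fun v w => ~~ sat a v w
  | And _ _ a b => fun v w => sat a v w && sat b v w
  | Or _ _ a b => fun v w => sat a v w || sat b v w
  | Imp _ _ a b => fun v w => sat a v w ==> sat b v w
  | ExPoint _ _ a => fun v w => [exists x : X, sat a (env_cons x v) w]
  | AllPoint _ _ a => fun v w => [forall x : X, sat a (env_cons x v) w]
  | ExOpen _ _ a => fun v w => [exists A : U, sat a v (env_cons A w)]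
  | AllOpen _ _ a => fun v w => [forall A : U, sat a v (env_cons A w)]
  end.

Definition models (phi : sentence r) : bool := sat phi (@env_nil X) (@env_nil U).

End Satisfaction.

Definition is_topology (X : finType) (O : {set {set X}}) : bool :=
  [&& set0 \in O,
      setT \in O,
      [forall S : {set {set X}}, (S \subset O) ==> (cover S \in O)] &
      [forall A in O, forall B in O, A :&: B \in O]].

(* (X, O, E, c): the second sort is the type of members of O. *)
Definition top_models (r : nat) (X : finType) (O : {set {set X}})
    (c : 'I_r -> X) (phi : sentence r) : bool :=
  @models r X {A : {set X} | A \in O} (fun x A => x \in val A) c phi.

(* [r + n] is 'I_(r + n), and the i-th constant denotes its i-th element. *)
Definition topcount (r : nat) (phi : sentence r) (n : nat) : nat :=
  #|[set O : {set {set 'I_(r + n)}} |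
      is_topology O && top_models O (fun i : 'I_r => lshift n i) phi]|.

Definition ultimately_periodic (T : Type) (s : nat -> T) : Prop :=
  exists p q : nat, 0 < p /\ forall n, q <= n -> s (n + p) = s n.

Definition mc_finite (s : nat -> int) : Prop :=
  forall m : nat, 0 < m ->
  exists (p q : nat) (c : 'I_p -> int),
    [/\ 0 < p, 0 < q &
      forall n, q <= n ->
        (s (n + p)%N = \sum_(i < p) c i * s (n + i)%N %[mod m%:Z])%Z%R].

(* Successor random access machines with unit cost. The largest number in a   *)
(* register grows by at most one per step (apart from the constants of the    *)
(* program), so step counts are polynomially related to Turing machine time.  *)
Inductive instr : Type :=
| Const of nat & nat   (* Const d k: R[d] := k *)
| Move of nat & nat    (* Move d s:  R[d] := R[s] *)
| LoadI of nat & nat   (* LoadI d s:  R[d] := R[R[s]] *)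
| StoreI of nat & nat  (* StoreI d s: R[R[d]] := R[s] *)
| Incr of nat
| Decr of nat
| JumpZ of nat & nat.  (* JumpZ s l: if R[s] = 0 then go to line l *)

Definition program : Type := seq instr.

Record config : Type := Config { pc : nat; reg : nat -> nat }.

Definition upd (R : nat -> nat) (d k : nat) : nat -> nat :=
  fun j => if j == d then k else R j.

Definition exec (i : instr) (s : config) : config :=
  let R := reg s in
  let next := (pc s).+1 in
  match i with
  | Const d k => Config next (upd R d k)
  | Move d e => Config next (upd R d (R e))
  | LoadI d e => Config next (upd R d (R (R e)))
  | StoreI d e => Config next (upd R (R d) (R e))
  | Incr d => Config next (upd R d (R d).+1)
  | Decr d => Config next (upd R d (R d).-1)
  | JumpZ e l => Config (if R e == 0 then l else next) R
  end.

Definition halted (P : program) (s : config) : bool := size P <= pc s.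

Definition step (P : program) (s : config) : config :=
  if onth P (pc s) is Some i then exec i s else s.

(* The input w occupies R[1], ..., R[size w], and R[0] holds its length. *)
Definition init (w : seq nat) : config := Config 0 (nth 0 (size w :: w)).

(* P halts on w after at most t steps, with output R[0] = v. Halted           *)
(* configurations are fixed by [step].                                        *)
Definition computes_within (P : program) (w : seq nat) (t v : nat) : Prop :=
  let s := iter t (step P) (init w) in halted P s /\ reg s 0 = v.

(* A single program and a single exponent serve all parameters k : K.         *)
(* (n + 1) ^ d is used instead of n ^ d so that the bound is meaningful at    *)
(* n = 0.                                                                     *)
Definition fpt_computable (K : Type) (enc : K -> seq nat)
    (F : K -> nat -> nat) : Prop :=
  exists (P : program) (d : nat) (f : K -> nat),
  forall (k : K) (n : nat),
    computes_within P (n :: enc k) (f k * n.+1 ^ d) (F k n).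

(* Polish notation, one register per symbol. *)
Definition enc_term (r p : nat) (t : term r p) : seq nat :=
  match t with
  | Var i => [:: 0; nat_of_ord i]
  | Cst a => [:: 1; nat_of_ord a]
  end.

Fixpoint enc_formula (r p u : nat) (phi : formula r p u) : seq nat :=
  match phi with
  | EqPoint _ _ s t => 0 :: enc_term s ++ enc_term t
  | EqOpen _ _ i j => [:: 1; nat_of_ord i; nat_of_ord j]
  | Mem _ _ t i => 2 :: rcons (enc_term t) (nat_of_ord i)
  | Not _ _ a => 3 :: enc_formula a
  | And _ _ a b => 4 :: enc_formula a ++ enc_formula b
  | Or _ _ a b => 5 :: enc_formula a ++ enc_formula b
  | Imp _ _ a b => 6 :: enc_formula a ++ enc_formula b
  | ExPoint _ _ a => 7 :: enc_formula a
  | AllPoint _ _ a => 8 :: enc_formula a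
  | ExOpen _ _ a => 9 :: enc_formula a
  | AllOpen _ _ a => 10 :: enc_formula a
  end.

Record params : Type := Params {
  par_r : nat;
  par_phi : sentence par_r;
  par_m : nat;
  par_m_gt0 : 0 < par_m
}.

Definition enc_params (k : params) : seq nat :=
  par_m k :: par_r k :: enc_formula (par_phi k).

(* Main.v *)
Require Import Defs.
From mathcomp Require Import all_boot all_order all_algebra.
From mathcomp Require Import all_fingroup zify.

(* A finite topology is the family of up-sets of a preorder, so a TFOL sentence
   is a monadic second-order sentence about the off-diagonal part of a transitive
   relation.  Such a sentence is recognized by a finite algebra that is compatible
   with the substitution of blocks (modules) for vertices: edges and labels are
   recognized directly, Boolean connectives are products of algebras and set
   quantifiers are powersets of algebras.

   Periodicity modulo p^k (Specker-Blatter): take k(k+1) blocks of p vertices with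
   the same label and let (Z/p)^(k(k+1)) rotate the blocks.  The relations for which
   no block rotation is a symmetry fall into orbits of size divisible by p^k, and a
   block whose rotation is a symmetry is a module, hence can be contracted to one
   vertex labelled by an element of the algebra.  So modulo p^k the counts for all
   multiplicities of labels are determined by the counts with multiplicities below
   k(k+1)p, and the pigeonhole principle bounds the preperiod and the period by an
   explicit number S depending on the sentence and the modulus only.

   For the algorithm, S is dominated by a tower of exponentials of the input.  The
   machine computes that tower, reduces n modulo its factorial in linear time, and
   then counts by brute force; the brute-force count is written as a primitive
   recursive expression, which is compiled to machine code. *)

Set Implicit Arguments.
Unset Strict Implicit.
Unset Printing Implicit Defensive.

(** * Recognizable properties of labelled graphs *)

(** A rotation acts transitively on its block, so when it is a symmetry every outside vertex sees
    the whole block alike: this is why the block is a module. When it is not, primality of [p] gives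
    the block a partner: a symmetry that moves the block must also move the partner. Among
    [k * k.+1] blocks one can pick [k] such that no picked block has a picked partner; no nontrivial
    rotation of these alone is a symmetry, which yields the factor [p ^ k] in every orbit. The
    obstacle is that a contracted block receives a new label, so the numbers [topcount phi n] are
    not closed under contraction. Hence the induction treats all multiplicities of all algebra
    elements at once, and [n] only counts vertices that carry the label of an unnamed point. For
    tractability a single program must serve all sentences, so neither the algebra nor the period
    can be built into it. This is why carriers are bounded by explicit numbers throughout, and why
    the period is a factorial: it is a multiple of a true period that is only known not to exceed
    the bound. *)

Record graph_algebra := GraphAlgebra {
  car : finType;
  op : forall V : finType, {set V} -> rel V -> (V -> car) -> car;
  op_ext : forall (V : finType) (D : {set V}) (R R' : rel V) (t t' : V -> car),
    {in D &, forall x y, x != y -> R x y = R' x y} ->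
    {in D, t =1 t'} -> op D R t = op D R' t';
  op_set1 : forall (V : finType) (v : V) (R : rel V) (t : V -> car),
    op [set v] R t = t v;
  op_subst : forall (V W : finType) (f : V -> W) (D : {set V}) (R : rel V)
      (RW : rel W) (t : V -> car),
    {in D &, forall x y, f x != f y -> R x y = RW (f x) (f y)} ->
    op D R t = op (f @: D) RW (fun w => op [set x in D | f x == w] R t)
}.

Definition graph_property (S : finType) : Type :=
  forall V : finType, rel V -> (V -> S) -> bool.

Definition recognizable (S : finType) (B : nat) (P : graph_property S) : Prop :=
  exists (A : graph_algebra) (pt : S -> car A) (ev : pred (car A)),
    #|car A| <= B /\
    forall (V : finType) (R : rel V) (c : V -> S),
      P V R c = ev (op [set: V] R (pt \o c)).

Lemma recognizable_ext (S : finType) (B : nat) (P Q : graph_property S) :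
  recognizable B P -> (forall V R c, Q V R c = P V R c) -> recognizable B Q.
Proof.
move=> [A [pt [ev [leB PE]]]] QE; exists A, pt, ev; split=> // V R c.
by rewrite QE PE.
Qed.

Lemma recognizable_relabel (S S' : finType) (h : S' -> S) (B : nat)
    (P : graph_property S) :
  recognizable B P -> recognizable B (fun V R c => P V R (h \o c)).
Proof.
by move=> [A [pt [ev [leB PE]]]]; exists A, (pt \o h), ev; split=> // V R c; rewrite PE.
Qed.

Section SomeAlgebra.

Let some_op (V : finType) (D : {set V}) (R : rel V) (t : V -> bool) :=
  [exists v in D, t v].

Let some_op_ext (V : finType) (D : {set V}) (R R' : rel V) (t t' : V -> bool) :
  {in D &, forall x y, x != y -> R x y = R' x y} ->
  {in D, t =1 t'} -> some_op D R t = some_op D R' t'.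
Proof.
by move=> _ tt'; apply: eq_existsb => v; case: (boolP (v \in D)) => //= /tt' ->.
Qed.

Let some_op_set1 (V : finType) (v : V) (R : rel V) (t : V -> bool) :
  some_op [set v] R t = t v.
Proof.
apply/existsP/idP => [[w /andP[/set1P -> //]]|tv].
by exists v; rewrite set11.
Qed.

Let some_op_subst (V W : finType) (f : V -> W) (D : {set V}) (R : rel V)
    (RW : rel W) (t : V -> bool) :
  {in D &, forall x y, f x != f y -> R x y = RW (f x) (f y)} ->
  some_op D R t = some_op (f @: D) RW (fun w => some_op [set x in D | f x == w] R t).
Proof.
move=> _; apply/existsP/existsP => [[v /andP[vD tv]]|[w /andP[wD /existsP[v]]]].
  exists (f v); rewrite imset_f //=; apply/existsP; exists v.
  by rewrite inE vD eqxx.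
by rewrite inE -andbA => /and3P[vD _ tv]; exists v; rewrite vD.
Qed.

Definition some_algebra : graph_algebra :=
  GraphAlgebra some_op_ext some_op_set1 some_op_subst.

End SomeAlgebra.

Definition some_label (S : finType) (a : pred S) : graph_property S :=
  fun V R c => [exists v, a (c v)].

Lemma recognizable_some (S : finType) (a : pred S) : recognizable 2 (some_label a).
Proof.
exists some_algebra, a, id; split; first by rewrite card_bool.
by move=> V R c; apply: eq_existsb => v; rewrite inE.
Qed.

Section EdgeAlgebra.

(* The three bits of a block: it contains an a-vertex, it contains a b-vertex,
   it contains an edge from an a-vertex to a b-vertex. *)
Let edge_op (V : finType) (D : {set V}) (R : rel V) (t : V -> bool * bool * bool) :=
  ([exists v in D, (t v).1.1], [exists v in D, (t v).1.2],
   [exists v in D, (t v).2] ||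
   [exists v in D, [exists w in D, [&& v != w, R v w, (t v).1.1 & (t w).1.2]]]).

Let edge_op_ext (V : finType) (D : {set V}) (R R' : rel V) t t' :
  {in D &, forall x y, x != y -> R x y = R' x y} ->
  {in D, t =1 t'} -> edge_op D R t = edge_op D R' t'.
Proof.
move=> RR' tt'; congr (_, _, _ || _); apply: eq_existsb => v;
  case: (boolP (v \in D)) => //= vD; rewrite ?tt' //.
apply: eq_existsb => w; case: (boolP (w \in D)) => //= wD; rewrite ?tt' //.
by case: (altP (v =P w)) => //= vw; rewrite RR'.
Qed.

Let edge_op_set1 (V : finType) (v : V) (R : rel V) t : edge_op [set v] R t = t v.
Proof.
have ex1 (p : pred V) : [exists x in [set v], p x] = p v.
  by apply/existsP/idP => [[w /andP[/set1P -> //]]|pv]; exists v; rewrite set11.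
rewrite /edge_op !ex1 eqxx orbF.
by case: (t v) => [[]].
Qed.

Let edge_op_subst (V W : finType) (f : V -> W) (D : {set V}) (R : rel V)
    (RW : rel W) t :
  {in D &, forall x y, f x != f y -> R x y = RW (f x) (f y)} ->
  edge_op D R t = edge_op (f @: D) RW (fun w => edge_op [set x in D | f x == w] R t).
Proof.
have exD (p : pred V) :
    [exists v in D, p v] = [exists w in f @: D, [exists v in [set x in D | f x == w], p v]].
  apply/existsP/existsP => [[v /andP[vD tv]]|[w /andP[wD /existsP[v]]]].
    exists (f v); rewrite imset_f //=; apply/existsP; exists v.
    by rewrite inE vD eqxx.
  by rewrite inE -andbA => /and3P[vD _ tv]; exists v; rewrite vD.
move=> RE; rewrite /edge_op /=; congr (_, _, _); try exact: exD.
apply/orP/orP => [[] | []] /existsP[v /andP[vD]].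
- move=> tv; left; apply/existsP; exists (f v); rewrite imset_f //=.
  by apply/orP; left; apply/existsP; exists v; rewrite inE vD eqxx.
- move=> /existsP[w /and5P[wD vw Rvw tv tw]].
  (* An edge inside a fibre is recorded in the third bit of that fibre; an edge between two fibres
     survives as an edge of the quotient. *)
  have [fvw|fvw] := eqVneq (f v) (f w).
    left; apply/existsP; exists (f v); rewrite imset_f //=.
    apply/orP; right; apply/existsP; exists v; rewrite inE vD eqxx /=.
    by apply/existsP; exists w; rewrite inE wD fvw eqxx vw Rvw tv.
  right; apply/existsP; exists (f v); rewrite imset_f //=.
  apply/existsP; exists (f w); rewrite imset_f //= fvw -RE // Rvw /=.
  by apply/andP; split; apply/existsP; [exists v|exists w]; rewrite inE eqxx ?vD ?wD.
- move=> /orP[] /existsP[x]; rewrite inE -andbA => /and3P[xD _].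
    by move=> tx; left; apply/existsP; exists x; rewrite xD.
  move=> /existsP[y]; rewrite inE -andbA => /and3P[yD _ H].
  by right; apply/existsP; exists x; rewrite xD; apply/existsP; exists y; rewrite yD.
move=> /existsP[w /and5P[wD vw Rvw /existsP[x] + /existsP[y]]].
rewrite !inE -!andbA => /and3P[xD /eqP fx tx] /and3P[yD /eqP fy ty].
right; apply/existsP; exists x; rewrite xD; apply/existsP; exists y.
have nf : f x != f y by rewrite fx fy.
rewrite yD /= RE // fx fy Rvw tx ty !andbT.
by apply: contraNneq nf => ->.
Qed.

Definition edge_algebra : graph_algebra :=
  GraphAlgebra edge_op_ext edge_op_set1 edge_op_subst.

End EdgeAlgebra.

Definition edge_label (S : finType) (a b : pred S) : graph_property S :=
  fun V R c => [exists v, exists w, [&& v != w, R v w, a (c v) & b (c w)]].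

Lemma recognizable_edge (S : finType) (a b : pred S) :
  recognizable 8 (edge_label a b).
Proof.
exists edge_algebra, (fun x => (a x, b x, false)), (fun t => t.2).
split; first by rewrite !card_prod card_bool.
move=> V R c /=.
rewrite [X in _ = X || _](_ : _ = false) /=; last first.
  by apply/existsP => [[v]]; rewrite andbF.
by apply: eq_existsb => v; rewrite inE; apply: eq_existsb => w; rewrite inE.
Qed.

Section ProductAlgebra.

Variables A1 A2 : graph_algebra.

Let prod_op (V : finType) (D : {set V}) (R : rel V) (t : V -> car A1 * car A2) :=
  (op D R (fun v => (t v).1), op D R (fun v => (t v).2)).

Let prod_op_ext (V : finType) (D : {set V}) (R R' : rel V) t t' :
  {in D &, forall x y, x != y -> R x y = R' x y} ->
  {in D, t =1 t'} -> prod_op D R t = prod_op D R' t'.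
Proof.
by move=> RR' tt'; congr pair; apply: op_ext => // v vD; rewrite tt'.
Qed.

Let prod_op_set1 (V : finType) (v : V) (R : rel V) t : prod_op [set v] R t = t v.
Proof. by rewrite /prod_op !op_set1 -surjective_pairing. Qed.

Let prod_op_subst (V W : finType) (f : V -> W) (D : {set V}) (R : rel V)
    (RW : rel W) t :
  {in D &, forall x y, f x != f y -> R x y = RW (f x) (f y)} ->
  prod_op D R t = prod_op (f @: D) RW (fun w => prod_op [set x in D | f x == w] R t).
Proof. by move=> RE; congr pair; apply: op_subst. Qed.

Definition prod_algebra : graph_algebra :=
  GraphAlgebra prod_op_ext prod_op_set1 prod_op_subst.

End ProductAlgebra.

Lemma recognizable_bool (S : finType) (f : bool -> bool -> bool) (B1 B2 : nat)
    (P1 P2 : graph_property S) :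
  recognizable B1 P1 -> recognizable B2 P2 ->
  recognizable (B1 * B2) (fun V R c => f (P1 V R c) (P2 V R c)).
Proof.
move=> [A1 [pt1 [ev1 [le1 E1]]]] [A2 [pt2 [ev2 [le2 E2]]]].
exists (prod_algebra A1 A2), (fun x => (pt1 x, pt2 x)), (fun t => f (ev1 t.1) (ev2 t.2)).
split; first by rewrite card_prod leq_mul.
by move=> V R c; rewrite E1 E2.
Qed.

Lemma recognizable_not (S : finType) (B : nat) (P : graph_property S) :
  recognizable B P -> recognizable B (fun V R c => ~~ P V R c).
Proof.
move=> [A [pt [ev [leB PE]]]]; exists A, pt, (fun t => ~~ ev t).
by split=> // V R c; rewrite PE.
Qed.

Section PowerAlgebra.

Variable A : graph_algebra.

(** The subset construction of automata theory: a block evaluates to the set of all values it can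
    take when each vertex picks one of its admissible labels. *)
Let power_op (V : finType) (D : {set V}) (R : rel V) (t : V -> {set car A}) :
    {set car A} :=
  [set op D R t' | t' : {ffun V -> car A} & [forall v in D, t' v \in t v]].

Let power_op_ext (V : finType) (D : {set V}) (R R' : rel V) t t' :
  {in D &, forall x y, x != y -> R x y = R' x y} ->
  {in D, t =1 t'} -> power_op D R t = power_op D R' t'.
Proof.
move=> RR' tt'; apply/setP => z; apply/imsetP/imsetP => [[s]|[s]];
  rewrite inE => /forall_inP sP -> ; exists s.
- by rewrite inE; apply/forall_inP => v vD; rewrite -tt' // sP.
- exact: op_ext.
- by rewrite inE; apply/forall_inP => v vD; rewrite tt' // sP.
- by apply: op_ext => // x y xD yD xy; rewrite RR'.
Qed.

Let power_op_set1 (V : finType) (v : V) (R : rel V) t : power_op [set v] R t = t v.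
Proof.
apply/setP => z; apply/imsetP/idP => [[s]|zt].
  by rewrite inE => /forall_inP sP ->; rewrite op_set1 sP // set11.
exists [ffun => z]; last by rewrite op_set1 ffunE.
by rewrite inE; apply/forall_inP => w /set1P ->; rewrite ffunE.
Qed.

Let power_op_subst (V W : finType) (f : V -> W) (D : {set V}) (R : rel V)
    (RW : rel W) t :
  {in D &, forall x y, f x != f y -> R x y = RW (f x) (f y)} ->
  power_op D R t = power_op (f @: D) RW (fun w => power_op [set x in D | f x == w] R t).
Proof.
move=> RE; apply/setP => z; apply/imsetP/imsetP => [[s]|[s]];
  rewrite inE => /forall_inP sP ->.
  rewrite (op_subst _ RE).
  exists [ffun w => op [set x in D | f x == w] R s]; last first.
    by apply: op_ext => // w _; rewrite ffunE.
  rewrite inE; apply/forall_inP => w wD; rewrite ffunE; apply: imset_f.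
  by rewrite inE; apply/forall_inP => v; rewrite inE => /andP[vD _]; apply: sP.
(* The membership of [w] sits under the existential so that a choice function over all of [W] can be
   extracted; the choices on the disjoint fibres are then glued into one. *)
have H w : exists r : {ffun V -> car A}, w \in f @: D ->
    (forall v, v \in D -> f v == w -> r v \in t v) /\
    s w = op [set x in D | f x == w] R r.
  case: (boolP (w \in f @: D)) => [wD|_]; last by exists [ffun => s w].
  have /imsetP[r] := sP _ wD; rewrite inE => /forall_inP rP ->.
  by exists r => _; split=> // v vD fv; apply: rP; rewrite inE vD.
have [g gP] := fin_all_exists H.
exists [ffun v => g (f v) v].
  rewrite inE; apply/forall_inP => v vD; rewrite ffunE.
  by have [+ _] := gP _ (imset_f f vD); apply.
rewrite (op_subst _ RE); apply: op_ext => // w wD.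
have [_ ->] := gP _ wD; apply: op_ext => // v.
by rewrite inE => /andP[_ /eqP <-]; rewrite ffunE.
Qed.

Definition power_algebra : graph_algebra :=
  GraphAlgebra power_op_ext power_op_set1 power_op_subst.

End PowerAlgebra.

Lemma recognizable_exists (S : finType) (B : nat) (P : graph_property (S * bool)%type) :
  recognizable B P ->
  recognizable (2 ^ B)
    (fun V R c => [exists X : {set V}, P V R (fun v => (c v, v \in X))]).
Proof.
move=> [A [pt [ev [leB PE]]]].
exists (power_algebra A), (fun x => [set pt (x, true); pt (x, false)]).
exists (fun t : {set car A} => [exists z in t, ev z]).
split.
  have -> : #|car (power_algebra A)| = 2 ^ #|car A|.
    by rewrite -(cardsT {set car A}) -powersetT card_powerset cardsT.
  by rewrite leq_exp2l.
move=> V R c; apply/existsP/exists_inP => [[X]|[z /imsetP[s]]].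
  rewrite PE => evX; exists (op [set: V] R (fun v => pt (c v, v \in X))) => //.
  apply/imsetP; exists [ffun v => pt (c v, v \in X)].
    rewrite inE; apply/forall_inP => v _; rewrite ffunE /= !inE.
    by case: (v \in X); rewrite eqxx ?orbT.
  by apply: op_ext => // v _; rewrite ffunE.
(* The choice of labels determines the quantified set; where the two labels of a vertex coincide,
   either membership gives the same value. *)
rewrite inE => /forall_inP sP -> evs; exists [set v | s v == pt (c v, true)].
rewrite PE; congr (ev _): evs; apply: op_ext => // v _ /=.
rewrite inE; case: eqP => [-> //|ns].
by have := sP v (in_setT v); rewrite !inE /= => /orP[] /eqP.
Qed.

Lemma recognizable_eq (S : finType) (B : nat) (P : graph_property S) (V : finType)
    (R R' : rel V) (c c' : V -> S) :
  recognizable B P -> (forall x y, x != y -> R x y = R' x y) -> c =1 c' ->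
  P V R c = P V R' c'.
Proof.
move=> [A [pt [ev [_ PE]]]] RR' cc'; rewrite !PE; congr (ev _).
by apply: op_ext => [x y _ _ /RR'|x _] //=; rewrite cc'.
Qed.

Definition single_label (S : finType) (a : pred S) : graph_property S :=
  fun V R c => #|[set v | a (c v)]| == 1.

(** Two distinct vertices satisfy [a] iff some set separates two vertices that satisfy it. This
    costs [2 ^ (2 * 2)], and the nonemptiness test doubles it to 32. *)
Lemma recognizable_single (S : finType) (a : pred S) :
  recognizable 32 (single_label a).
Proof.
pose two := recognizable_exists
  (recognizable_bool andb (recognizable_some (fun x : S * bool => a x.1 && x.2))
                          (recognizable_some (fun x : S * bool => a x.1 && ~~ x.2))).
have := recognizable_bool andb (recognizable_some a) (recognizable_not two).
move/recognizable_ext; apply => V R c /=.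
apply/cards1P/andP => [[v /setP vP]|[/existsP[v av] /existsPn ntwo]].
  have va w : a (c w) = (w == v) by have := vP w; rewrite !inE.
  split; first by apply/existsP; exists v; rewrite va.
  apply/existsPn => X; apply/negP => /andP[/existsP[x] + /existsP[y]] /=.
  rewrite !va => /andP[/eqP -> /= vX] /andP[/eqP -> /=].
  by rewrite vX.
exists v; apply/setP => w; rewrite !inE; apply/idP/eqP => [aw|-> //].
apply/eqP/negPn/negP => wv; have /negP[] := ntwo [set v].
by apply/andP; split; apply/existsP; [exists v|exists w];
   rewrite /= !inE ?eqxx ?av ?aw.
Qed.

Definition off_transitive (V : finType) (R : rel V) : bool :=
  [forall x, forall y, forall z,
     [&& x != y, y != z, x != z, R x y & R y z] ==> R x z].

(* Locked: a tower of exponentials that must never be evaluated. *)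
Definition transitive_bound : nat :=
  locked (2 ^ (2 ^ (2 ^ (32 * (8 * (8 * (8 * 2))))))).

(** A failure of transitivity is guessed as three sets, of which only the middle one must be a
    singleton: if the outer two are disjoint with no edge from the first to the third, any witnesses
    in them are distinct and non-adjacent. In the bound, 32 pays for the singleton, each 8 for an
    edge test, 2 for disjointness, and each exponential for a guessed set. *)
Lemma recognizable_transitive (S : finType) :
  recognizable transitive_bound
    (fun (V : finType) (R : rel V) (c : V -> S) => off_transitive R).
Proof.
pose SX := (S * bool * bool * bool)%type.
pose X (s : SX) := s.1.1.2; pose Y (s : SX) := s.1.2; pose Z (s : SX) := s.2.
pose bad := recognizable_bool andb (recognizable_single Y)
  (recognizable_bool andb (recognizable_edge X Y)
  (recognizable_bool andb (recognizable_edge Y Z)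
  (recognizable_bool andb (recognizable_not (recognizable_edge X Z))
    (recognizable_not (recognizable_some (fun s => X s && Z s)))))).
rewrite /transitive_bound -lock.
have := recognizable_not (recognizable_exists (recognizable_exists
         (recognizable_exists bad))).
move/recognizable_ext; apply => V R c /=.
apply/idP/idP => [/forallP tr|nbad].
  apply/existsPn => A; apply/existsPn => B; apply/existsPn => C.
  apply/negP => /and5P[/cards1P[y /setP yB] /existsP[x /existsP[y' /and4P[xy Rxy xA]]]].
  have inB w : (w \in B) = (w == y) by have := yB w; rewrite !inE /Y /=.
  rewrite /Y /= inB => /eqP ?; subst y'.
  move=> /existsP[y' /existsP[z /and4P[yz Ryz]]].
  rewrite /= inB => /eqP ?; subst y' => zC /existsPn nXZ /existsPn XZ.
  have xz : x != z.
    by apply: contraNneq (XZ x) => xz; apply/andP; split=> //; rewrite xz.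
  have /negP[] := nXZ x; apply/existsP; exists z; apply/and4P; split=> //.
  have /forallP/(_ y)/forallP/(_ z) := tr x.
  by rewrite xy yz xz Rxy Ryz.
apply/forallP => x; apply/forallP => y; apply/forallP => z.
apply/implyP => /and5P[xy yz xz Rxy Ryz]; apply: contraNT nbad => nR.
apply/existsP; exists [set x]; apply/existsP; exists [set y].
apply/existsP; exists [set z]; apply/and5P; split.
- apply/cards1P; exists y; apply/setP => w; by rewrite !inE.
- by apply/existsP; exists x; apply/existsP; exists y; rewrite xy Rxy !inE !eqxx.
- by apply/existsP; exists y; apply/existsP; exists z; rewrite yz Ryz !inE !eqxx.
- apply/existsPn => x'; apply/existsPn => z'; apply/and4P => [[_ + /set1P xx' /set1P zz']].
  by rewrite xx' zz' (negPf nR).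
apply/existsPn => w; rewrite /= !inE; apply/andP => [[/eqP -> /eqP xz']].
by rewrite xz' eqxx in xz.
Qed.

(** * TFOL formulas as properties of coloured graphs *)

Definition up_set (V : finType) (R : rel V) (A : {set V}) : bool :=
  ~~ [exists v, exists w, [&& v != w, R v w, v \in A & w \notin A]].

Lemma up_setP (V : finType) (R : rel V) (A : {set V}) :
  reflect (forall v w, v != w -> R v w -> v \in A -> w \in A) (up_set R A).
Proof.
apply: (iffP existsPn) => [up v w vw Rvw vA|up v].
  apply: contraNT (up v) => wA; apply/existsP; exists w.
  by rewrite vw Rvw vA.
apply/existsPn => w; apply/and4P => [[vw Rvw vA]].
by rewrite (up v w).
Qed.

Definition up_topology (V : finType) (R : rel V) : {set {set V}} :=
  [set A | up_set R A].

Definition color (r p u : nat) : finType :=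
  ({ffun 'I_r -> bool} * {ffun 'I_p -> bool} * {ffun 'I_u -> bool})%type.

(** The environment is stored in the vertices: each one knows which constants and point variables
    denote it and which open sets contain it. Binding a variable thus adds one bit to every
    label. *)
Definition coloring (r p u : nat) (V : finType) (O : {set {set V}})
    (cst : 'I_r -> V) (v : 'I_p -> V) (w : 'I_u -> {A : {set V} | A \in O})
    (x : V) : color r p u :=
  ([ffun i => cst i == x], [ffun i => v i == x], [ffun i => x \in val (w i)]).

Definition term_pred (r p u : nat) (t : term r p) : pred (color r p u) :=
  fun c => match t with Var i => c.1.2 i | Cst a => c.1.1 a end.

Lemma term_pred_coloring (r p u : nat) (V : finType) (O : {set {set V}})
    (cst : 'I_r -> V) (v : 'I_p -> V) (w : 'I_u -> {A : {set V} | A \in O})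
    (t : term r p) (x : V) :
  term_pred t (coloring cst v w x) = (eval_term cst v t == x).
Proof. by case: t => i; rewrite /= ffunE. Qed.

Definition push_point (r p u : nat) (cb : (color r p u * bool)%type) :
    color r p.+1 u :=
  (cb.1.1.1, [ffun i => if unlift ord0 i is Some j then cb.1.1.2 j else cb.2],
   cb.1.2).

Definition push_open (r p u : nat) (cb : (color r p u * bool)%type) :
    color r p u.+1 :=
  (cb.1.1, [ffun i => if unlift ord0 i is Some j then cb.1.2 j else cb.2]).

Lemma coloring_point (r p u : nat) (V : finType) (O : {set {set V}})
    (cst : 'I_r -> V) (v : 'I_p -> V) (w : 'I_u -> {A : {set V} | A \in O})
    (x y : V) :
  coloring cst (env_cons x v) w y = push_point (coloring cst v w y, y \in [set x]).
Proof.
congr (_, _, _); apply/ffunP => i; rewrite !ffunE /env_cons.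
by case: unlift => [j|]; rewrite ?ffunE // inE eq_sym.
Qed.

Lemma coloring_open (r p u : nat) (V : finType) (O : {set {set V}})
    (cst : 'I_r -> V) (v : 'I_p -> V) (w : 'I_u -> {A : {set V} | A \in O})
    (A : {A : {set V} | A \in O}) (y : V) :
  coloring cst v (env_cons A w) y = push_open (coloring cst v w y, y \in val A).
Proof.
congr (_, _, _); apply/ffunP => i; rewrite !ffunE /env_cons.
by case: unlift => [j|]; rewrite ?ffunE.
Qed.

(** A point quantifier ranges over sets passing the singleton test, hence the factor 32; an open
    quantifier ranges over sets that no edge leaves, hence the factor 8 of an edge test. *)
Fixpoint tfol_bound (r p u : nat) (phi : formula r p u) : nat :=
  match phi with
  | EqPoint _ _ _ _ => 2
  | EqOpen _ _ _ _ => 2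
  | Defs.Mem _ _ _ _ => 2
  | Not _ _ a => tfol_bound a
  | And _ _ a b => tfol_bound a * tfol_bound b
  | Or _ _ a b => tfol_bound a * tfol_bound b
  | Imp _ _ a b => tfol_bound a * tfol_bound b
  | ExPoint _ _ a => 2 ^ (32 * tfol_bound a)
  | AllPoint _ _ a => 2 ^ (32 * tfol_bound a)
  | ExOpen _ _ a => 2 ^ (8 * tfol_bound a)
  | AllOpen _ _ a => 2 ^ (8 * tfol_bound a)
  end.

Definition up_sat (r p u : nat) (phi : formula r p u) (V : finType) (R : rel V)
    (cst : 'I_r -> V) (v : 'I_p -> V)
    (w : 'I_u -> {A : {set V} | A \in up_topology R}) : bool :=
  sat (fun x (A : {A : {set V} | A \in up_topology R}) => x \in val A) cst phi v w.

Lemma recognizable_ex_point (r p u B : nat) (P : graph_property (color r p.+1 u)) :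
  recognizable B P ->
  exists2 Q : graph_property (color r p u), recognizable (2 ^ (32 * B)) Q &
    forall (V : finType) (R : rel V) (cst : 'I_r -> V) (v : 'I_p -> V)
        (w : 'I_u -> {A : {set V} | A \in up_topology R}),
      Q V R (coloring cst v w) =
      [exists x, P V R (coloring cst (env_cons x v) w)].
Proof.
move=> recP; eexists; first exact: recognizable_exists (recognizable_bool andb
  (recognizable_single (fun s => s.2)) (recognizable_relabel (@push_point r p u) recP)).
move=> V R cst v w /=.
have PE x : P V R (coloring cst (env_cons x v) w) =
   P V R (@push_point r p u \o (fun y => (coloring cst v w y, y \in [set x]))).
  by apply: recognizable_eq recP _ _ => // y; rewrite coloring_point.
apply/existsP/existsP => [[X /andP[/cards1P[x /setP xX]]]|[x Px]].
  have -> : X = [set x] by apply/setP => y; rewrite -xX inE.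
  by rewrite -PE; exists x.
exists [set x]; rewrite -PE Px andbT; apply/cards1P; exists x.
by apply/setP => y; rewrite !inE.
Qed.

Lemma recognizable_ex_open (r p u B : nat) (P : graph_property (color r p u.+1)) :
  recognizable B P ->
  exists2 Q : graph_property (color r p u), recognizable (2 ^ (8 * B)) Q &
    forall (V : finType) (R : rel V) (cst : 'I_r -> V) (v : 'I_p -> V)
        (w : 'I_u -> {A : {set V} | A \in up_topology R}),
      Q V R (coloring cst v w) =
      [exists A, P V R (coloring cst v (env_cons A w))].
Proof.
move=> recP; eexists; first exact: recognizable_exists (recognizable_bool andb
  (recognizable_not (recognizable_edge (fun s => s.2) (fun s => ~~ s.2)))
  (recognizable_relabel (@push_open r p u) recP)).
move=> V R cst v w /=.
have PE (A : {A : {set V} | A \in up_topology R}) :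
   P V R (coloring cst v (env_cons A w)) =
   P V R (@push_open r p u \o (fun y => (coloring cst v w y, y \in val A))).
  by apply: recognizable_eq recP _ _ => // y; rewrite coloring_open.
apply/existsP/existsP => [[X /andP[upX PX]]|[A PA]].
  have XO : X \in up_topology R by rewrite inE.
  by exists (exist _ X XO); rewrite PE.
exists (val A); rewrite -PE PA andbT.
by have := valP A; rewrite inE.
Qed.

Lemma recognizable_sat (r p u : nat) (phi : formula r p u) :
  exists2 P : graph_property (color r p u), recognizable (tfol_bound phi) P &
    forall (V : finType) (R : rel V) (cst : 'I_r -> V) (v : 'I_p -> V)
        (w : 'I_u -> {A : {set V} | A \in up_topology R}),
      up_sat phi cst v w = P V R (coloring cst v w).
Proof.
elim: phi => {p u}.
- move=> p u s t; eexists.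
    exact: recognizable_some (fun c => term_pred s c && term_pred t c).
  move=> V R cst v w; rewrite /up_sat /=; apply/eqP/existsP => [st|[x]].
    by exists (eval_term cst v s); rewrite !term_pred_coloring st eqxx.
  by rewrite !term_pred_coloring => /andP[/eqP -> /eqP ->].
- move=> p u i j; eexists.
    exact: recognizable_not (recognizable_some (fun c : color r p u => c.2 i != c.2 j)).
  move=> V R cst v w; rewrite /up_sat /=; apply/eqP/existsPn => [ij x|ij].
    by rewrite !ffunE ij eqxx.
  apply: val_inj; apply/setP => x; apply/eqP.
  by have := ij x; rewrite !ffunE negbK.
- move=> p u t i; eexists.
    exact: recognizable_some (fun c : color r p u => term_pred t c && c.2 i).
  move=> V R cst v w; rewrite /up_sat /=; apply/idP/existsP => [ti|[x]].
    by exists (eval_term cst v t); rewrite term_pred_coloring eqxx ffunE.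
  by rewrite term_pred_coloring ffunE => /andP[/eqP ->].
- move=> p u a [P recP PE]; eexists; first exact: recognizable_not recP.
  by move=> V R cst v w; rewrite /= -PE.
- move=> p u a [P recP PE] b [Q recQ QE].
  exists (fun V R c => andb (P V R c) (Q V R c)); first exact: recognizable_bool recP recQ.
  by move=> V R cst v w; rewrite /= -PE -QE.
- move=> p u a [P recP PE] b [Q recQ QE].
  exists (fun V R c => orb (P V R c) (Q V R c)); first exact: recognizable_bool recP recQ.
  by move=> V R cst v w; rewrite /= -PE -QE.
- move=> p u a [P recP PE] b [Q recQ QE].
  exists (fun V R c => implb (P V R c) (Q V R c)); first exact: recognizable_bool recP recQ.
  by move=> V R cst v w; rewrite /= -PE -QE.
- move=> p u a [P recP PE]; have [Q recQ QE] := recognizable_ex_point recP.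
  exists Q => // V R cst v w; rewrite QE.
  by apply: eq_existsb => x; rewrite -PE.
- move=> p u a [P recP PE].
  have [Q recQ QE] := recognizable_ex_point (recognizable_not recP).
  eexists; first exact: recognizable_not recQ.
  move=> V R cst v w /=; rewrite QE negb_exists.
  by apply: eq_forallb => x; rewrite negbK -PE.
- move=> p u a [P recP PE]; have [Q recQ QE] := recognizable_ex_open recP.
  exists Q => // V R cst v w; rewrite QE.
  by apply: eq_existsb => x; rewrite -PE.
- move=> p u a [P recP PE].
  have [Q recQ QE] := recognizable_ex_open (recognizable_not recP).
  eexists; first exact: recognizable_not recQ.
  move=> V R cst v w /=; rewrite QE negb_exists.
  by apply: eq_forallb => x; rewrite negbK -PE.
Qed.

(** * Finite topologies and preorders *)

Definition rel_of (V : finType) (R : {set V * V}) : rel V := fun x y => (x, y) \in R.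

Definition off_diagonal (V : finType) (R : {set V * V}) : bool :=
  [forall x, (x, x) \notin R].

(** Loops are left out because the algebras ignore them: with an empty diagonal each preorder has
    exactly one representing relation, so counting relations counts topologies. *)
Definition specialization (V : finType) (O : {set {set V}}) : {set V * V} :=
  [set xy | (xy.1 != xy.2) && [forall A in O, (xy.1 \in A) ==> (xy.2 \in A)]].

Lemma is_topology_up (V : finType) (R : rel V) : is_topology (up_topology R).
Proof.
apply/and4P; split.
- by rewrite inE; apply/up_setP => v w _ _; rewrite !inE.
- by rewrite inE; apply/up_setP => v w _ _; rewrite !inE.
- apply/forallP => S; apply/implyP => /subsetP SO; rewrite inE.
  apply/up_setP => v w vw Rvw /bigcupP[A AS vA]; apply/bigcupP; exists A => //.
  by have := SO A AS; rewrite inE => /up_setP/(_ v w); apply.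
apply/forall_inP => A; rewrite inE => /up_setP upA.
apply/forall_inP => B; rewrite inE => /up_setP upB.
rewrite inE; apply/up_setP => v w vw Rvw; rewrite !inE => /andP[vA vB].
by rewrite (upA v w vw Rvw vA) (upB v w vw Rvw vB).
Qed.

Lemma off_diagonal_specialization (V : finType) (O : {set {set V}}) :
  off_diagonal (specialization O).
Proof. by apply/forallP => x; rewrite inE eqxx. Qed.

Lemma off_transitive_specialization (V : finType) (O : {set {set V}}) :
  off_transitive (rel_of (specialization O)).
Proof.
apply/forallP => x; apply/forallP => y; apply/forallP => z.
apply/implyP => /and5P[_ _ xz]; rewrite /rel_of !inE /= xz.
move=> /andP[_ /forall_inP xy] /andP[_ /forall_inP yz].
apply/forall_inP => A AO; apply/implyP => xA.
exact: (implyP (yz A AO)) (implyP (xy A AO) xA).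
Qed.

Lemma up_topologyK (V : finType) (R : {set V * V}) :
  off_diagonal R -> off_transitive (rel_of R) ->
  specialization (up_topology (rel_of R)) = R.
Proof.
move=> /forallP oR /forallP tR; apply/setP => -[x y]; rewrite inE /=.
apply/andP/idP => [[xy /forall_inP H]|Rxy].
  (* The principal up-set of [x] is an open set that excludes every point not above [x]. *)
  have xA : [set z | (z == x) || ((x, z) \in R)] \in up_topology (rel_of R).
    rewrite inE; apply/up_setP => v w vw; rewrite /rel_of !inE => Rvw.
    case/orP => [/eqP vx|Rxv]; first by rewrite -vx Rvw orbT.
    have [//|wx] := eqVneq w x.
    have [vx|vx] := eqVneq v x; first by rewrite -vx Rvw orbT.
    have /forallP/(_ v)/forallP/(_ w) := tR x.
    by rewrite (eq_sym x v) vx vw (eq_sym x w) wx /rel_of Rxv Rvw.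
  have := H _ xA; rewrite !inE eqxx /= eq_sym => /orP[/eqP yx|//].
  by rewrite yx eqxx in xy.
have xy : x != y.
  by apply: contraTneq Rxy => ->; apply: oR.
split=> //; apply/forall_inP => A; rewrite inE => /up_setP upA.
by apply/implyP => xA; apply: upA xy _ xA.
Qed.

Lemma specializationK (V : finType) (O : {set {set V}}) :
  is_topology O -> up_topology (rel_of (specialization O)) = O.
Proof.
move=> /and4P[O0 OT /forallP OU /forall_inP OI].
have Obig (I : finType) (Q : pred I) (F : I -> {set V}) :
    (forall i, Q i -> F i \in O) -> \bigcap_(i | Q i) F i \in O.
  move=> FO; elim/big_ind: _ => // A B AO BO; exact: (forall_inP (OI A AO)).
(* By finiteness every point has a smallest open neighbourhood, and an up-set is the union of those
   of its points. *)
pose nb x := \bigcap_(A in O | x \in A) A.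
have nbO x : nb x \in O by apply: Obig => A /andP[].
apply/setP => A; rewrite inE; apply/up_setP/idP => [upA|AO x y xy].
  have -> : A = cover [set nb x | x in A].
    apply/setP => y; apply/idP/bigcupP => [yA|[B /imsetP[x xA ->]] yx].
      exists (nb y); first exact: imset_f.
      by apply/bigcapP => B /andP[].
    have [<- //|xy] := eqVneq x y.
    apply: (upA x y xy _ xA); rewrite /rel_of inE /= xy.
    apply/forall_inP => C CO; apply/implyP => xC.
    by move/bigcapP: yx => /(_ C); rewrite CO xC => /(_ isT).
  apply: (implyP (OU _)); apply/subsetP => B /imsetP[x _ ->]; exact: nbO.
by rewrite /rel_of inE /= => /andP[_ /forall_inP/(_ A AO)/implyP].
Qed.

Lemma card_topologies (V : finType) (Q : pred {set {set V}}) :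
  #|[set O | is_topology O && Q O]| =
  #|[set R : {set V * V} | off_diagonal R &&
      (off_transitive (rel_of R) && Q (up_topology (rel_of R)))]|.
Proof.
rewrite -(@card_in_imset _ _ (@specialization V)); last first.
  move=> O O'; rewrite !inE => /andP[tO _] /andP[tO' _] sOO'.
  by rewrite -(specializationK tO) sOO' specializationK.
apply: eq_card => R; rewrite [RHS]inE; apply/imsetP/and3P => [[O]|[oR tR QR]].
  rewrite inE => /andP[tO QO] ->.
  by rewrite off_diagonal_specialization off_transitive_specialization specializationK.
exists (up_topology (rel_of R)); last by rewrite up_topologyK.
by rewrite inE is_topology_up.
Qed.

(** * Rotations of blocks *)

(** A fibre of [f] is independent since [f] has no fixed point, so a fibre with [k] elements settles
    the matter. Otherwise picking [x] and discarding [x], [f x] and the fibre over [x] costs at most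
    [k.+1] points per pick. With [j = k] this is the origin of [k * k.+1]. *)
Lemma independent_set_greedy (T : finType) (f : T -> T) (k j : nat) (D : {set T}) :
  (forall x, f x != x) -> j * k.+1 <= #|D| ->
  exists2 J : {set T}, {in J, forall x, f x \notin J} &
    (k <= #|J|) \/ (J \subset D /\ j <= #|J|).
Proof.
move=> nfix; elim: j D => [|j IHj] D leD.
  by exists set0 => [x|]; [rewrite inE | right; rewrite sub0set].
have [x xD] : exists x, x \in D.
  by apply/card_gt0P; apply: leq_trans leD; rewrite mulSn.
have [lek|ltk] := leqP k #|f @^-1: [set x]|.
  exists (f @^-1: [set x]); last by left.
  by move=> y; rewrite !inE => /eqP ->; apply: nfix.
have [|J indJ] := IHj (D :\: (x |: (f x |: f @^-1: [set x]))).
  have : #|D :&: (x |: (f x |: f @^-1: [set x]))| <= k.+1.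
    apply: leq_trans (subset_leq_card (subsetIr _ _)) _.
    rewrite !cardsU1.
    by have := leq_add (leq_b1 (x \notin f x |: f @^-1: [set x]))
                       (leq_add (leq_b1 (f x \notin f @^-1: [set x])) ltk); lia.
  by have := cardsID (x |: (f x |: f @^-1: [set x])) D; rewrite mulSn in leD; lia.
case=> [leJ|[sJ leJ]]; first by exists J => //; left.
have outJ y : y \in x |: (f x |: f @^-1: [set x]) -> y \notin J.
  by move=> yE; apply/negP => /(subsetP sJ); rewrite inE yE.
exists (x |: J).
  move=> y; rewrite !inE => /orP[/eqP ->|yJ].
    by rewrite (negPf (nfix x)) /= outJ // !inE eqxx orbT.
  rewrite (negPf (indJ y yJ)) orbF; apply: contraL yJ => fy.
  by apply: outJ; rewrite !inE fy !orbT.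
right; split.
  rewrite subUset sub1set xD; apply: subset_trans sJ _; exact: subsetDl.
by rewrite cardsU1 outJ ?setU11 // ltnS.
Qed.

Lemma independent_set (T : finType) (f : T -> T) (k : nat) :
  (forall x, f x != x) -> k * k.+1 <= #|T| ->
  exists2 J : {set T}, {in J, forall x, f x \notin J} & k <= #|J|.
Proof.
move=> nfix; rewrite -cardsT => /(independent_set_greedy nfix)[J indJ].
by case=> [|[_]] leJ; exists J.
Qed.

Section Rotations.

Variables (p' N : nat) (U : finType).

Local Notation blocks := ('I_N * 'I_p'.+1)%type.
Local Notation V := (blocks + U)%type.
Local Notation rotgroup := {dffun 'I_N -> 'I_p'.+1}.

Definition rotate (h : rotgroup) (x : V) : V :=
  match x with inl ci => inl (ci.1, (ci.2 + h ci.1)%R) | inr y => inr y end.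

Lemma rotate1 (x : V) : rotate 1%g x = x.
Proof. by case: x => [[c i]|y] //=; rewrite ffunE /= GRing.addr0. Qed.

Lemma rotateM (h g : rotgroup) (x : V) : rotate (h * g)%g x = rotate g (rotate h x).
Proof. by case: x => [[c i]|y] //=; rewrite ffunE GRing.addrA. Qed.

Lemma rotateK (h : rotgroup) : cancel (rotate h) (rotate h^-1%g).
Proof. by move=> x; rewrite -rotateM mulgV rotate1. Qed.

Lemma rotateVK (h : rotgroup) : cancel (rotate h^-1%g) (rotate h).
Proof. by move=> x; rewrite -rotateM mulVg rotate1. Qed.

Definition rotate_rel (R : {set V * V}) (h : rotgroup) : {set V * V} :=
  [set xy | (rotate h^-1%g xy.1, rotate h^-1%g xy.2) \in R].

Lemma rotate_rel1 (R : {set V * V}) : rotate_rel R 1%g = R.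
Proof. by apply/setP => -[x y]; rewrite inE /= invg1 !rotate1. Qed.

Lemma rotate_relM (R : {set V * V}) (h g : rotgroup) :
  rotate_rel R (h * g)%g = rotate_rel (rotate_rel R h) g.
Proof. by apply/setP => -[x y]; rewrite !inE /= invMg !rotateM. Qed.

Canonical rotate_action := TotalAction rotate_rel1 rotate_relM.

Lemma mem_rotate_rel (R : {set V * V}) (h : rotgroup) (x y : V) :
  ((rotate h x, rotate h y) \in rotate_rel R h) = ((x, y) \in R).
Proof. by rewrite inE /= !rotateK. Qed.

Lemma rotate_fixP (R : {set V * V}) (h : rotgroup) :
  reflect (forall x y, ((rotate h x, rotate h y) \in R) = ((x, y) \in R))
          (rotate_rel R h == R).
Proof.
apply: (iffP eqP) => [fix_h x y|fix_h].
  by rewrite -[in LHS]fix_h mem_rotate_rel.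
by apply/setP => -[x y]; rewrite inE /= -fix_h !rotateVK.
Qed.

Definition rotate_one (c : 'I_N) : rotgroup :=
  [ffun i => if i == c then Zp1 else 0%R : 'I_p'.+1].

Definition block_fixed (R : {set V * V}) (c : 'I_N) : bool :=
  rotate_rel R (rotate_one c) == R.

Lemma rotgroupC (h g : rotgroup) : (h * g = g * h)%g.
Proof. by apply/ffunP => i; rewrite !ffunE; exact: GRing.addrC. Qed.

Lemma rotgroupX (h : rotgroup) (n : nat) (i : 'I_N) : (h ^+ n)%g i = (h i *+ n)%R.
Proof.
elim: n => [|n IHn]; first by rewrite expg0 ffunE.
by rewrite expgS ffunE IHn GRing.mulrS.
Qed.

(** Rotations commute, so which blocks are symmetric depends only on the orbit. *)
Lemma block_fixed_rotate (R : {set V * V}) (h : rotgroup) (c : 'I_N) :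
  block_fixed (rotate_rel R h) c = block_fixed R c.
Proof.
rewrite /block_fixed -rotate_relM rotgroupC rotate_relM.
by rewrite (inj_eq (act_inj rotate_action h)).
Qed.

Hypothesis p_prime : prime p'.+1.

(** Primality enters here: a symmetry that moves a block at all has a power that rotates it by
    one. *)
Lemma ord_mulrn_eq1 (a : 'I_p'.+1) : a != 0%R -> exists n, (a *+ n)%R = Zp1.
Proof.
move=> a0.
have a_gt0 : 0 < a by rewrite lt0n.
have co : coprime a p'.+1.
  rewrite coprime_sym prime_coprime //; apply/negP => /(dvdn_leq a_gt0).
  by rewrite leqNgt ltn_ord.
have [u v uP _] := egcdnP p'.+1 a_gt0.
exists u; apply: val_inj; rewrite /= Zp_mulrn /=.
by rewrite mulnC uP (eqP co) modnMDl.
Qed.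

(* If no partner i existed, the stabilizer would realize the rotation of c on any
   pair of points, since a pair that meets block c meets at most one other block. *)
Lemma partner_block (R : {set V * V}) (c : 'I_N) :
  1 < N -> ~~ block_fixed R c ->
  exists i, (i != c) &&
    [forall h, (rotate_rel R h == R) ==> (h i == 0%R) ==> (h c == 0%R)].
Proof.
move=> N2 nfix; apply/existsP; apply: contraNT nfix => /existsPn nopart.
have unitP i : i != c ->
    exists h, [/\ rotate_rel R h == R, h i = 0%R & h c = Zp1].
  move=> ic; have := nopart i; rewrite ic /= => /forallPn[h].
  rewrite !negb_imply => /and3P[fix_h /eqP hi hc].
  have [n hn] := ord_mulrn_eq1 hc; exists (h ^+ n)%g; rewrite !rotgroupX hi hn.
  split=> //; last by rewrite GRing.mul0rn.
  have hC : h \in ('C[R | rotate_action])%g by apply/astab1P; exact/eqP.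
  by apply/eqP; have /astab1P := groupX n hC.
have [j jc] : exists j : 'I_N, j != c.
  apply/existsP; rewrite -negb_forall; apply/negP => /forallP all_c.
  have := all_c (Ordinal N2); have := all_c (Ordinal (ltnW N2)).
  by move=> /eqP <- /eqP/(congr1 val).
apply/rotate_fixP => x y.
(* The block of [z] when it differs from [c]; the default [j] is any other block, available because
   [1 < N]. *)
pose other (z : V) : 'I_N := if z is inl ci then if ci.1 == c then j else ci.1 else j.
have other_c z : other z != c by case: z => [[d i]|z] //=; case: (eqVneq d c).
have rotE (h : rotgroup) (z : V) i : h i = 0%R -> h c = Zp1 -> (other z == i) ->
    rotate h z = rotate (rotate_one c) z.
  case: z => [[d a]|z] //= hi hc; rewrite ffunE.
  by case: (eqVneq d c) => [-> _|_ /eqP ->]; rewrite ?hi ?hc.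
have rotE2 (h : rotgroup) (z : V) : h c = Zp1 -> (if z is inl ci then ci.1 == c else true) ->
    rotate h z = rotate (rotate_one c) z.
  by case: z => [[d a]|z] //= hc /eqP ->; rewrite ffunE eqxx hc.
have [xc|xc] := boolP (if x is inl ci then ci.1 == c else true).
  have [h [fix_h hi hc]] := unitP _ (other_c y).
  by rewrite -(rotE2 h x) // -(rotE h y _ hi) // (rotate_fixP _ _ fix_h).
have [yc|yc] := boolP (if y is inl ci then ci.1 == c else true).
  have [h [fix_h hi hc]] := unitP _ (other_c x).
  by rewrite -(rotE2 h y) // -(rotE h x _ hi) // (rotate_fixP _ _ fix_h).
have rot_id (z : V) : ~~ (if z is inl ci then ci.1 == c else true) ->
    rotate (rotate_one c) z = z.
  by case: z => [[d a]|z] //= /negPf dc; rewrite ffunE dc GRing.addr0.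
by rewrite !rot_id.
Qed.

Lemma card_supported (J : {set 'I_N}) :
  #|[set h : rotgroup | [forall i, (i \notin J) ==> (h i == 0%R)]]| = p'.+1 ^ #|J|.
Proof.
transitivity #|pffun_on (0%R : 'I_p'.+1) J predT|; last first.
  by rewrite card_pffun_on cardT size_enum_ord.
apply: eq_card => h; rewrite inE.
apply/forallP/pffun_onP => [hP|[/subsetP hP _] i].
  split=> //; apply/subsetP => i; rewrite inE; apply: contraNT => iJ.
  exact: (implyP (hP i)).
by apply/implyP; apply: contraNT => hi; apply: hP.
Qed.

(** Let [J] be a set of at least [k] blocks that contains no partner of its members. A symmetry
    supported on [J] is trivial on all partners, hence on [J]. So the group of rotations supported
    on [J], of order [p ^ #|J|], meets the stabilizer trivially, and its order divides the length of
    the orbit. *)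
Lemma dvdn_card_unfixed (k : nat) (S : {set {set V * V}}) :
  0 < k -> k * k.+1 <= N ->
  (forall R h, R \in S -> rotate_rel R h \in S) ->
  (forall R c, R \in S -> ~~ block_fixed R c) ->
  p'.+1 ^ k %| #|S|.
Proof.
move=> k0 leN stabS nfix.
have N2 : 1 < N by apply: leq_trans leN; nia.
have actS : [acts [set: rotgroup], on S | rotate_action].
  apply/actsP => h _ R; apply/idP/idP => RS; last exact: stabS.
  by rewrite -[R](actK rotate_action h) /=; apply: stabS.
rewrite -(acts_sum_card_orbit actS); apply: dvdn_sum => _ /imsetP[R RS ->].
have partP c : exists i, (i != c) &&
    [forall h, (rotate_rel R h == R) ==> (h i == 0%R) ==> (h c == 0%R)].
  by apply: partner_block => //; apply: nfix.
have [f fP] := fin_all_exists partP.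
have [J indJ leJ] : exists2 J : {set 'I_N}, {in J, forall x, f x \notin J} & k <= #|J|.
  apply: independent_set; last by rewrite card_ord.
  by move=> c; have /andP[] := fP c.
pose GJ := [set h : rotgroup | [forall i, (i \notin J) ==> (h i == 0%R)]].
have gGJ : group_set GJ.
  apply/group_setP; split.
    by rewrite inE; apply/forallP => i; rewrite ffunE eqxx implybT.
  move=> h g; rewrite !inE => /forallP hP /forallP gP; apply/forallP => i.
  apply/implyP => iJ; rewrite ffunE (eqP (implyP (hP i) iJ)) (eqP (implyP (gP i) iJ)).
  by rewrite mulg1.
pose H := ('C_[set: rotgroup][R | rotate_action])%G.
have TI : (Group gGJ :&: H = 1)%g.
  apply/trivgP/subsetP => h; rewrite !inE => /andP[/forallP hJ /=].
  rewrite sub1set inE => /eqP fix_h.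
  apply/eqP/ffunP => c; rewrite ffunE; apply/eqP.
  have [cJ|cJ] := boolP (c \in J); last exact: (implyP (hJ c)).
  have /andP[_ /forallP/(_ h)] := fP c; rewrite fix_h eqxx /= => /implyP; apply.
  exact: (implyP (hJ _)) (indJ c cJ).
have : p'.+1 ^ #|J| * #|H| %| #|[set: rotgroup]|.
  rewrite -card_supported -(TI_cardMg TI) -norm_joinEl.
    by rewrite cardSg // subsetT.
  by rewrite cents_norm //; apply/centsP => h _ g _; apply: rotgroupC.
rewrite -(card_orbit_stab rotate_action [set: rotgroup]%G R) dvdn_pmul2r ?cardG_gt0 //.
by apply: dvdn_trans; rewrite dvdn_exp2l.
Qed.

End Rotations.

(** * Contraction of blocks *)

Definition mult (V : finType) (T : eqType) (t : V -> T) (l : T) : nat :=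
  \sum_(v : V) (t v == l).

Lemma mult_card (V : finType) (T : eqType) (t : V -> T) (l : T) :
  mult t l = size (enum [pred v | t v == l]).
Proof.
rewrite -cardE -sum1_card big_mkcond; apply: eq_bigr => v _.
by rewrite inE; case: eqP.
Qed.

Lemma sum_mult (V T : finType) (t : V -> T) : \sum_l mult t l = #|V|.
Proof.
rewrite exchange_big -sum1_card; apply: eq_bigr => v _ /=.
by rewrite (bigD1 (t v)) //= eqxx big1 // => l; rewrite eq_sym => /negPf ->.
Qed.

(** Vertices are matched by their rank in the enumeration of their label class. An empty [W] is
    treated apart because [nth] needs a default. *)
Lemma mult_bij (V W T : finType) (t : V -> T) (s : W -> T) :
  mult t =1 mult s -> exists2 f : V -> W, bijective f & forall v, s (f v) = t v.
Proof.
move=> ts.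
have cVW : #|V| = #|W| by rewrite -(sum_mult t) -(sum_mult s); apply: eq_bigr => l _.
pose eV v := enum [pred x | t x == t v]; pose eW v := enum [pred y | s y == t v].
have szE v : size (eV v) = size (eW v) by rewrite -!mult_card.
have idx v : index v (eV v) < size (eW v).
  by rewrite -szE index_mem mem_enum inE eqxx.
case: (pickP (mem W)) => [w0 _|W0]; last first.
  have V0 (v : V) : False.
    have : 0 < #|V| by apply/card_gt0P; exists v.
    by rewrite cVW eq_card0.
  have W0' (w : W) : False by have := W0 w.
  exists (fun v => False_rect W (V0 v)) => [|v]; last by case: (V0 v).
  by exists (fun w => False_rect V (W0' w)) => x; [case: (V0 x) | case: (W0' x)].
pose f v := nth w0 (eW v) (index v (eV v)).
have sf v : s (f v) = t v.
  by have := mem_nth w0 (idx v); rewrite mem_enum inE => /eqP.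
exists f => //; apply: inj_card_bij; last by rewrite cVW.
move=> v v' ff; have tt : t v = t v' by rewrite -!sf ff.
have eVE : eV v' = eV v by rewrite /eV tt.
have eWE : eW v' = eW v by rewrite /eW tt.
move: ff; rewrite /f eWE eVE => /eqP; rewrite nth_uniq ?enum_uniq ?idx //; last first.
  by rewrite -eWE -eVE idx.
by move=> /eqP ii; apply: (index_inj v _ _ ii); rewrite mem_enum inE ?tt.
Qed.

Lemma Zp1_mulrn (p' : nat) (d : 'I_p'.+1) : (Zp1 *+ d)%R = d.
Proof. by rewrite Zp_mulrn; apply: val_inj; rewrite /= modnMml mul1n modn_small. Qed.

Section Counting.

Variables (A : graph_algebra) (ev : pred (car A)).

Definition accepted (V : finType) (t : V -> car A) (R : {set V * V}) : bool :=
  off_diagonal R && ev (op [set: V] (rel_of R) t).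

Definition count_graphs (V : finType) (t : V -> car A) : nat :=
  #|[set R | accepted t R]|.

(** Isomorphism invariance is the substitution law with singleton fibres. *)
Lemma op_bij (V W : finType) (f : V -> W) (R : rel V) (S : rel W)
    (t : V -> car A) (s : W -> car A) :
  bijective f -> (forall x y, x != y -> R x y = S (f x) (f y)) ->
  (forall v, s (f v) = t v) -> op [set: V] R t = op [set: W] S s.
Proof.
move=> [g fK gK] RS st; rewrite (@op_subst _ _ _ f _ _ S); last first.
  by move=> x y _ _ fxy; apply: RS; apply: contraNneq fxy => ->.
have -> : f @: [set: V] = [set: W].
  by apply/setP => w; rewrite inE; apply/imsetP; exists (g w).
apply: op_ext => // w _.
have -> : [set x in [set: V] | f x == w] = [set g w].
  by apply/setP => x; rewrite !inE -(can_eq gK) fK.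
by rewrite op_set1 -st gK.
Qed.

Lemma count_graphs_bij (V W : finType) (f : V -> W) (t : V -> car A) (s : W -> car A) :
  bijective f -> (forall v, s (f v) = t v) -> count_graphs t = count_graphs s.
Proof.
move=> bf st; have [g fK gK] := bf.
pose F (S : {set W * W}) : {set V * V} := [set xy | (f xy.1, f xy.2) \in S].
have Finj : injective F.
  move=> S S' /setP FE; apply/setP => -[x y].
  by have := FE (g x, g y); rewrite !inE /= !gK.
rewrite /count_graphs -(card_imset _ Finj).
apply: eq_card => R; rewrite inE; apply/idP/imsetP => [aR|[S]].
  exists [set xy | (g xy.1, g xy.2) \in R]; last first.
    by apply/setP => -[x y]; rewrite !inE /= !fK.
  move: aR; rewrite inE /accepted => /andP[/forallP oR evR]; apply/andP; split.
    by apply/forallP => x; rewrite inE.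
  congr (ev _): evR; apply: op_bij bf _ st => x y _.
  by rewrite /rel_of inE /= !fK.
rewrite inE => /andP[/forallP oS evS] ->; apply/andP; split.
  by apply/forallP => x; rewrite inE.
congr (ev _): evS; apply/esym; apply: op_bij bf _ st => x y _.
by rewrite /rel_of inE.
Qed.

Lemma count_graphs_mult (V W : finType) (t : V -> car A) (s : W -> car A) :
  mult t =1 mult s -> count_graphs t = count_graphs s.
Proof. by move=> /mult_bij[f bf st]; apply: count_graphs_bij bf st. Qed.

Definition sum_label (X U : finType) (x : X -> car A) (u : U -> car A)
    (v : X + U) : car A :=
  match v with inl a => x a | inr b => u b end.

Lemma mult_sum (X U : finType) (x : X -> car A) (u : U -> car A) (l : car A) :
  mult (sum_label x u) l = mult x l + mult u l.
Proof. by rewrite /mult big_sumType. Qed.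

Section Contraction.

Variables (p' N : nat) (l : car A).

Local Notation blocks := ('I_N * 'I_p'.+1)%type.

Section WithRest.

Variables (U : finType) (u : U -> car A).

Local Notation V := (blocks + U)%type.

Definition block_label : V -> car A := sum_label (fun _ : blocks => l) u.

Lemma accepted_rotate (R : {set V * V}) (h : {dffun 'I_N -> 'I_p'.+1}) :
  accepted block_label (rotate_rel R h) = accepted block_label R.
Proof.
congr (_ && ev _).
  apply/forallP/forallP => oR x; last by rewrite inE.
  by have := oR (rotate h x); rewrite mem_rotate_rel.
apply/esym; apply: (@op_bij _ _ (rotate h)) => [|x y _|].
- by exists (rotate h^-1%g); [apply: rotateK | apply: rotateVK].
- by rewrite /rel_of mem_rotate_rel.
by case=> [[c i]|y].
Qed.

Variable (I : {set 'I_N}).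

(** A block of [I] is represented by its vertex of offset 0; the other blocks stay whole. *)
Definition kept (ci : blocks) : bool := (ci.1 \in I) ==> (ci.2 == 0%R).

Definition kept_blocks : finType := {ci : blocks | kept ci}.

Local Notation W := (kept_blocks + U)%type.

Lemma collapse_subproof (ci : blocks) :
  kept (if ci.1 \in I then (ci.1, 0%R) else ci).
Proof. by rewrite /kept; case: ifP => /= cI; rewrite ?cI ?eqxx. Qed.

Definition collapse (x : V) : W :=
  match x with inl ci => inl (exist kept _ (collapse_subproof ci)) | inr y => inr y end.

Definition include (w : W) : V :=
  match w with inl ci => inl (val ci) | inr y => inr y end.

Lemma includeK : cancel include collapse.
Proof.
case=> [[[c i] ci]|y] //; congr inl; apply: val_inj => /=.
by case: ifP => // cI; move: ci; rewrite /kept /= cI => /eqP ->.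
Qed.

(** The possible interiors of the contracted blocks. They do not mention [U], so the sum in
    [card_fixed] has the same index set whatever the rest of the graph. As [B] has no pairs between
    blocks, rotating all blocks at once tests each block separately. *)
Definition inner_rel (B : {set blocks * blocks}) : bool :=
  [&& off_diagonal B,
      [forall xy in B, (xy.1.1 == xy.2.1) && (xy.1.1 \in I)] &
      [forall x : blocks, forall y : blocks,
         ((x, y) \in B) == (((x.1, x.2 + Zp1)%R, (y.1, y.2 + Zp1)%R) \in B)]].

Definition inner_of (R : {set V * V}) : {set blocks * blocks} :=
  [set xy | [&& xy.1.1 == xy.2.1, xy.1.1 \in I & (inl xy.1, inl xy.2) \in R]].

Definition restrict_rel (R : {set V * V}) : {set W * W} :=
  [set xy | (include xy.1, include xy.2) \in R].

Definition glue (B : {set blocks * blocks}) (S : {set W * W}) : {set V * V} :=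
  [set xy | if collapse xy.1 == collapse xy.2 then
              match xy.1, xy.2 with inl x, inl y => (x, y) \in B | _, _ => false end
            else (collapse xy.1, collapse xy.2) \in S].

Definition contracted_label (B : {set blocks * blocks}) (x : kept_blocks) : car A :=
  if (val x).1 \in I then op [set y : blocks | y.1 == (val x).1] (rel_of B) (fun=> l)
  else l.

Lemma collapse_rotate_one (c : 'I_N) (x : V) :
  c \in I -> collapse (rotate (rotate_one p' c) x) = collapse x.
Proof.
case: x => [[d i]|y] //= cI; congr inl; apply: val_inj => /=.
case: ifP => // dI; rewrite ffunE; case: eqP => [dc|_]; last by rewrite GRing.addr0.
by rewrite dc cI in dI.
Qed.

Lemma collapse_eq (x y : V) :
  collapse x = collapse y ->
  x = y \/ exists c i j, [/\ c \in I, x = inl (c, i) & y = inl (c, j)].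
Proof.
case: x y => [[c i]|x] [[d j]|y] //= => [[] | [->]]; last by left.
case: ifP => cI; case: ifP => dI; move=> [].
- by move=> cd; right; exists c, i, j; rewrite cd.
- by move=> cd; rewrite cd dI in cI.
- by move=> cd; rewrite cd dI in cI.
- by move=> -> ->; left.
Qed.

(** Iterating the rotation of block [c] reaches every vertex of the block and leaves each vertex
    outside it in place, so the edges between [c] and an outside vertex are all present or all
    absent, in each direction. *)
Lemma fixed_collapse (R : {set V * V}) (x y : V) :
  [forall c in I, block_fixed R c] -> collapse x != collapse y ->
  ((x, y) \in R) = ((include (collapse x), include (collapse y)) \in R).
Proof.
move=> /forall_inP fixR nxy.
have move_l c i j z : c \in I -> collapse (inl (c, i)) != collapse z ->
    ((inl (c, i), z) \in R) = ((inl (c, j), z) \in R) /\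
    ((z, inl (c, i)) \in R) = ((z, inl (c, j)) \in R).
  move=> cI nz.
  have rot_z : rotate (rotate_one p' c) z = z.
    case: z nz => [[d a]|//] nz; rewrite /= ffunE; case: eqP => [dc|_]; last by rewrite GRing.addr0.
    case/eqP: nz; congr inl; apply: val_inj => /=; by rewrite dc cI.
  have rot_i n a : iter n (rotate (rotate_one p' c)) (inl (c, a) : V) =
      inl (c, (a + Zp1 *+ n)%R).
    elim: n => [|n IHn] /=; first by rewrite GRing.mulr0n GRing.addr0.
    by rewrite IHn /= ffunE eqxx GRing.mulrSr GRing.addrA.
  have fixn n a b : ((iter n (rotate (rotate_one p' c)) a,
                      iter n (rotate (rotate_one p' c)) b) \in R) = ((a, b) \in R).
    by elim: n => //= n IHn; rewrite (rotate_fixP _ _ (fixR c cI)).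
  have iter_z n : iter n (rotate (rotate_one p' c)) z = z.
    by elim: n => //= n ->.
  have [n ->] : exists n, j = (i + Zp1 *+ n)%R.
    by exists (j - i)%R; rewrite Zp1_mulrn GRing.addrC GRing.subrK.
  by rewrite -rot_i; split; [rewrite -(fixn n (inl (c, i)) z) | rewrite -(fixn n z (inl (c, i)))];
    rewrite iter_z.
have inc_move (v : V) z : collapse v != collapse z ->
    ((v, z) \in R) = ((include (collapse v), z) \in R) /\
    ((z, v) \in R) = ((z, include (collapse v)) \in R).
  case: v => [[c i]|//] vz; rewrite /=; case: ifP => //= cI.
  exact: move_l.
have collK v : collapse (include (collapse v)) = collapse v by rewrite includeK.
rewrite (inc_move x y nxy).1 (inc_move y _ _).2 //.
by rewrite collK eq_sym.
Qed.

Lemma collapse_same (c : 'I_N) (i j : 'I_p'.+1) :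
  c \in I -> collapse (inl (c, i)) = collapse (inl (c, j)).
Proof. by move=> cI; congr inl; apply: val_inj => /=; rewrite cI. Qed.

Arguments collapse : simpl never.

Lemma inner_of_fixed (R : {set V * V}) :
  off_diagonal R -> [forall c in I, block_fixed R c] -> inner_rel (inner_of R).
Proof.
move=> /forallP oR /forall_inP fixR; apply/and3P; split.
- by apply/forallP => x; rewrite inE /= (negPf (oR _)) !andbF.
- by apply/forall_inP => -[x y]; rewrite inE /= => /and3P[-> ->].
apply/forallP => -[c i]; apply/forallP => -[d j]; rewrite !inE /=.
case: (eqVneq c d) => //= <-; case: (boolP (c \in I)) => //= cI.
have /rotate_fixP/(_ (inl (c, i)) (inl (c, j))) := fixR c cI.
by rewrite /= ffunE eqxx => ->.
Qed.

Lemma glue_restrict (R : {set V * V}) :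
  off_diagonal R -> [forall c in I, block_fixed R c] ->
  glue (inner_of R) (restrict_rel R) = R.
Proof.
move=> /forallP oR fixR; apply/setP => -[x y]; rewrite inE /=.
case: eqP => [/collapse_eq[->|[c [i [j [cI -> ->]]]]]|/eqP nxy].
- by case: y => [y|y]; rewrite ?inE /= (negPf (oR _)) ?andbF.
- by rewrite inE /= eqxx cI.
by rewrite inE /= -fixed_collapse.
Qed.

(** Gluing reads [S] only between distinct classes, so exactly its loops are lost. The boolean
    equation is the form in which [reindex_onto] asks for it. *)
Lemma restrict_glue (B : {set blocks * blocks}) (S : {set W * W}) :
  inner_rel B -> (restrict_rel (glue B S) == S) = off_diagonal S.
Proof.
move=> /and3P[/forallP oB _ _]; apply/eqP/forallP => [<- w|oS].
  by rewrite !inE /= eqxx; case: w => [w|w] //=; apply: oB.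
apply/setP => -[x y]; rewrite !inE /= !includeK; case: eqP => // <-.
rewrite (negPf (oS x)); by case: x => [x|x] //=; rewrite (negPf (oB _)).
Qed.

Lemma inner_glue (B : {set blocks * blocks}) (S : {set W * W}) :
  inner_rel B -> inner_of (glue B S) = B.
Proof.
move=> /and3P[_ /forall_inP inB _]; apply/setP => -[[c i] [d j]]; rewrite !inE /=.
apply/idP/idP.
  by move=> /and3P[/eqP <- cI]; rewrite (collapse_same i j cI) eqxx.
move=> cdB; have /= /andP[/eqP cd cI] := inB _ cdB; subst d.
by rewrite eqxx cI (collapse_same i j cI) eqxx.
Qed.

Lemma glue_fixed (B : {set blocks * blocks}) (S : {set W * W}) :
  inner_rel B -> [forall c in I, block_fixed (glue B S) c].
Proof.
move=> /and3P[_ /forall_inP inB /forallP rotB]; apply/forall_inP => c cI.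
apply/rotate_fixP => x y; rewrite !inE /= !collapse_rotate_one //.
case: eqP => // /collapse_eq[->|[d [i [j [dI -> ->]]]]].
  case: y => [[d i]|//] /=; rewrite ffunE; case: eqP => [_|_]; last by rewrite GRing.addr0.
  by have /forallP/(_ (d, i))/eqP := rotB (d, i).
rewrite /= ffunE; case: eqP => [_|_]; last by rewrite !GRing.addr0.
by have /forallP/(_ (d, j))/eqP := rotB (d, i).
Qed.

Lemma glue_off_diagonal (B : {set blocks * blocks}) (S : {set W * W}) :
  inner_rel B -> off_diagonal (glue B S).
Proof.
move=> /and3P[/forallP oB _ _]; apply/forallP => x; rewrite inE /= eqxx.
by case: x.
Qed.

Lemma op_glue (B : {set blocks * blocks}) (S : {set W * W}) :
  op [set: V] (rel_of (glue B S)) block_label =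
  op [set: W] (rel_of S) (sum_label (contracted_label B) u).
Proof.
rewrite (@op_subst _ _ _ collapse _ _ (rel_of S)); last first.
  by move=> x y _ _ /negPf nxy; rewrite /rel_of inE /= nxy.
have -> : collapse @: [set: V] = [set: W].
  by apply/setP => w; rewrite inE; apply/imsetP; exists (include w); rewrite ?includeK.
apply: op_ext => // w _.
have sing v : (forall x, (collapse x == w) = (x == v)) ->
    op [set x in [set: V] | collapse x == w] (rel_of (glue B S)) block_label =
    block_label v.
  move=> xv; have -> : [set x in [set: V] | collapse x == w] = [set v].
    by apply/setP => x; rewrite !inE xv.
  by rewrite op_set1.
have inc_only : (if w is inl ci then (val ci).1 \notin I else true) ->
    forall x, (collapse x == w) = (x == include w).
  move=> wI x; apply/eqP/eqP => [xw|->]; last by rewrite includeK.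
  have /collapse_eq[//|[c [i [j [cI xE wE]]]]] : collapse x = collapse (include w).
    by rewrite includeK.
  case: w wE wI {sing xw} => [ci [wE]|//].
  by rewrite (wE : val ci = (c, j)) /= cI.
case: w sing inc_only => [ci|y] sing inc_only /=; last by rewrite (sing (inr y)) //; apply: inc_only.
rewrite /contracted_label; case: ifP => cI; last first.
  by rewrite (sing (include (inl ci))) //; apply: inc_only; rewrite cI.
set c := (val ci).1; set D := [set y : blocks | y.1 == c].
have -> : [set x in [set: V] | collapse x == inl ci] = inl @: D.
  apply/setP => x; rewrite !inE; apply/eqP/imsetP => [xci|[[d i]]].
    have /collapse_eq[->|[d [i [j [dI -> wE]]]]] : collapse x = collapse (include (inl ci)).
      by rewrite includeK.
      by exists (val ci); rewrite ?inE.
    case: wE => wE; exists (d, i) => //.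
    by rewrite inE /c (wE : val ci = (d, j)).
  rewrite inE /= => /eqP -> ->; rewrite (collapse_same i (val ci).2 cI).
  by rewrite -[RHS]includeK /= -surjective_pairing.
(* The substitution law along the injection [inl] carries the value of the block from the type of
   blocks into [V]. *)
rewrite [RHS](@op_subst _ _ _ (@inl blocks U) _ _ (rel_of (glue B S))).
  apply: op_ext => // _ /imsetP[y yD ->] /=.
  have -> : [set x in D | inl x == inl y :> V] = [set y].
    apply/setP => x; rewrite !inE; apply/andP/eqP => [[_ /eqP[]] //|->].
    by rewrite eqxx; move: yD; rewrite inE.
  by rewrite op_set1.
move=> [d i] [e j]; rewrite !inE /= => /eqP -> /eqP -> _.
rewrite /rel_of inE /=.
by rewrite (collapse_same i j cI) eqxx.
Qed.

(** A relation with symmetric blocks in [I] is the same as an interior for these blocks together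
    with a relation on the contracted graph; [glue] and the pair [inner_of], [restrict_rel] are the
    two directions. *)
Lemma card_fixed :
  #|[set R | accepted block_label R && [forall c in I, block_fixed R c]]| =
  \sum_(B | inner_rel B) count_graphs (sum_label (contracted_label B) u).
Proof.
rewrite -sum1_card (partition_big inner_of inner_rel) /=; last first.
  move=> R; rewrite inE => /andP[/andP[oR _] fixR]; exact: inner_of_fixed.
apply: eq_bigr => B inB.
rewrite (reindex_onto (glue B) restrict_rel) /=; last first.
  move=> R; rewrite inE => /andP[/andP[/andP[oR _] fixR] /eqP <-].
  exact: glue_restrict.
rewrite sum1dep_card; apply: eq_card => S; rewrite !inE restrict_glue // inner_glue //.
rewrite eqxx andbT glue_fixed // andbT /accepted glue_off_diagonal //= op_glue.
by rewrite andbC.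
Qed.

End WithRest.

End Contraction.

End Counting.

(** * Periodicity *)

Lemma leq_exp2r_le (a b e : nat) : a <= b -> a ^ e <= b ^ e.
Proof. by case: e => // e ab; rewrite leq_exp2r. Qed.

(** A contracted block loses [p'] vertices; this strict drop drives the induction on the number of
    vertices. *)
Lemma card_kept_blocks (p' N : nat) (I : {set 'I_N}) (c : 'I_N) :
  0 < p' -> c \in I -> #|kept_blocks p' I| < N * p'.+1.
Proof.
move=> p'0 cI; have -> : N * p'.+1 = #|{: 'I_N * 'I_p'.+1}|.
  by rewrite card_prod !card_ord.
rewrite card_sig; apply: proper_card; apply/properP; split; first exact/subsetP.
exists (c, ord_max) => //; rewrite inE /kept cI /=.
by apply/eqP => /(congr1 val) /= p'E; rewrite p'E in p'0.
Qed.

Section Determined.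

Variables (A : graph_algebra) (ev : pred (car A)) (p' k N : nat).
Hypotheses (p_prime : prime p'.+1) (k_gt0 : 0 < k) (leN : k * k.+1 <= N).

Local Notation q := (p'.+1 ^ k).
Local Notation count := (@count_graphs A ev).
Local Notation blocks_with l := (@block_label A p' N l _).

Section Pattern.

Variables (l : car A) (U : finType) (u : U -> car A).

Definition count_pattern (I J : seq 'I_N) : nat :=
  #|[set R | [&& accepted ev (blocks_with l u) R, all (block_fixed R) I &
                 all (fun c => ~~ block_fixed R c) J]]|.

Lemma count_pattern_split (I J : seq 'I_N) (j : 'I_N) :
  count_pattern I J = count_pattern (j :: I) J + count_pattern I (j :: J).
Proof.
rewrite /count_pattern -(cardsID [set R | block_fixed R j]); congr (_ + _).
  by apply: eq_card => R; rewrite !inE /= andbC -!andbA; do !bool_congr.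
by apply: eq_card => R; rewrite !inE /= andbC -!andbA; do !bool_congr.
Qed.

Lemma count_pattern_unfixed : q %| count_pattern [::] (enum 'I_N).
Proof.
apply: (dvdn_card_unfixed p_prime k_gt0 leN) => [R h|R c];
  rewrite !inE /= => /andP[aR /allP nfix].
  rewrite accepted_rotate aR; apply/allP => c cI.
  by rewrite block_fixed_rotate nfix.
by apply: nfix; rewrite mem_enum.
Qed.

Lemma count_pattern_contract (I : seq 'I_N) :
  count_pattern I [::] =
  \sum_(B | inner_rel [set c in I] B)
     count (sum_label (contracted_label (p' := p') l (I := [set c in I]) B) u).
Proof.
rewrite -card_fixed; apply: eq_card => R; rewrite !inE andbT; congr (_ && _).
apply/allP/forall_inP => fixR c cI; apply: fixR; first by rewrite inE in cI.
by rewrite inE.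
Qed.

End Pattern.

(** Modulo [q], relations without a symmetric block contribute nothing. The others are recovered by
    [count_pattern_split], deciding one block at a time: each correction term has a fixed block,
    hence is a sum of counts over contracted graphs, to which the hypothesis applies. *)
Lemma count_blocks_determined (l : car A) (U U' : finType) (u : U -> car A)
    (u' : U' -> car A) :
  (forall (X : finType) (x : X -> car A), #|X| < N * p'.+1 ->
     count (sum_label x u) = count (sum_label x u') %[mod q]) ->
  count (blocks_with l u) = count (blocks_with l u') %[mod q].
Proof.
move=> det_small.
have p'0 : 0 < p' by have := prime_gt1 p_prime.
have det_fixed J : forall I, I != [::] ->
    count_pattern l u I J = count_pattern l u' I J %[mod q].
  elim: J => [|j J IHJ] I nI.
    rewrite !count_pattern_contract -modn_summ -[RHS]modn_summ.
    congr (_ %% _); apply: eq_bigr => B _; apply: det_small.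
    case: I nI {B} => // c I _; apply: (@card_kept_blocks _ _ _ c) => //.
    by rewrite inE mem_head.
  have /eqP := IHJ I nI; rewrite !(count_pattern_split _ _ I J j).
  rewrite -modnDml IHJ // modnDml eqn_modDl => /eqP //.
have det_all J : count_pattern l u [::] J = count_pattern l u' [::] J %[mod q] ->
    count_pattern l u [::] [::] = count_pattern l u' [::] [::] %[mod q].
  elim: J => // j J IHJ detJ; apply: IHJ.
  rewrite !(count_pattern_split _ _ [::] J j) -modnDm detJ det_fixed // modnDm //.
have cE (V : finType) (v : V -> car A) :
    count (blocks_with l v) = count_pattern l v [::] [::].
  by apply: eq_card => R; rewrite !inE /= andbT.
rewrite !cE.
apply: (det_all (enum 'I_N)).
by rewrite !(eqP (count_pattern_unfixed _ _)).
Qed.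

Definition labelled_type (b : car A -> nat) : finType := {l : car A & 'I_(b l)}.

Definition count_mult (b : car A -> nat) (l0 : car A) (n : nat) : nat :=
  count (sum_label (fun v : labelled_type b => tag v) (fun _ : 'I_n => l0)).

Lemma mult_tag (b : car A -> nat) (l : car A) :
  mult (fun v : labelled_type b => tag v) l = b l.
Proof.
rewrite /mult -(sig_big_dep xpredT (fun _ => xpredT) (fun i _ => (i == l : nat))) /=.
rewrite (bigD1 l) //= eqxx sum1_card card_ord big1 ?addn0 // => i /negPf ->.
by rewrite sum_nat_const muln0.
Qed.

Lemma count_multE (X : finType) (x : X -> car A) (l0 : car A) (n : nat) :
  count (sum_label x (fun _ : 'I_n => l0)) = count_mult (mult x) l0 n.
Proof. by apply: count_graphs_mult => l; rewrite !mult_sum mult_tag. Qed.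

Lemma eq_count_mult (b b' : car A -> nat) (l0 : car A) (n n' : nat) :
  (forall l, b l + (l0 == l) * n = b' l + (l0 == l) * n') ->
  count_mult b l0 n = count_mult b' l0 n'.
Proof.
move=> bb'; apply: count_graphs_mult => l; rewrite !mult_sum !mult_tag.
by rewrite /mult !sum_nat_const !card_ord ![_ * (_ == _)]mulnC.
Qed.

(** If some label occurs at least [N * p'.+1] times in [b], that many of its vertices are arranged
    in blocks and [count_blocks_determined] leads to smaller multiplicities. Otherwise [b] lies in
    the finite box of the hypothesis. *)
Lemma count_mult_determined (l0 : car A) (n n' : nat) :
  (forall b : {ffun car A -> 'I_(N * p'.+1)},
     count_mult (fun i => b i) l0 n = count_mult (fun i => b i) l0 n' %[mod q]) ->
  forall b : car A -> nat, count_mult b l0 n = count_mult b l0 n' %[mod q].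
Proof.
move=> det_box b; have [s les] := ubnP (\sum_l b l).
elim: s b les => // s IHs b les.
have [/existsP[l leb]|/existsPn small] := boolP [exists l, N * p'.+1 <= b l]; last first.
  have ltb l : b l < N * p'.+1 by rewrite ltnNge small.
  have bE m : count_mult b l0 m = count_mult (fun i => [ffun l => Ordinal (ltb l)] i) l0 m.
    by apply: eq_count_mult => l; rewrite ffunE.
  by rewrite !bE; apply: det_box.
pose b' i := b i - (i == l) * (N * p'.+1).
have b'E i : b i = b' i + (i == l) * (N * p'.+1).
  by rewrite /b'; case: eqP => [->|_]; rewrite ?mul1n ?mul0n ?subn0 ?addn0 ?subnK.
pose rest m : labelled_type b' + 'I_m -> car A :=
  sum_label (fun v : labelled_type b' => tag v) (fun _ : 'I_m => l0).
have bE m : count_mult b l0 m = count (blocks_with l (@rest m)).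
  apply: count_graphs_mult => i; rewrite !mult_sum !mult_tag b'E addnA; congr (_ + _).
  by rewrite addnC /mult sum_nat_const card_prod !card_ord mulnC eq_sym.
rewrite !bE; apply: count_blocks_determined => X x ltX.
have XE m : count (sum_label x (@rest m)) = count_mult (fun i => mult x i + b' i) l0 m.
  by apply: count_graphs_mult => i; rewrite !mult_sum !mult_tag addnA.
rewrite ltnS in les.
rewrite !XE; apply: IHs; apply: leq_trans les; rewrite big_split /= sum_mult.
rewrite (eq_bigr _ (fun i _ => b'E i)) big_split /= [X in _ < _ + X](bigD1 l) //= eqxx mul1n.
rewrite [X in _ < _ + (_ + X)]big1 => [|i /negPf ->]; last by rewrite mul0n.
by rewrite addn0 addnC ltn_add2l.
Qed.

Lemma count_mult_shift (l0 : car A) (b : car A -> nat) (n : nat) :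
  count_mult b l0 n.+1 = count_mult (fun i => b i + (l0 == i)) l0 n.
Proof. by apply: eq_count_mult => i; rewrite mulnS addnA. Qed.

(** The state at [n] is the table of residues over the box, so two states agree among the first
    [S.+1]. One more vertex labelled [l0] shifts [b] by one, possibly out of the box;
    [count_mult_determined] covers all [b], so the agreement persists for ever. *)
Lemma count_mult_repeat (l0 : car A) :
  exists i j, [/\ i < j, j <= q ^ ((N * p'.+1) ^ #|car A|) &
    forall a b, count_mult b l0 (i + a) = count_mult b l0 (j + a) %[mod q]].
Proof.
have q_gt0 : 0 < q by rewrite expn_gt0.
pose box := {ffun car A -> 'I_(N * p'.+1)}; set S := q ^ _.
pose state (n : 'I_S.+1) : {ffun box -> 'I_q} :=
  [ffun b => Ordinal (ltn_pmod (count_mult (fun i => (b : box) i) l0 n) q_gt0)].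
have /injectivePn[i [j ij sij]] : ~~ injectiveb state.
  apply/negP => /injectiveP/leq_card; rewrite card_ord card_ffun card_ord card_ffun card_ord.
  by rewrite ltnn.
wlog lt_ij : i j ij sij / i < j.
  move=> wl; have [lt_ij|] := ltnP i j; first exact: (wl i j).
  rewrite leq_eqVlt => /orP[/eqP/val_inj ji|lt_ji]; first by rewrite ji eqxx in ij.
  by apply: (wl j i) => //; rewrite eq_sym.
exists i, j; split=> //; first by rewrite -ltnS ltn_ord.
elim=> [|a IHa] b; last by rewrite !addnS !count_mult_shift IHa.
rewrite !addn0; apply: count_mult_determined => {}b.
by have /ffunP/(_ b) := sij; rewrite !ffunE => /(congr1 val).
Qed.

(** The pigeonhole period [j - i] is unknown but at most [S], so it divides the factorial. *)
Lemma count_periodic (X : finType) (x : X -> car A) (l0 : car A) (S n : nat) :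
  q ^ ((N * p'.+1) ^ #|car A|) <= S -> S <= n ->
  count (sum_label x (fun _ : 'I_(n + S`!) => l0)) =
  count (sum_label x (fun _ : 'I_n => l0)) %[mod q].
Proof.
move=> leS leSn; rewrite !count_multE.
have [i [j [lt_ij le_jS per]]] := count_mult_repeat l0.
have per1 m b : i <= m -> count_mult b l0 (m + (j - i)) = count_mult b l0 m %[mod q].
  move=> le_im; rewrite -(subnKC le_im) per; congr (count_mult b l0 _ %% _).
  by lia.
have perk c m b : i <= m -> count_mult b l0 (m + c * (j - i)) = count_mult b l0 m %[mod q].
  move=> le_im; elim: c => [|c IHc]; first by rewrite addn0.
  by rewrite mulSn addnCA addnC per1 //; apply: leq_trans (leq_addr _ _).
have /dvdnP[c ->] : j - i %| S`!.
  by apply: dvdn_fact; apply/andP; split; lia.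
by rewrite perk //; lia.
Qed.

End Determined.

(** * The threshold for topologies and an arbitrary modulus *)

(** Dominates [q ^ ((N * p) ^ #|car A|)] for every prime power [q = p ^ k] exactly dividing [m],
    with [N = k * k.+1], since [q], [p] and [k] are at most [m]. *)
Definition topcount_bound (r : nat) (phi : sentence r) (m : nat) : nat :=
  m ^ ((m * m.+1 * m) ^ (transitive_bound * tfol_bound phi)).

(** Hard-wired constants become [r] extra vertices, each with its own colour, and the other [n]
    points share one colour: [n] is the multiplicity of a single label. *)
Lemma topcount_count_graphs (r : nat) (phi : sentence r) :
  exists (A : graph_algebra) (ev : pred (car A)) (x : 'I_r -> car A) (l0 : car A),
    #|car A| <= transitive_bound * tfol_bound phi /\
    forall n, topcount phi n = count_graphs ev (sum_label x (fun _ : 'I_n => l0)).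
Proof.
have [P recP PE] := recognizable_sat phi.
have := recognizable_bool andb (recognizable_transitive (color r 0 0)) recP.
move=> [A [pt [ev [leA evE]]]].
pose col0 : color r 0 0 := ([ffun=> false], [ffun=> false], [ffun=> false]).
pose colr (i : 'I_r) : color r 0 0 := ([ffun j => j == i], [ffun=> false], [ffun=> false]).
exists A, ev, (pt \o colr), (pt col0); split=> // n.
rewrite /topcount card_topologies.
set cst := fun i : 'I_r => lshift n i.
pose lab (v : 'I_(r + n)) : color r 0 0 :=
  match split v with inl i => colr i | inr _ => col0 end.
transitivity (count_graphs ev (pt \o lab)).
  apply: eq_card => R; rewrite !inE /accepted; congr (_ && _).
  rewrite /top_models -[models _ _ _]/(up_sat phi cst (@env_nil _) (@env_nil _)).
  rewrite PE -evE; congr (_ && _); apply: (recognizable_eq recP) => // v.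
  rewrite /lab /coloring; have -> : v = unsplit (split v) by rewrite splitK.
  rewrite unsplitK; case: (split v) => i; congr (_, _, _); apply/ffunP => j.
  - by case: j.
  - by case: j.
  - by rewrite !ffunE /cst /= eq_lrshift.
  - by case: j.
  - by case: j.
apply/esym; apply: (@count_graphs_bij _ _ _ _ (@unsplit r n)).
  by exists (@split r n); [apply: unsplitK | apply: splitK].
by move=> v; rewrite /= /lab unsplitK; case: v.
Qed.

Lemma eqn_mod_part (m a b : nat) :
  0 < m -> (forall p, p \in \pi(m) -> a = b %[mod m`_p]) -> a = b %[mod m].
Proof.
move=> m0; wlog ba : a b / b <= a => [wl|] eq_p.
  have [ba|/ltnW ab] := leqP b a; first exact: wl.
  by apply/esym/wl => // p /eq_p.
apply/eqP; rewrite eqn_mod_dvd //; apply/(dvdn_partP _ m0) => p /eq_p/eqP.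
by rewrite eqn_mod_dvd.
Qed.

Theorem topcount_periodic (r : nat) (phi : sentence r) (m S n : nat) :
  0 < m -> topcount_bound phi m <= S -> S <= n ->
  topcount phi (n + S`!) = topcount phi n %[mod m].
Proof.
move=> m0 leS leSn; have [A [ev [x [l0 [leA cE]]]]] := topcount_count_graphs phi.
apply: (eqn_mod_part m0) => p.
rewrite mem_primes => /and3P[p_prime _ p_m]; rewrite p_part.
have k0 : 0 < logn p m by rewrite logn_gt0 mem_primes p_prime m0.
case: p p_prime p_m k0 => // p' p_prime p_m k0; set k := logn _ _ in k0 *.
have leq : p'.+1 ^ k <= m by apply: dvdn_leq => //; apply: pfactor_dvdnn.
have lek : k <= m by apply: leq_trans leq; apply/ltnW/ltn_expl; apply: prime_gt1.
have lep : p'.+1 <= m by apply: dvdn_leq.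
rewrite !cE; apply: (count_periodic _ p_prime k0 (leqnn _)) => //.
apply: leq_trans leS; rewrite /topcount_bound.
have leM : k * k.+1 * p'.+1 <= m * m.+1 * m by apply: leq_mul => //; apply: leq_mul.
have M0 : 0 < m * m.+1 * m by rewrite !muln_gt0 m0.
apply: leq_trans (leq_exp2r_le _ leq) _; apply: leq_pexp2l => //.
exact: leq_trans (leq_exp2r_le _ leM) (leq_pexp2l M0 leA).
Qed.

(** * Structured programs and primitive recursive expressions *)

Inductive stmt : Type :=
| Do of instr
| Seq of stmt & stmt
| While of nat & stmt.

Notation "s1 ;; s2" := (Seq s1 s2) (at level 62, right associativity).

Definition jump_free (i : instr) : bool := if i is JumpZ _ _ then false else true.

Definition effect (i : instr) (R : nat -> nat) : nat -> nat :=
  reg (exec i (Config 0 R)).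

(* Register 5 is sacrificed to the unconditional back jump of loops. *)
Inductive runs : stmt -> (nat -> nat) -> nat -> (nat -> nat) -> Prop :=
| RunDo i R : jump_free i -> runs (Do i) R 1 (effect i R)
| RunSeq s1 s2 R1 t1 R2 t2 R3 :
    runs s1 R1 t1 R2 -> runs s2 R2 t2 R3 -> runs (s1 ;; s2) R1 (t1 + t2) R3
| RunStop r s R : R r = 0 -> runs (While r s) R 1 R
| RunLoop r s R1 t1 R2 t2 R3 :
    0 < R1 r -> runs s R1 t1 R2 -> runs (While r s) (upd R2 5 0) t2 R3 ->
    runs (While r s) R1 (t1 + t2 + 3) R3.

(** A loop adds three instructions: the exit test, the clearing of register 5 and the jump back on
    it. This is the 3 in the exit address and in the cost of [RunLoop]. *)
Fixpoint assemble (a : nat) (s : stmt) : program :=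
  match s with
  | Do i => [:: i]
  | s1 ;; s2 => assemble a s1 ++ assemble (a + size (assemble a s1)) s2
  | While r s =>
      JumpZ r (a + size (assemble a.+1 s) + 3) ::
        assemble a.+1 s ++ [:: Const 5 0; JumpZ 5 a]
  end.

Lemma assemble_while (a r : nat) (s : stmt) :
  assemble a (While r s) =
  JumpZ r (a + size (assemble a.+1 s) + 3) ::
    assemble a.+1 s ++ [:: Const 5 0; JumpZ 5 a].
Proof. by []. Qed.

Definition fits (P : program) (a : nat) (c : program) : Prop :=
  forall j, j < size c -> onth P (a + j) = onth c j.

Lemma fits_cat (P : program) (a : nat) (c1 c2 : program) :
  fits P a (c1 ++ c2) -> fits P a c1 /\ fits P (a + size c1) c2.
Proof.
move=> fit; split=> j ltj.
  by rewrite fit ?onth_cat ?ltj // size_cat ltn_addr.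
rewrite -addnA fit ?size_cat ?ltn_add2l // onth_cat.
by rewrite ltnNge leq_addr /= addKn.
Qed.

Lemma step_fits (P : program) (a : nat) (i : instr) (c : program) (R : nat -> nat) :
  fits P a (i :: c) -> step P (Config a R) = exec i (Config a R).
Proof. by move=> /(_ 0 isT); rewrite addn0 /step /= => ->. Qed.

Lemma runs_assemble (s : stmt) (R R' : nat -> nat) (t : nat) :
  runs s R t R' ->
  forall P a, fits P a (assemble a s) ->
    iter t (step P) (Config a R) = Config (a + size (assemble a s)) R'.
Proof.
elim=> {s R t R'}.
- move=> i R jf P a fit; rewrite /= (step_fits R fit) addn1.
  by case: i jf {fit}.
- move=> s1 s2 R1 t1 R2 t2 R3 _ IH1 _ IH2 P a /fits_cat[fit1 fit2].
  by rewrite addnC iterD IH1 // IH2 // size_cat addnA.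
- move=> r s R R0 P a; rewrite assemble_while => fit.
  rewrite [iter 1 _ _]/= (step_fits R fit) /= R0 size_cat /=.
  by congr Config; lia.
move=> r s R1 t1 R2 t2 R3 R1r _ IH1 _ IH2 P a fitw; have := fitw.
rewrite {1}assemble_while => fit; have := fit.
rewrite -cat1s => /fits_cat[fit1 /fits_cat[]]; rewrite [size [:: _]]/= addn1 => fit2 fit3.
have -> : t1 + t2 + 3 = t2 + (2 + (t1 + 1)) by lia.
rewrite iterD (iterD 2) iterD [iter 1 _ _]/= (step_fits R1 fit) /= eqn0Ngt R1r /=.
rewrite IH1 // (step_fits R2 fit3) /=.
have fit4 : fits P (a.+1 + size (assemble a.+1 s)).+1 [:: JumpZ 5 a].
  by move=> [|//] _; have := fit3 1 isT; rewrite addn1 addn0.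
by rewrite (step_fits _ fit4) /= IH2.
Qed.

Definition scons (x : nat) (rho : nat -> nat) (i : nat) : nat :=
  if i is j.+1 then rho j else x.

(** In [ERec e0 e1 e2] the step [e2] is iterated [e0] times from [e1]; it binds index 0 to the round
    and index 1 to the accumulator. *)
Inductive expr : Type :=
| EVar of nat
| EZero
| ESucc of expr
| ERec of expr & expr & expr.

Fixpoint eval (rho : nat -> nat) (e : expr) : nat :=
  match e with
  | EVar i => rho i
  | EZero => 0
  | ESucc e => (eval rho e).+1
  | ERec e0 e1 e2 =>
      iteri (eval rho e0) (fun i x => eval (scons i (scons x rho)) e2) (eval rho e1)
  end.

(** Register [d] receives the value, those above it are scratch. In a recursion [d] holds the
    remaining rounds, [d.+1] the accumulator, [d.+2] the index of the round, and the body is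
    evaluated into [d.+3]. *)
Fixpoint expr_stmt (d : nat) (vm : nat -> nat) (e : expr) : stmt :=
  match e with
  | EVar i => Do (Move d (vm i))
  | EZero => Do (Const d 0)
  | ESucc e => expr_stmt d vm e ;; Do (Incr d)
  | ERec e0 e1 e2 =>
      expr_stmt d vm e0 ;; expr_stmt d.+1 vm e1 ;; Do (Const d.+2 0) ;;
      While d (Do (Decr d) ;; expr_stmt d.+3 (scons d.+2 (scons d.+1 vm)) e2 ;;
               Do (Move d.+1 d.+3) ;; Do (Incr d.+2)) ;;
      Do (Move d d.+1)
  end.

Definition agree (d : nat) (R R' : nat -> nat) : Prop :=
  forall j, j < d -> j != 5 -> R' j = R j.

Definition placed (d : nat) (vm : nat -> nat) (rho R : nat -> nat) : Prop :=
  forall i, [/\ vm i < d, vm i != 5 & R (vm i) = rho i].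

Lemma placed_agree (d d' : nat) (vm : nat -> nat) (rho R R' : nat -> nat) :
  placed d vm rho R -> d <= d' -> agree d R R' -> placed d' vm rho R'.
Proof.
move=> pl dd' ag i; have [vd v5 Rv] := pl i; split=> //.
  exact: leq_trans vd dd'.
by rewrite ag.
Qed.

Lemma agree_trans (d d' : nat) (R R' R'' : nat -> nat) :
  d <= d' -> agree d R R' -> agree d' R' R'' -> agree d R R''.
Proof. by move=> dd' a1 a2 j jd j5; rewrite a2 ?a1 //; apply: leq_trans jd dd'. Qed.

Lemma agree_upd (d k x : nat) (R : nat -> nat) : d <= k -> agree d R (upd R k x).
Proof. by move=> dk j jd _; rewrite /upd; case: eqP => // jk; lia. Qed.

Lemma agree_upd5 (d x : nat) (R : nat -> nat) : agree d R (upd R 5 x).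
Proof. by move=> j _ /negPf j5; rewrite /upd j5. Qed.

(* The number of steps depends on the values of the variables only. *)
Lemma runs_expr (e : expr) (rho : nat -> nat) :
  {t | forall d vm R, 5 < d -> placed d vm rho R ->
    exists R', [/\ runs (expr_stmt d vm e) R t R', R' d = eval rho e & agree d R R']}.
Proof.
elim: e rho => [i|||].
- move=> rho; exists 1 => d vm R d5 pl; exists (effect (Move d (vm i)) R).
  split; [exact: RunDo | by rewrite /effect /= /upd eqxx; case: (pl i) | exact: agree_upd].
- move=> rho; exists 1 => d vm R d5 pl; exists (effect (Const d 0) R).
  split; [exact: RunDo | by rewrite /effect /= /upd eqxx | exact: agree_upd].
- move=> e IHe rho; have [t tP] := IHe rho; exists (t + 1) => d vm R d5 pl.
  have [R' [run Rd ag]] := tP d vm R d5 pl; exists (effect (Incr d) R'); split.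
  + by apply: RunSeq run _; apply: RunDo.
  + by rewrite /effect /= /upd eqxx Rd.
  + exact: agree_trans (leqnn _) ag (agree_upd _ _ (leqnn _)).
move=> e0 IH0 e1 IH1 e2 IH2 rho.
have [t0 t0P] := IH0 rho; have [t1 t1P] := IH1 rho.
pose f i x := eval (scons i (scons x rho)) e2.
pose body d vm := Do (Decr d) ;; expr_stmt d.+3 (scons d.+2 (scons d.+1 vm)) e2 ;;
               Do (Move d.+1 d.+3) ;; Do (Incr d.+2).
(* Induction on the remaining rounds. Fixing [i] and [x] beforehand fixes the environment of the
   body, hence its cost, before any registers are chosen. *)
have loop n : forall i x, {t | forall d vm R, 5 < d -> placed d vm rho R ->
    R d = n -> R d.+1 = x -> R d.+2 = i -> x = iteri i f (eval rho e1) ->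
    exists R', [/\ runs (While d (body d vm)) R t R',
      R' d.+1 = iteri (i + n) f (eval rho e1) & agree d R R']}.
  elim: n => [|n IHn] i x.
    exists 1 => d vm R d5 pl Rd Rd1 Rd2 xE; exists R; rewrite addn0 Rd1.
    by split=> //; apply: RunStop.
  have [tb tbP] := IH2 (scons i (scons x rho)).
  have [tl tlP] := IHn i.+1 (f i x).
  exists (1 + (tb + (1 + 1)) + tl + 3) => d vm R d5 pl Rd Rd1 Rd2 xE.
  set R1 := effect (Decr d) R.
  have ag1 : agree d R R1 by apply: agree_upd.
  have d3 : 5 < d.+3 by lia.
  have neq j k : j < k -> (k == j) = false by move=> jk; apply/eqP; lia.
  have neq' j k : j < k -> (j == k) = false by move=> jk; apply/eqP; lia.
  have pl1 : placed d.+3 (scons d.+2 (scons d.+1 vm)) (scons i (scons x rho)) R1.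
    case=> [|[|j]] /=; rewrite /R1 /effect /= /upd.
    - by rewrite (neq d) ?Rd2 //; split=> //; lia.
    - by rewrite (neq d) ?Rd1 //; split=> //; lia.
    by have [vd v5 Rv] := pl j; rewrite (neq' (vm j) d) //; split=> //; lia.
  have [R2 [run2 R2d ag2]] := tbP _ _ R1 d3 pl1.
  set R3 := effect (Move d.+1 d.+3) R2; set R4 := effect (Incr d.+2) R3.
  have ag4 : agree d R (upd R4 5 0).
    have ag12 : agree d R1 R2 by move=> j jd j5; apply: ag2 => //; lia.
    apply: agree_trans (leqnn d) ag1 _; apply: agree_trans (leqnn d) ag12 _.
    have ag23 : agree d R2 R3 by apply: agree_upd; apply: leqnSn.
    have ag34 : agree d R3 R4 by apply: agree_upd; apply/leqW/leqnSn.
    apply: agree_trans (leqnn d) ag23 _; apply: agree_trans (leqnn d) ag34 _.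
    exact: agree_upd5.
  have [] := tlP d vm (upd R4 5 0) d5.
  - exact: placed_agree pl (leqnn _) ag4.
  - rewrite /R4 /R3 /effect /= /upd (neq 5) // (neq' d d.+2) // (neq' d d.+1) //.
    rewrite ag2 ?(neq 5) //; last by lia.
    by rewrite /R1 /effect /= /upd eqxx Rd.
  - rewrite /R4 /R3 /effect /= /upd (neq 5) //; last by lia.
    by rewrite (neq' d.+1 d.+2) // eqxx R2d.
  - rewrite /R4 /R3 /effect /= /upd (neq 5) //; last by lia.
    rewrite eqxx (neq d.+1 d.+2) // ag2 ?(neq 5) //; last by lia.
    by rewrite /R1 /effect /= /upd (neq d d.+2) // Rd2.
  - by rewrite /= -xE.
  move=> R5 [run5 R5d ag5]; exists R5; split.
  - apply: RunLoop run5; first by rewrite Rd.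
    apply: RunSeq (RunDo _ _) _ => //; apply: RunSeq run2 _.
    by apply: RunSeq; apply: RunDo.
  - by rewrite R5d addSnnS.
  - exact: agree_trans (leqnn _) ag4 ag5.
have [tl tlP] := loop (eval rho e0) 0 (eval rho e1).
exists (t0 + (t1 + (1 + (tl + 1)))) => d vm R d5 pl.
have [R0 [run0 R0d ag0]] := t0P d vm R d5 pl.
have pl0 := placed_agree pl (leqnSn d) ag0.
have [R1 [run1 R1d ag1]] := t1P d.+1 vm R0 (leqW d5) pl0.
set R2 := effect (Const d.+2 0) R1.
have ag02 : agree d.+1 R0 R2.
  by apply: agree_trans (leqnn _) ag1 _; apply: agree_upd; lia.
have ag2 : agree d R R2 by apply: agree_trans (leqnSn d) ag0 ag02.
have neq' j k : j < k -> (j == k) = false by move=> jk; apply/eqP; lia.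
have [] := tlP d vm R2 d5 (placed_agree pl (leqnn _) ag2).
- by rewrite ag02 // neq_ltn d5 orbT.
- by rewrite /R2 /effect /= /upd (neq' d.+1 d.+2).
- by rewrite /R2 /effect /= /upd eqxx.
- by [].
move=> R3 [run3 R3d ag3]; exists (effect (Move d d.+1) R3); split.
- apply: RunSeq run0 _; apply: RunSeq run1 _; apply: RunSeq (RunDo _ _) _ => //.
  by apply: RunSeq run3 _; apply: RunDo.
- by rewrite /effect /= /upd eqxx R3d.
- apply: agree_trans (leqnn _) ag2 _; apply: agree_trans (leqnn _) ag3 _.
  exact: agree_upd.
Qed.

Arguments effect _ _ /.
Arguments upd _ _ _ _ /.

(** * Reading the input and reducing [n] on the machine *)

Definition double_stmt : stmt := Do (Move 4 2) ;; While 4 (Do (Decr 4) ;; Do (Incr 2)).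

Definition keeps (ks : seq nat) (R R' : nat -> nat) : Prop :=
  forall j, j \notin ks -> R' j = R j.

Lemma keeps_upd (ks : seq nat) (k x : nat) (R : nat -> nat) :
  k \in ks -> keeps ks R (upd R k x).
Proof. by move=> kk j; rewrite /upd; case: eqP => // ->; rewrite kk. Qed.

Lemma keeps_trans (ks : seq nat) (R R' R'' : nat -> nat) :
  keeps ks R R' -> keeps ks R' R'' -> keeps ks R R''.
Proof. by move=> k1 k2 j jk; rewrite k2 ?k1. Qed.

Lemma runs_double (v : nat) :
  {t | forall R, R 2 = v ->
    exists R', [/\ runs double_stmt R t R', R' 2 = v.*2 & keeps [:: 2; 4; 5] R R']}.
Proof.
have loop x : {t | forall R, R 4 = x ->
    exists R', [/\ runs (While 4 (Do (Decr 4) ;; Do (Incr 2))) R t R',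
      R' 2 = R 2 + x & keeps [:: 2; 4; 5] R R']}.
  elim: x => [|x [t tP]].
    exists 1 => R R4; exists R; split=> //; first exact: RunStop.
    by rewrite addn0.
  exists (1 + 1 + t + 3) => R R4.
  set R1 := effect (Decr 4) R; set R2 := effect (Incr 2) R1.
  have [|R3 [run3 R32 k3]] := tP (upd R2 5 0); first by rewrite /R2 /R1 /= R4.
  exists R3; split.
  - apply: RunLoop run3; first by rewrite R4.
    by apply: RunSeq; apply: RunDo.
  - by rewrite R32 /R2 /R1 /= addSnnS.
  - apply: keeps_trans k3; apply: (keeps_trans (R' := R2)); last exact: keeps_upd.
    by apply: (keeps_trans (R' := R1)); apply: keeps_upd.
have [t tP] := loop v; exists (1 + t) => R R2.
have [|R' [run R'2 k']] := tP (effect (Move 4 2) R); first by rewrite /= R2.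
exists R'; split.
- by apply: RunSeq run; apply: RunDo.
- by rewrite R'2 /= R2 addnn.
- by apply: keeps_trans k'; apply: keeps_upd.
Qed.

Definition shift_stmt : stmt := While 3 (Do (Decr 3) ;; double_stmt).

Lemma runs_shift (x v : nat) :
  {t | forall R, R 3 = x -> R 2 = v ->
    exists R', [/\ runs shift_stmt R t R', R' 2 = 2 ^ x * v &
                   keeps [:: 2; 3; 4; 5] R R']}.
Proof.
elim: x v => [|x IHx] v.
  exists 1 => R R3 R2; exists R; split=> //; first exact: RunStop.
  by rewrite mul1n.
have [t tP] := runs_double v; have [t' tP'] := IHx v.*2.
exists (1 + t + t' + 3) => R R3 R2.
set R1 := effect (Decr 3) R.
have [//|R4 [run4 R42 k4]] := tP R1.
have k4' : keeps [:: 2; 3; 4; 5] R R4.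
  apply: (keeps_trans (R' := R1)); first exact: keeps_upd.
  by move=> j; rewrite !inE !negb_or => /and4P[? ? ? ?]; apply: k4; rewrite !inE !negb_or; apply/and3P.
have [||R5 [run5 R52 k5]] := tP' (upd R4 5 0).
- by rewrite /= k4 // /R1 /= R3.
- by rewrite /= R42.
exists R5; split.
- apply: RunLoop run5; first by rewrite R3.
  by apply: RunSeq run4; apply: RunDo.
- by rewrite R52 expnS -mul2n mulnCA mulnA.
- apply: keeps_trans k5; apply: keeps_trans k4' _; exact: keeps_upd.
Qed.

(** Evaluates [code (x :: s) = 2 ^ x * (2 * code s + 1)] from the last entry backwards. Register 0
    is the address of the current entry; entries start at register 6, so five decrements turn it
    into the number of entries left. *)
Definition encode_stmt : stmt :=
  While 3 (Do (LoadI 3 0) ;; double_stmt ;; Do (Incr 2) ;; shift_stmt ;;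
           Do (Decr 0) ;; Do (Move 3 0) ;; Do (Decr 3) ;; Do (Decr 3) ;;
           Do (Decr 3) ;; Do (Decr 3) ;; Do (Decr 3)).

Lemma runs_encode (w : seq nat) (j : nat) :
  {t | forall R, R 0 = 5 + j -> R 3 = j -> R 2 = CodeSeq.code (drop j w) ->
      j <= size w -> (forall i, i < j -> R (6 + i) = nth 0 w i) ->
    exists R', [/\ runs encode_stmt R t R', R' 2 = CodeSeq.code w & R' 1 = R 1]}.
Proof.
elim: j => [|j [t tP]].
  exists 1 => R R0 R3 R2 _ _; exists R; split=> //; first exact: RunStop.
  by rewrite R2 drop0.
have [t1 t1P] := runs_double (CodeSeq.code (drop j.+1 w)).
have [t2 t2P] := runs_shift (nth 0 w j) (CodeSeq.code (drop j.+1 w)).*2.+1.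
exists (1 + (t1 + (1 + (t2 + (1 + (1 + (1 + (1 + (1 + (1 + 1))))))))) + t + 3).
move=> R R0 R3 R2 lew Rw.
set Ra := effect (LoadI 3 0) R.
have Ra3 : Ra 3 = nth 0 w j by rewrite /Ra /effect /= R0 -Rw // addnS.
have [|Rb [runb Rb2 kb]] := t1P Ra; first by rewrite /Ra /effect /= R2.
set Rc := effect (Incr 2) Rb.
have Rc3 : Rc 3 = nth 0 w j by rewrite /Rc /effect /= kb.
have [||Rd [rund Rd2 kd]] := t2P Rc => //.
  by rewrite /Rc /effect /= Rb2.
pose Re := effect (Decr 3) (effect (Decr 3) (effect (Decr 3) (effect (Decr 3)
  (effect (Decr 3) (effect (Move 3 0) (effect (Decr 0) Rd)))))).
have keep i : i \notin [:: 2; 3; 4; 5] -> Rd i = R i.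
  move=> ik; rewrite kd //; move: ik; rewrite !inE !negb_or => /and4P[i2 i3 i4 i5].
  rewrite /Rc /effect /= /upd (negPf i2) kb ?inE ?negb_or ?i2 ?i4 ?i5 //.
  by rewrite /Ra /effect /= /upd (negPf i3).
have Rd0 : Rd 0 = 5 + j.+1 by rewrite keep.
have [||||i ij|R' [run R'2 R'1]] := tP (upd Re 5 0).
- by rewrite /Re /effect /= Rd0 /= addnS.
- by rewrite /Re /effect /= Rd0 addnS.
- by rewrite /Re /= Rd2 (drop_nth 0 lew).
- exact: ltnW.
- rewrite /Re /effect /= /upd /= keep // Rw //; exact: ltnW.
exists R'; split=> //.
  apply: RunLoop run; first by rewrite R3.
  apply: RunSeq (RunDo _ _) _ => //; apply: RunSeq runb _.
  apply: RunSeq (RunDo _ _) _ => //; apply: RunSeq rund _.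
  by do ![apply: RunSeq (RunDo _ _) _ => //]; apply: RunDo.
by rewrite R'1 /Re /effect /= keep.
Qed.

(** Registers 2 to 5 are needed as work space, so the entries they hold are copied behind the end of
    the input. From register 6 on the parameter list then reads rotated by four: the origin of
    [rot 4]. *)
Definition save_stmt : stmt :=
  Do (Incr 0) ;; Do (StoreI 0 2) ;; Do (Incr 0) ;; Do (StoreI 0 3) ;;
  Do (Incr 0) ;; Do (StoreI 0 4) ;; Do (Incr 0) ;; Do (StoreI 0 5) ;;
  Do (Const 2 0) ;; Do (Move 3 0) ;;
  Do (Decr 3) ;; Do (Decr 3) ;; Do (Decr 3) ;; Do (Decr 3) ;; Do (Decr 3).

Lemma runs_save (n : nat) (w : seq nat) : 4 <= size w ->
  exists R', [/\ runs save_stmt (reg (init (n :: w))) 15 R',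
    R' 0 = 5 + size w, R' 3 = size w, R' 2 = 0 /\ R' 1 = n &
    forall i, i < size w -> R' (6 + i) = nth 0 (rot 4 w) i].
Proof.
move=> w4; eexists; split.
- by do ![apply: (@RunSeq _ _ _ 1 _ _) => //]; do ?[exact: RunDo].
all: case: w w4 => [|a [|b [|c [|d w]]]] //= _; rewrite /rot /= ?drop0 ?take0 //.
move=> i ltw; rewrite nth_cat.
have [ltiw|leiw] := ltnP i (size w).
  by do 4![rewrite ifF; last by apply/eqP; lia].
have [j ij] : exists j, i = size w + j by exists (i - size w); lia.
subst i; rewrite addKn.
case: j ltw {leiw} => [|[|[|[|j]]]] ltw; last by lia.
- by do 3![rewrite ifF; last by apply/eqP; lia]; rewrite ifT //; apply/eqP; lia.
- by do 2![rewrite ifF; last by apply/eqP; lia]; rewrite ifT //; apply/eqP; lia.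
- by do 1![rewrite ifF; last by apply/eqP; lia]; rewrite ifT //; apply/eqP; lia.
- by rewrite ifT //; apply/eqP; lia.
Qed.

Definition load_stmt : stmt := save_stmt ;; encode_stmt.

Lemma runs_load (w : seq nat) : 4 <= size w ->
  {t | forall n, exists R', [/\ runs load_stmt (reg (init (n :: w))) t R',
    R' 2 = CodeSeq.code (rot 4 w) & R' 1 = n]}.
Proof.
move=> w4; have [t tP] := runs_encode (rot 4 w) (size w).
exists (15 + t) => n; have [R' [run R0 R3 [R2 R1] Rw]] := runs_save n w4.
have [|||||R'' [run' R''2 R''1]] := tP R' => //.
- by rewrite R2 drop_oversize // size_rot.
- by rewrite size_rot.
exists R''; split=> //; first exact: RunSeq run run'.
by rewrite R''1.
Qed.

(** Register 9 counts up and register 8 holds its distance to [S + Q]; when that reaches 0 they are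
    reset to [S] and [Q], kept in registers 6 and 7. The flags 10 and 11 make two loops that run at
    most once act as a conditional. *)
Definition reduce_body : stmt :=
  Do (Decr 1) ;; Do (Incr 9) ;; Do (Decr 8) ;; Do (Const 10 1) ;; Do (Move 11 8) ;;
  While 11 (Do (Const 10 0) ;; Do (Const 11 0)) ;;
  While 10 (Do (Move 9 6) ;; Do (Move 8 7) ;; Do (Const 10 0)).

Lemma runs_reduce_body (R : nat -> nat) :
  exists t R', [/\ runs reduce_body R t R', t <= 40 &
    [/\ R' 1 = (R 1).-1, R' 9 = (if (R 8).-1 == 0 then R 6 else (R 9).+1),
        R' 8 = (if (R 8).-1 == 0 then R 7 else (R 8).-1) &
        forall j, j \in [:: 2; 6; 7] -> R' j = R j]].
Proof.
set R1 := effect (Move 11 8) (effect (Const 10 1) (effect (Decr 8) (effect (Incr 9) (effect (Decr 1) R)))).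
case E: (R 8).-1 => [|c].
  pose R2 := effect (Const 10 0) (effect (Move 8 7) (effect (Move 9 6) R1)).
  exists (1 + (1 + (1 + (1 + (1 + (1 + (1 + (1 + 1) + 1 + 3))))))), (upd R2 5 0); split=> //.
    do 5![apply: RunSeq (RunDo _ _) _ => //].
    apply: RunSeq (RunStop _ _) _; first by rewrite /= E.
    apply: RunLoop (RunStop _ _) => //.
    by do 2![apply: RunSeq (RunDo _ _) _ => //]; apply: RunDo.
  by split=> // j; rewrite !inE => /or3P[] /eqP ->.
pose R2 := upd (effect (Const 11 0) (effect (Const 10 0) R1)) 5 0.
exists (1 + (1 + (1 + (1 + (1 + ((1 + 1 + 1 + 3) + 1)))))), R2; split=> //.
  do 5![apply: RunSeq (RunDo _ _) _ => //].
  apply: RunSeq (RunStop _ _) => //; apply: RunLoop (RunStop _ _) => //.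
    by rewrite /= E.
  by apply: RunSeq (RunDo _ _) _ => //; apply: RunDo.
by split=> //; rewrite /R2 /R1 /= ?E // => j; rewrite !inE => /or3P[] /eqP ->.
Qed.

(** A reset replaces [S + Q] by [S], which [G] does not notice. The 43 is 40 steps of the body plus
    three of loop overhead. *)
Lemma runs_reduce (S Q : nat) (G : nat -> nat) (n : nat) (R : nat -> nat) :
  (forall y, S <= y -> G (y + Q) = G y) -> 0 < Q ->
  R 1 = n -> R 6 = S -> R 7 = Q -> 0 < R 8 -> R 9 + R 8 = S + Q ->
  exists t R', [/\ runs (While 1 reduce_body) R t R', t <= 43 * n + 1, R' 2 = R 2,
    R' 9 < S + Q & G (R' 9) = G (R 9 + n)].
Proof.
move=> perG Q0; elim: n R => [|n IHn] R R1 R6 R7 R8 R98.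
  exists 1, R; split=> //; [exact: RunStop | lia | by rewrite addn0].
have [t [R' [run let40 [R'1 R'9 R'8 R'k]]]] := runs_reduce_body R.
have [|||||t' [R'' [run' let' R''2 R''9 GE]]] := IHn (upd R' 5 0).
- by rewrite /= R'1 R1.
- by rewrite /= R'k.
- by rewrite /= R'k.
- by rewrite /= R'8; case: eqP => // [_|]; rewrite ?R7 //; lia.
- by rewrite /= R'8 R'9; case: eqP => [_|]; rewrite ?R6 ?R7 //; lia.
exists (t + t' + 3), R''; split.
- by apply: RunLoop run run'; rewrite R1.
- by lia.
- by rewrite R''2 /= R'k.
- by [].
rewrite GE /= R'9; case: eqP => [R80|_]; last by rewrite addSnnS.
have -> : R 9 + n.+1 = S + n + Q by lia.
by rewrite perG ?R6 // leq_addr.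
Qed.

Lemma iter_halted (P : program) (s : config) (t : nat) :
  halted P s -> iter t (step P) s = s.
Proof.
move=> hs; elim: t => //= t ->; rewrite /step.
by rewrite onth_default.
Qed.

Lemma runs_computes_within (s : stmt) (w : seq nat) (t t' : nat) (R : nat -> nat) :
  runs s (reg (init w)) t R -> t <= t' ->
  computes_within (assemble 0 s) w t' (R 0).
Proof.
move=> run tt'; have E := runs_assemble run (P := assemble 0 s) (a := 0) (fun j _ => erefl).
have h : halted (assemble 0 s) (Config (0 + size (assemble 0 s)) R) by rewrite /halted /= add0n.
rewrite /computes_within -(subnK tt') iterD.
by have -> : init w = Config 0 (reg (init w)) by []; rewrite E iter_halted.
Qed.

(* The period makes it possible to replace n by some y < S + Q in linear time;
   the cost of everything else depends on the parameter only. *)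
Lemma periodic_fpt_computable (K : Type) (enc : K -> seq nat) (F : K -> nat -> nat)
    (eS eQ eT eF : expr) :
  let code k := CodeSeq.code (rot 4 (enc k)) in
  let S k := eval (fun=> code k) eS in
  let Q k := eval (fun=> code k) eQ in
  (forall k, 4 <= size (enc k)) ->
  (forall k, 0 < Q k) ->
  (forall k, eval (fun=> code k) eT = S k + Q k) ->
  (forall k n, S k <= n -> F k (n + Q k) = F k n) ->
  (forall k y, eval (scons (code k) (fun=> y)) eF = F k y) ->
  fpt_computable enc F.
Proof.
move=> code S Q enc4 Q0 eTE perF eFE.
pose prog : stmt :=
  load_stmt ;; expr_stmt 6 (fun=> 2) eS ;; expr_stmt 7 (fun=> 2) eQ ;;
  expr_stmt 8 (fun=> 2) eT ;; Do (Const 9 0) ;; While 1 reduce_body ;;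
  expr_stmt 12 (scons 2 (fun=> 9)) eF ;; Do (Move 0 12).
(* The running times were stated as [{t | _}] so that they can be extracted here as functions of the
   parameter. *)
pose tl k := sval (runs_load (enc4 k)).
pose tS k := sval (runs_expr eS (fun=> code k)).
pose tQ k := sval (runs_expr eQ (fun=> code k)).
pose tT k := sval (runs_expr eT (fun=> code k)).
pose tF k y := sval (runs_expr eF (scons (code k) (fun=> y))).
exists (assemble 0 prog), 1.
(* The final evaluation is run on a [y] that depends on [n]; summing its cost over all [y < S + Q]
   removes this dependence. The 46 covers the [43 * n + 1] steps of the reduction and two single
   instructions. *)
exists (fun k => tl k + tS k + tQ k + tT k + 46 + \sum_(y < S k + Q k) tF k y).
move=> k n; rewrite expn1.
have [R1 [run1 R12 R11]] := svalP (runs_load (enc4 k)) n.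
have placed2 d R : 5 < d -> R 2 = code k -> placed d (fun=> 2) (fun=> code k) R.
  by move=> d5 R2 i; split=> //; lia.
have [|R2 [run2 R26 ag2]] := svalP (runs_expr eS (fun=> code k)) 6 (fun=> 2) R1 isT.
  exact: placed2.
have R22 : R2 2 = code k by rewrite ag2.
have [|R3 [run3 R37 ag3]] := svalP (runs_expr eQ (fun=> code k)) 7 (fun=> 2) R2 isT.
  exact: placed2.
have R32 : R3 2 = code k by rewrite ag3.
have [|R4 [run4 R48 ag4]] := svalP (runs_expr eT (fun=> code k)) 8 (fun=> 2) R3 isT.
  exact: placed2.
have R42 : R4 2 = code k by rewrite ag4.
set R5 := effect (Const 9 0) R4.
have [|||||t6 [R6 [run6 le6 R62 R69 FE]]] := @runs_reduce (S k) (Q k) (F k) n R5 (perF k) (Q0 k).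
- by rewrite /R5 /= ag4 // ag3 // ag2 // R11.
- by rewrite /R5 /= ag4 // ag3 // R26.
- by rewrite /R5 /= ag4 // R37.
- by rewrite /R5 /= R48 eTE; have := Q0 k; lia.
- by rewrite /R5 /= R48 eTE.
have [|R7 [run7 R712 ag7]] := svalP (runs_expr eF (scons (code k) (fun=> R6 9))) 12
    (scons 2 (fun=> 9)) R6 isT.
  by case=> [|i]; split=> //=; rewrite R62 /R5.
have -> : F k n = effect (Move 0 12) R7 0 by rewrite /= R712 eFE FE /R5.
apply: runs_computes_within.
  apply: RunSeq run1 _; apply: RunSeq run2 _; apply: RunSeq run3 _.
  apply: RunSeq run4 _; apply: RunSeq (RunDo _ _) _ => //.
  by apply: RunSeq run6 _; apply: RunSeq run7 _; apply: RunDo.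
have leF : tF k (R6 9) <= \sum_(y < S k + Q k) tF k y.
  by rewrite (bigD1 (Ordinal R69)) //= leq_addr.
rewrite -/(tl k) -/(tS k) -/(tQ k) -/(tT k) -/(tF k (R6 9)).
set F' := (\sum_(y < _) _) in leF *.
move: (tl k) (tS k) (tQ k) (tT k) (tF k (R6 9)) leF => a b c d e leF.
by nia.
Qed.

(** * Definable functions *)

Definition lift_var (xi : nat -> nat) (i : nat) : nat :=
  if i is j.+2 then (xi j).+2 else i.

Fixpoint rename (xi : nat -> nat) (e : expr) : expr :=
  match e with
  | EVar i => EVar (xi i)
  | EZero => EZero
  | ESucc e => ESucc (rename xi e)
  | ERec e0 e1 e2 => ERec (rename xi e0) (rename xi e1) (rename (lift_var xi) e2)
  end.

Definition lift_expr (sigma : nat -> expr) (i : nat) : expr :=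
  if i is j.+2 then rename (fun k => k.+2) (sigma j) else EVar i.

Fixpoint subst_expr (sigma : nat -> expr) (e : expr) : expr :=
  match e with
  | EVar i => sigma i
  | EZero => EZero
  | ESucc e => ESucc (subst_expr sigma e)
  | ERec e0 e1 e2 =>
      ERec (subst_expr sigma e0) (subst_expr sigma e1) (subst_expr (lift_expr sigma) e2)
  end.

Lemma eq_iteri (f g : nat -> nat -> nat) (n x : nat) :
  (forall i y, f i y = g i y) -> iteri n f x = iteri n g x.
Proof. by move=> fg; elim: n => //= n ->. Qed.

Lemma eq_eval (rho rho' : nat -> nat) (e : expr) :
  rho =1 rho' -> eval rho e = eval rho' e.
Proof.
elim: e rho rho' => [i|//|e IHe|e0 IH0 e1 IH1 e2 IH2] rho rho' rr' //=.
  by rewrite (IHe _ _ rr').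
rewrite (IH0 _ _ rr') (IH1 _ _ rr'); apply: eq_iteri => i x.
by apply: IH2 => -[|[|j]] /=.
Qed.

Lemma eval_rename (rho xi : nat -> nat) (e : expr) :
  eval rho (rename xi e) = eval (rho \o xi) e.
Proof.
elim: e rho xi => [i|//|e IHe|e0 IH0 e1 IH1 e2 IH2] rho xi //=.
  by rewrite IHe.
rewrite IH0 IH1; apply: eq_iteri => i x; rewrite IH2.
by apply: eq_eval => -[|[|j]].
Qed.

Lemma eval_subst (rho : nat -> nat) (sigma : nat -> expr) (e : expr) :
  eval rho (subst_expr sigma e) = eval (fun i => eval rho (sigma i)) e.
Proof.
elim: e rho sigma => [i|//|e IHe|e0 IH0 e1 IH1 e2 IH2] rho sigma //=.
  by rewrite IHe.
rewrite IH0 IH1; apply: eq_iteri => i x; rewrite IH2.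
by apply: eq_eval => -[|[|j]] //=; rewrite eval_rename; apply: eq_eval.
Qed.

Definition definable (F : (nat -> nat) -> nat) : Prop :=
  exists e, forall rho, eval rho e = F rho.

Lemma definable_ext (F G : (nat -> nat) -> nat) :
  definable F -> (forall rho, G rho = F rho) -> definable G.
Proof. by move=> [e eE] GF; exists e => rho; rewrite GF. Qed.

Lemma definable_rename (F : (nat -> nat) -> nat) (xi : nat -> nat) :
  definable F -> definable (fun rho => F (fun i => rho (xi i))).
Proof. by move=> [e eE]; exists (rename xi e) => rho; rewrite eval_rename -eE. Qed.

Lemma definable_var (i : nat) : definable (fun rho => rho i).
Proof. by exists (EVar i). Qed.

Lemma definable_succ (a : (nat -> nat) -> nat) :
  definable a -> definable (fun rho => (a rho).+1).
Proof. by move=> [e eE]; exists (ESucc e) => rho /=; rewrite eE. Qed.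

Lemma definable_const (c : nat) : definable (fun=> c).
Proof. by elim: c => [|c /definable_succ //]; exists EZero. Qed.

Lemma definable_iteri (a b : (nat -> nat) -> nat) (c : nat -> nat -> (nat -> nat) -> nat) :
  definable a -> definable b ->
  definable (fun rho => c (rho 0) (rho 1) (fun i => rho i.+2)) ->
  definable (fun rho => iteri (a rho) (fun i x => c i x rho) (b rho)).
Proof.
move=> [ea aE] [eb bE] [ec cE]; exists (ERec ea eb ec) => rho /=.
by rewrite aE bE; apply: eq_iteri => i x; rewrite cE.
Qed.

Lemma definable_comp1 (f : nat -> nat) (a : (nat -> nat) -> nat) :
  definable (fun rho => f (rho 0)) -> definable a -> definable (fun rho => f (a rho)).
Proof.
move=> [e eE] [ea aE]; exists (subst_expr (fun=> ea) e) => rho.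
by rewrite eval_subst eE aE.
Qed.

Lemma definable_comp2 (f : nat -> nat -> nat) (a b : (nat -> nat) -> nat) :
  definable (fun rho => f (rho 0) (rho 1)) -> definable a -> definable b ->
  definable (fun rho => f (a rho) (b rho)).
Proof.
move=> [e eE] [ea aE] [eb bE].
exists (subst_expr (fun i => if i is 0 then ea else eb) e) => rho.
by rewrite eval_subst eE aE bE.
Qed.

Lemma definable_comp3 (f : nat -> nat -> nat -> nat) (a b c : (nat -> nat) -> nat) :
  definable (fun rho => f (rho 0) (rho 1) (rho 2)) ->
  definable a -> definable b -> definable c ->
  definable (fun rho => f (a rho) (b rho) (c rho)).
Proof.
move=> [e eE] [ea aE] [eb bE] [ec cE].
exists (subst_expr (fun i => match i with 0 => ea | 1 => eb | _ => ec end) e) => rho.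
by rewrite eval_subst eE aE bE cE.
Qed.

Lemma definable_add (a b : (nat -> nat) -> nat) :
  definable a -> definable b -> definable (fun rho => a rho + b rho).
Proof.
apply: (definable_comp2 (f := addn)).
apply: definable_ext (definable_iteri (c := fun _ x _ => x.+1) (definable_var 0)
  (definable_var 1) (definable_succ (definable_var 1))) _ => rho.
by elim: (rho 0) => //= n <-.
Qed.

Lemma definable_pred (a : (nat -> nat) -> nat) :
  definable a -> definable (fun rho => (a rho).-1).
Proof.
apply: (definable_comp1 (f := predn)).
apply: definable_ext (definable_iteri (c := fun i _ _ => i) (definable_var 0)
  (definable_const 0) (definable_var 0)) _ => rho.
by case: (rho 0).
Qed.

Lemma definable_sub (a b : (nat -> nat) -> nat) :
  definable a -> definable b -> definable (fun rho => a rho - b rho).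
Proof.
apply: (definable_comp2 (f := subn)).
apply: definable_ext (definable_iteri (c := fun _ x _ => x.-1) (definable_var 1)
  (definable_var 0) (definable_pred (definable_var 1))) _ => rho.
by elim: (rho 1) => [|n IHn] /=; rewrite ?subn0 // subnS IHn.
Qed.

Lemma definable_mul (a b : (nat -> nat) -> nat) :
  definable a -> definable b -> definable (fun rho => a rho * b rho).
Proof.
apply: (definable_comp2 (f := muln)).
apply: definable_ext (definable_iteri (c := fun _ x rho => rho 1 + x) (definable_var 0)
  (definable_const 0) (definable_add (definable_var 3) (definable_var 1))) _ => rho.
by elim: (rho 0) => [|n IHn] /=; rewrite ?mul0n // mulSn IHn.
Qed.

Lemma definable_exp (a b : (nat -> nat) -> nat) :
  definable a -> definable b -> definable (fun rho => a rho ^ b rho).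
Proof.
apply: (definable_comp2 (f := expn)).
apply: definable_ext (definable_iteri (c := fun _ x rho => rho 0 * x) (definable_var 1)
  (definable_const 1) (definable_mul (definable_var 2) (definable_var 1))) _ => rho.
by elim: (rho 1) => [|n IHn] /=; rewrite ?expn0 // expnS IHn.
Qed.

Lemma definable_fact (a : (nat -> nat) -> nat) :
  definable a -> definable (fun rho => (a rho)`!).
Proof.
apply: (definable_comp1 (f := factorial)).
apply: definable_ext (definable_iteri (c := fun i x _ => i.+1 * x) (definable_var 0)
  (definable_const 1) (definable_mul (definable_succ (definable_var 0)) (definable_var 1))) _ => rho.
by elim: (rho 0) => [|n IHn] //=; rewrite factS IHn.
Qed.

Lemma definable_negb (a : (nat -> nat) -> bool) :
  definable (fun rho => a rho) -> definable (fun rho => ~~ a rho).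
Proof.
move=> da; apply: definable_ext (definable_sub (definable_const 1) da) _ => rho.
by case: (a rho).
Qed.

Lemma definable_leq (a b : (nat -> nat) -> nat) :
  definable a -> definable b -> definable (fun rho => a rho <= b rho).
Proof.
move=> da db; apply: definable_ext
  (definable_sub (definable_const 1) (definable_sub da db)) _ => rho.
by rewrite -subn_eq0; case: (_ - _).
Qed.

Lemma definable_andb (a b : (nat -> nat) -> bool) :
  definable (fun rho => a rho) -> definable (fun rho => b rho) ->
  definable (fun rho => a rho && b rho).
Proof.
move=> da db; apply: definable_ext (definable_mul da db) _ => rho.
by rewrite mulnb.
Qed.

Lemma definable_orb (a b : (nat -> nat) -> bool) :
  definable (fun rho => a rho) -> definable (fun rho => b rho) ->
  definable (fun rho => a rho || b rho).
Proof.
move=> da db; apply: definable_ext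
  (definable_negb (definable_andb (definable_negb da) (definable_negb db))) _ => rho.
by rewrite negb_and !negbK.
Qed.

Lemma definable_implb (a b : (nat -> nat) -> bool) :
  definable (fun rho => a rho) -> definable (fun rho => b rho) ->
  definable (fun rho => a rho ==> b rho).
Proof.
move=> da db; apply: definable_ext (definable_orb (definable_negb da) db) _ => rho.
by rewrite implybE.
Qed.

Lemma definable_eqn (a b : (nat -> nat) -> nat) :
  definable a -> definable b -> definable (fun rho => a rho == b rho).
Proof.
move=> da db; apply: definable_ext
  (definable_andb (definable_leq da db) (definable_leq db da)) _ => rho.
by rewrite -eqn_leq.
Qed.

Lemma definable_if (c : (nat -> nat) -> bool) (a b : (nat -> nat) -> nat) :
  definable (fun rho => c rho) -> definable a -> definable b ->
  definable (fun rho => if c rho then a rho else b rho).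
Proof.
move=> dc da db; apply: definable_ext
  (definable_add (definable_mul dc da) (definable_mul (definable_negb dc) db)) _ => rho.
by case: (c rho); rewrite /= ?mul1n ?mul0n ?addn0.
Qed.

Lemma definable_ifb (c a b : (nat -> nat) -> bool) :
  definable (fun rho => c rho) -> definable (fun rho => a rho) ->
  definable (fun rho => b rho) -> definable (fun rho => if c rho then a rho else b rho).
Proof.
move=> dc da db; apply: definable_ext (definable_if dc da db) _ => rho.
by case: (c rho).
Qed.

Lemma definable_sum (n : (nat -> nat) -> nat) (F : nat -> (nat -> nat) -> nat) :
  definable n -> definable (fun rho => F (rho 0) (fun i => rho i.+1)) ->
  definable (fun rho => \sum_(0 <= i < n rho) F i rho).
Proof.
move=> dn dF; pose xi i := if i is j.+1 then j.+2 else 0.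
apply: definable_ext (definable_iteri (c := fun i x rho => x + F i rho) dn
  (definable_const 0) (definable_add (definable_var 1) (definable_rename xi dF))) _ => rho.
elim: (n rho) => [|m IHm] /=; first by rewrite big_geq.
by rewrite big_nat_recr //= IHm.
Qed.

Definition exists_below (n : nat) (P : nat -> bool) : bool :=
  0 < \sum_(0 <= i < n) P i.

Lemma exists_belowP (n : nat) (P : nat -> bool) :
  reflect (exists2 i, i < n & P i) (exists_below n P).
Proof.
rewrite /exists_below big_mkord lt0n sum_nat_eq0 negb_forall.
apply: (iffP existsP) => [[i]|[i ltn Pi]].
  by case Pi: (P i) => // _; exists i.
by exists (Ordinal ltn); rewrite /= Pi.
Qed.

Lemma definable_exists_below (n : (nat -> nat) -> nat) (P : nat -> (nat -> nat) -> bool) :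
  definable n -> definable (fun rho => P (rho 0) (fun i => rho i.+1)) ->
  definable (fun rho => exists_below (n rho) (fun i => P i rho)).
Proof.
move=> dn dP; apply: definable_leq; first exact: definable_const.
exact: (definable_sum (F := fun i rho => P i rho)).
Qed.

(** The quotient counts the positive multiples of the divisor up to the dividend. A zero divisor is
    tested apart because there the count would be the dividend instead of 0. *)
Lemma definable_div (a b : (nat -> nat) -> nat) :
  definable a -> definable b -> definable (fun rho => a rho %/ b rho).
Proof.
apply: (definable_comp2 (f := divn)).
apply: definable_ext (definable_if (c := fun rho => rho 1 == 0) _ (definable_const 0)
  (definable_sum (F := fun i rho => i.+1 * rho 1 <= rho 0) (definable_var 0) _)) _.
- by apply: definable_eqn; [apply: definable_var | apply: definable_const].
- apply: definable_leq; last exact: definable_var.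
  by apply: definable_mul; [apply/definable_succ/definable_var | apply: definable_var].
move=> rho; move: (rho 0) (rho 1) => m d.
have [->|] := posnP d; first by rewrite divn0.
move=> d0.
rewrite (eq_bigr (fun i => (i < m %/ d : nat))); last first.
  by move=> i _; rewrite leq_divRL.
have le : m %/ d <= m by apply: leq_div.
rewrite (big_cat_nat (n := m %/ d)) //= [X in _ + X]big_nat_cond.
rewrite [X in _ + X]big1 ?addn0 => [|i /andP[/andP[lei _] _]]; last by rewrite ltnNge lei.
rewrite big_nat_cond (eq_bigr (fun=> 1)) => [|i /andP[/andP[_ ->]]] //.
by rewrite -big_nat_cond sum_nat_const_nat subn0 muln1.
Qed.

Lemma definable_mod (a b : (nat -> nat) -> nat) :
  definable a -> definable b -> definable (fun rho => a rho %% b rho).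
Proof.
move=> da db; apply: definable_ext
  (definable_sub da (definable_mul (definable_div da db) db)) _ => rho.
by rewrite {2}(divn_eq (a rho) (b rho)) addKn.
Qed.

Lemma definable_odd (a : (nat -> nat) -> nat) :
  definable a -> definable (fun rho => odd (a rho)).
Proof.
move=> da; apply: definable_ext (definable_mod da (definable_const 2)) _ => rho.
by rewrite modn2.
Qed.

(** * Arithmetization of lists, formulas and topologies *)

Definition bit (T z : nat) : bool := odd (T %/ 2 ^ z).

Definition bits (B : nat) (P : nat -> bool) : nat := \sum_(0 <= i < B) 2 ^ i * P i.

Definition code_cons (x H : nat) : nat := 2 ^ x * (2 * H).+1.

(** The exponent of 2 in [K], found by a search below [K]; for the empty list, [K = 0], the sum is
    empty and the head is 0. *)
Definition code_head (K : nat) : nat := \sum_(0 <= i < K) (K %% 2 ^ i.+1 == 0).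

Definition code_tail (K : nat) : nat := K %/ 2 ^ code_head K %/ 2.

Definition code_nth (K i : nat) : nat := code_head (iteri i (fun _ x => code_tail x) K).

Definition code_size (K : nat) : nat :=
  \sum_(0 <= i < K) (0 < iteri i (fun _ x => code_tail x) K).

Definition digit (M g i : nat) : nat := (g %/ M ^ i) %% M.

(** A de Bruijn environment as digits in base [M]: the new value becomes digit 0. The remainder
    keeps the code below [E], so that truth tables have a fixed size. *)
Definition push (M E e a : nat) : nat := (e * M + a) %% E.

(* The history of a token list has three entries per position: the token, the
   length of the formula parsed from that position on, and its truth table; the
   bit e * E + g of the table is the truth value in the environment (e, g), whose
   i-th digit in base 2 ^ N is the value of the variable with index i. *)
Definition tok (H d : nat) : nat := code_nth H (3 * d).
Definition len (H d : nat) : nat := code_nth H (3 * d).+1.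
Definition tab (H d : nat) : nat := code_nth H (3 * d).+2.

Definition term_value (M tag i e : nat) : nat := if tag == 0 then digit M e i else i.

(** The atoms have fixed lengths 5, 3 and 4 since a term takes two tokens. The second operand of a
    connective starts where the first ends, at [len H 0]. *)
Definition len_step (x H : nat) : nat :=
  if x == 0 then 5 else if x == 1 then 3 else if x == 2 then 4
  else if [|| x == 4, x == 5 | x == 6] then (len H 0 + len H (len H 0)).+1
  else (len H 0).+1.

(** Quantifiers look up other environments in the table of the subformula, so storing whole tables
    turns the recursion on formulas into one pass over the tokens from right to left. *)
Definition truth (N O E x H e g : nat) : bool :=
  if x == 0 then
    term_value (2 ^ N) (tok H 0) (tok H 1) e == term_value (2 ^ N) (tok H 2) (tok H 3) e
  else if x == 1 then digit (2 ^ N) g (tok H 0) == digit (2 ^ N) g (tok H 1)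
  else if x == 2 then
    bit (digit (2 ^ N) g (tok H 2)) (term_value (2 ^ N) (tok H 0) (tok H 1) e)
  else if x == 3 then ~~ bit (tab H 0) (e * E + g)
  else if x == 4 then bit (tab H 0) (e * E + g) && bit (tab H (len H 0)) (e * E + g)
  else if x == 5 then bit (tab H 0) (e * E + g) || bit (tab H (len H 0)) (e * E + g)
  else if x == 6 then bit (tab H 0) (e * E + g) ==> bit (tab H (len H 0)) (e * E + g)
  else if x == 7 then
    exists_below N (fun a => bit (tab H 0) (push (2 ^ N) E e a * E + g))
  else if x == 8 then
    ~~ exists_below N (fun a => ~~ bit (tab H 0) (push (2 ^ N) E e a * E + g))
  else if x == 9 then
    exists_below (2 ^ N)
      (fun a => bit O a && bit (tab H 0) (e * E + push (2 ^ N) E g a))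
  else
    ~~ exists_below (2 ^ N)
      (fun a => bit O a && ~~ bit (tab H 0) (e * E + push (2 ^ N) E g a)).

Definition step_history (N O E x H : nat) : nat :=
  code_cons x (code_cons (len_step x H)
    (code_cons (bits (E * E) (fun z => truth N O E x H (z %/ E) (z %% E))) H)).

(** Undoes the rotation by four made when the input was loaded. *)
Definition token (K i : nat) : nat :=
  code_nth K ((i + code_size K - 4) %% code_size K).

(** The first two entries of the input are [m] and [r], hence the 2 that is subtracted. *)
Definition history (N O E K : nat) : nat :=
  iteri (code_size K - 2)
    (fun j H => step_history N O E (token K (code_size K - j.+1)) H) 0.

(** Bit [a] of [o] tells whether the set with characteristic number [a] is open. By finiteness
    binary unions stand for arbitrary ones. *)
Definition topology_code (N o : nat) : bool :=
  [&& bit o 0, bit o (2 ^ N).-1 &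
    ~~ exists_below (2 ^ N) (fun a => exists_below (2 ^ N) (fun b =>
      [&& bit o a, bit o b &
        ~~ (bit o (bits N (fun i => bit a i || bit b i)) &&
            bit o (bits N (fun i => bit a i && bit b i)))]))].

Definition count_models (N K : nat) : nat :=
  \sum_(0 <= o < 2 ^ (2 ^ N))
    (topology_code N o && bit (tab (history N o ((2 ^ N) ^ code_size K) K) 0) 0).

Definition count_mod (K y : nat) : nat := count_models (token K 1 + y) K %% token K 0.

Ltac definability_step :=
  lazymatch goal with
  | H : definable ?F |- definable ?F => exact: H
  | |- definable (fun rho => rho ?i) => exact: (definable_var i)
  | |- definable (fun _ => ?c) => exact: (definable_const c)
  | |- definable (fun rho => nat_of_bool (exists_below (@?n rho) (@?P rho))) =>
      refine (@definable_exists_below n (fun i rho => P rho i) _ _)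
  | |- definable (fun rho => bigop.body 0 (index_iota 0 (@?n rho))
                               (fun i => BigBody i addn true (@?F rho i))) =>
      refine (@definable_sum n (fun i rho => F rho i) _ _)
  | |- definable (fun rho => nat_of_bool (~~ @?a rho)) => apply: (@definable_negb a)
  | |- definable (fun rho => nat_of_bool (@?a rho && @?b rho)) =>
      apply: (@definable_andb a b)
  | |- definable (fun rho => nat_of_bool (@?a rho || @?b rho)) =>
      apply: (@definable_orb a b)
  | |- definable (fun rho => nat_of_bool (@?a rho ==> @?b rho)) =>
      apply: (@definable_implb a b)
  | |- definable (fun rho => nat_of_bool (@?a rho == @?b rho)) =>
      apply: (@definable_eqn a b)
  | |- definable (fun rho => nat_of_bool (@?a rho <= @?b rho)) =>
      apply: (@definable_leq a b)
  | |- definable (fun rho => nat_of_bool (odd (@?a rho))) => apply: (@definable_odd a)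
  | |- definable (fun rho => S (@?a rho)) => apply: (@definable_succ a)
  | |- definable (fun rho => predn (@?a rho)) => apply: (@definable_pred a)
  | |- definable (fun rho => @?a rho + @?b rho) => apply: (@definable_add a b)
  | |- definable (fun rho => @?a rho - @?b rho) => apply: (@definable_sub a b)
  | |- definable (fun rho => @?a rho * @?b rho) => apply: (@definable_mul a b)
  | |- definable (fun rho => @?a rho ^ @?b rho) => apply: (@definable_exp a b)
  | |- definable (fun rho => @?a rho %/ @?b rho) => apply: (@definable_div a b)
  | |- definable (fun rho => @?a rho %% @?b rho) => apply: (@definable_mod a b)
  | |- definable (fun rho => factorial (@?a rho)) => apply: (@definable_fact a)
  | |- definable (fun rho => nat_of_bool _) => apply: definable_ifb
  | |- _ => apply: definable_if
  end.

Ltac definability := repeat (cbv beta; definability_step).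

Lemma definable_bit (a b : (nat -> nat) -> nat) :
  definable a -> definable b -> definable (fun rho => bit (a rho) (b rho)).
Proof.
apply: (definable_comp2 (f := fun x y => bit x y)).
by rewrite /bit; definability.
Qed.

Lemma definable_bits (a : (nat -> nat) -> nat) (P : nat -> (nat -> nat) -> bool) :
  definable a -> definable (fun rho => P (rho 0) (fun i => rho i.+1)) ->
  definable (fun rho => bits (a rho) (fun i => P i rho)).
Proof.
move=> da dP; apply: (definable_sum (F := fun i rho => 2 ^ i * P i rho)) => //.
by apply: definable_mul => //; definability.
Qed.

Lemma definable_code_cons (a b : (nat -> nat) -> nat) :
  definable a -> definable b -> definable (fun rho => code_cons (a rho) (b rho)).
Proof. by move=> da db; rewrite /code_cons; definability. Qed.

Lemma definable_code_head (a : (nat -> nat) -> nat) :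
  definable a -> definable (fun rho => code_head (a rho)).
Proof.
apply: (definable_comp1 (f := code_head)).
by rewrite /code_head; definability.
Qed.

Lemma definable_code_tail (a : (nat -> nat) -> nat) :
  definable a -> definable (fun rho => code_tail (a rho)).
Proof.
apply: (definable_comp1 (f := code_tail)); rewrite /code_tail.
have dh := definable_code_head (definable_var 0).
by definability.
Qed.

Lemma definable_iter_tail (a b : (nat -> nat) -> nat) :
  definable a -> definable b ->
  definable (fun rho => iteri (b rho) (fun _ x => code_tail x) (a rho)).
Proof.
move=> da db; apply: (definable_iteri (c := fun _ x _ => code_tail x)) => //.
exact: definable_code_tail (definable_var 1).
Qed.

Lemma definable_code_nth (a b : (nat -> nat) -> nat) :
  definable a -> definable b -> definable (fun rho => code_nth (a rho) (b rho)).
Proof. by move=> da db; apply: definable_code_head; apply: definable_iter_tail. Qed.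

Lemma definable_code_size (a : (nat -> nat) -> nat) :
  definable a -> definable (fun rho => code_size (a rho)).
Proof.
apply: (definable_comp1 (f := code_size)); rewrite /code_size.
apply: (definable_sum (F := fun i rho => 0 < iteri i (fun _ x => code_tail x) (rho 0))).
  exact: definable_var.
apply: definable_leq; first exact: definable_const.
by apply: (definable_iter_tail (a := fun rho => rho 1)); apply: definable_var.
Qed.

Lemma definable_digit (a b c : (nat -> nat) -> nat) :
  definable a -> definable b -> definable c ->
  definable (fun rho => digit (a rho) (b rho) (c rho)).
Proof.
apply: (definable_comp3 (f := digit)); rewrite /digit; definability.
Qed.

Lemma definable_token (a b : (nat -> nat) -> nat) :
  definable a -> definable b -> definable (fun rho => token (a rho) (b rho)).
Proof.
apply: (definable_comp2 (f := token)); rewrite /token.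
apply: definable_code_nth; first exact: definable_var.
have ds := definable_code_size (definable_var 0).
by definability.
Qed.

Lemma definable_tok (a b : (nat -> nat) -> nat) :
  definable a -> definable b -> definable (fun rho => tok (a rho) (b rho)).
Proof. by move=> da db; apply: definable_code_nth => //; definability. Qed.

Lemma definable_len (a b : (nat -> nat) -> nat) :
  definable a -> definable b -> definable (fun rho => len (a rho) (b rho)).
Proof. by move=> da db; apply: definable_code_nth => //; definability. Qed.

Lemma definable_tab (a b : (nat -> nat) -> nat) :
  definable a -> definable b -> definable (fun rho => tab (a rho) (b rho)).
Proof. by move=> da db; apply: definable_code_nth => //; definability. Qed.

Ltac definability_code_step :=
  lazymatch goal with
  | |- definable (fun rho => nat_of_bool (bit (@?a rho) (@?b rho))) =>
      apply: (@definable_bit a b)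
  | |- definable (fun rho => bits (@?a rho) (@?P rho)) =>
      refine (@definable_bits a (fun i rho => P rho i) _ _)
  | |- definable (fun rho => code_cons (@?a rho) (@?b rho)) =>
      apply: (@definable_code_cons a b)
  | |- definable (fun rho => digit (@?a rho) (@?b rho) (@?c rho)) =>
      apply: (@definable_digit a b c)
  | |- definable (fun rho => token (@?a rho) (@?b rho)) => apply: (@definable_token a b)
  | |- definable (fun rho => tok (@?a rho) (@?b rho)) => apply: (@definable_tok a b)
  | |- definable (fun rho => len (@?a rho) (@?b rho)) => apply: (@definable_len a b)
  | |- definable (fun rho => tab (@?a rho) (@?b rho)) => apply: (@definable_tab a b)
  | |- definable (fun rho => code_size (@?a rho)) => apply: (@definable_code_size a)
  | _ => definability_step
  end.

Ltac definability_code := repeat (cbv beta; definability_code_step).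

Lemma definable_count_models (a b : (nat -> nat) -> nat) :
  definable a -> definable b -> definable (fun rho => count_models (a rho) (b rho)).
Proof.
apply: (definable_comp2 (f := count_models)); rewrite /count_models.
apply: (@definable_sum _ (fun o rho => topology_code (rho 0) o &&
  bit (tab (history (rho 0) o ((2 ^ rho 0) ^ code_size (rho 1)) (rho 1)) 0) 0)).
  by definability.
apply: definable_andb.
  by rewrite /topology_code; definability_code.
apply: definable_bit; last exact: definable_const.
apply: definable_tab; last exact: definable_const.
apply: (@definable_iteri _ _ (fun j H rho => step_history (rho 1) (rho 0)
  ((2 ^ rho 1) ^ code_size (rho 2)) (token (rho 2) (code_size (rho 2) - j.+1)) H)).
- by definability_code.
- by definability_code.
rewrite /step_history /truth /term_value /push /len_step.
by definability_code.
Qed.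

Lemma definable_count_mod : definable (fun rho => count_mod (rho 0) (rho 1)).
Proof.
apply: definable_mod; last by definability_code.
by apply: definable_count_models; definability_code.
Qed.

(** The carriers grow by an exponential at each nested quantifier, so the height of the bound has to
    depend on the sentence. *)
Definition tower (n : nat) : nat := iteri n (fun _ x => 2 ^ x) 1.

Lemma definable_tower (a : (nat -> nat) -> nat) :
  definable a -> definable (fun rho => tower (a rho)).
Proof.
move=> da; apply: (@definable_iteri _ _ (fun _ x _ => 2 ^ x)) => //; by definability.
Qed.

(** * Correctness of the brute-force count *)

Arguments code_nth : simpl never.
Arguments tok : simpl never.
Arguments len : simpl never.
Arguments tab : simpl never.
Arguments bit : simpl never.
Arguments step_history : simpl never.

Lemma bit0 (T : nat) : bit T 0 = odd T.
Proof. by rewrite /bit expn0 divn1. Qed.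

Lemma bitS (T z : nat) : bit T z.+1 = bit T./2 z.
Proof. by rewrite /bit expnS divnMA divn2. Qed.

Lemma bits_recl (B : nat) (P : nat -> bool) :
  bits B.+1 P = P 0 + (bits B (fun i => P i.+1)).*2.
Proof.
rewrite /bits big_nat_recl // expn0 mul1n -mul2n big_distrr /=.
by congr (_ + _); apply: eq_bigr => i _; rewrite expnS mulnA.
Qed.

Lemma bit_bits (B : nat) (P : nat -> bool) (z : nat) : z < B -> bit (bits B P) z = P z.
Proof.
elim: B P z => // B IHB P [|z] ltz; rewrite bits_recl.
  by rewrite bit0 oddD odd_double addbF oddb.
by rewrite bitS half_bit_double IHB.
Qed.

Lemma bits_lt (B : nat) (P : nat -> bool) : bits B P < 2 ^ B.
Proof.
elim: B P => [|B IHB] P; first by rewrite /bits big_geq.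
rewrite bits_recl expnS mul2n; have := IHB (fun i => P i.+1).
by rewrite -!addnn; case: (P 0) => /=; lia.
Qed.

Lemma bits_bit (B a : nat) : a < 2 ^ B -> bits B (bit a) = a.
Proof.
elim: B a => [|B IHB] a lta.
  by rewrite /bits big_geq //; move: lta; rewrite expn0 ltnS leqn0 => /eqP.
rewrite bits_recl bit0 -[RHS]odd_double_half; congr (_ + _.*2).
rewrite -[RHS]IHB; first by apply: eq_bigr => i _; rewrite bitS.
by move: lta; rewrite -{1}(odd_double_half a) expnS mul2n -!addnn; lia.
Qed.

Lemma eq_bits (B : nat) (P Q : nat -> bool) :
  (forall i, i < B -> P i = Q i) -> bits B P = bits B Q.
Proof.
move=> PQ; rewrite /bits big_nat_cond [RHS]big_nat_cond; apply: eq_bigr => i.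
by rewrite andbT => /andP[_ ltiB]; rewrite PQ.
Qed.

(** The cofactor of [2 ^ x] is odd, so [2 ^ i.+1] divides the code exactly when [i < x]; as [x] is
    below the code, the search meets all these [i]. *)
Lemma code_head_cons (x H : nat) : code_head (code_cons x H) = x.
Proof.
set K := code_cons x H; have ltxK : x < K.
  rewrite /K /code_cons; apply: leq_trans (ltn_expl x (ltnSn 1)) _.
  by rewrite leq_pmulr.
have divK i : (K %% 2 ^ i.+1 == 0) = (i < x).
  have K0 : 0 < K by apply: leq_ltn_trans ltxK.
  rewrite -/(dvdn _ _) pfactor_dvdn // /K /code_cons lognM ?expn_gt0 // pfactorK //.
  by rewrite logn_coprime ?addn0 // prime_coprime // dvdn2 /= mul2n odd_double.
rewrite /code_head (eq_bigr (fun i => (i < x : nat))) => [|i _]; last by rewrite divK.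
rewrite (big_cat_nat (n := x)) //=; last exact: ltnW.
rewrite [X in _ + X]big_nat_cond [X in _ + X]big1 ?addn0; last first.
  by move=> i /andP[/andP[lei _] _]; rewrite ltnNge lei.
rewrite big_nat_cond (eq_bigr (fun=> 1)) => [|i /andP[/andP[_ ->]]] //.
by rewrite -big_nat_cond sum_nat_const_nat subn0 muln1.
Qed.

Lemma code_tail_cons (x H : nat) : code_tail (code_cons x H) = H.
Proof.
rewrite /code_tail code_head_cons /code_cons mulKn ?expn_gt0 //.
by rewrite divn2 mul2n /= uphalf_double.
Qed.

Lemma code_nth_cons0 (x H : nat) : code_nth (code_cons x H) 0 = x.
Proof. exact: code_head_cons. Qed.

Lemma iteri_const (f : nat -> nat) (n x : nat) : iteri n (fun=> f) x = iter n f x.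
Proof. by elim: n => //= n ->. Qed.

Lemma code_nth_consS (x H i : nat) : code_nth (code_cons x H) i.+1 = code_nth H i.
Proof. by rewrite /code_nth !iteri_const iterSr code_tail_cons. Qed.

Lemma code_consE (x : nat) (s : seq nat) :
  CodeSeq.code (x :: s) = code_cons x (CodeSeq.code s).
Proof. by rewrite /code_cons mul2n. Qed.

Lemma code_nthE (s : seq nat) (i : nat) : code_nth (CodeSeq.code s) i = nth 0 s i.
Proof.
have tail0 n : iter n code_tail 0 = 0.
  by elim: n => //= n ->; rewrite /code_tail /code_head big_geq // divn1.
elim: s i => [|x s IHs] i.
  by rewrite nth_nil /code_nth iteri_const tail0 /code_head big_geq.
by case: i => [|i]; rewrite code_consE ?code_nth_cons0 ?code_nth_consS.
Qed.

Lemma size_code (s : seq nat) : size s <= CodeSeq.code s.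
Proof.
elim: s => //= x s IHs; apply: leq_trans (leq_pmull _ _); last by rewrite expn_gt0.
by rewrite ltnS -addnn; apply: leq_trans IHs (leq_addr _ _).
Qed.

Lemma code_sizeE (s : seq nat) : code_size (CodeSeq.code s) = size s.
Proof.
have iter_tail i t : iter i code_tail (CodeSeq.code t) = CodeSeq.code (drop i t).
  elim: i t => [|i IHi] t; first by rewrite drop0.
  case: t => [|x t]; rewrite iterSr; last by rewrite code_consE code_tail_cons IHi.
  have -> : code_tail (CodeSeq.code [::]) = CodeSeq.code [::].
    by rewrite /code_tail /code_head big_geq // divn1.
  by rewrite IHi.
have pos t : (0 < CodeSeq.code t) = (0 < size t).
  by case: t => //= x t; rewrite muln_gt0 expn_gt0.
rewrite /code_size (eq_bigr (fun i => (i < size s : nat))); last first.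
  by move=> i _; rewrite iteri_const iter_tail pos size_drop subn_gt0.
rewrite (big_cat_nat (n := size s)) //=; last exact: size_code.
rewrite [X in _ + X]big_nat_cond [X in _ + X]big1 ?addn0; last first.
  by move=> i /andP[/andP[lei _] _]; rewrite ltnNge lei.
rewrite big_nat_cond (eq_bigr (fun=> 1)) => [|i /andP[/andP[_ ->]]] //.
by rewrite -big_nat_cond sum_nat_const_nat subn0 muln1.
Qed.

Lemma token_rot (w : seq nat) (i : nat) :
  4 <= size w -> i < size w -> token (CodeSeq.code (rot 4 w)) i = nth 0 w i.
Proof.
move=> w4 ltiw; rewrite /token code_sizeE code_nthE size_rot /rot nth_cat size_drop nth_drop.
have [lti4|le4i] := ltnP i 4.
  rewrite modn_small; last by lia.
  rewrite ifF; last by apply/negbTE; rewrite -leqNgt; lia.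
  by rewrite nth_take; [congr nth; lia | lia].
have -> : i + size w - 4 = (i - 4) + size w by lia.
rewrite modnDr modn_small; last by lia.
by rewrite ifT; [congr nth; lia | lia].
Qed.

Lemma digit_push0 (M D e a : nat) : 0 < D -> a < M -> digit M (push M (M ^ D) e a) 0 = a.
Proof.
case: D => // D _ lta; rewrite /digit /push expn0 divn1.
by rewrite modn_dvdm ?expnS ?dvdn_mulr // modnMDl modn_small.
Qed.

Lemma digit_pushS (M D e a i : nat) :
  i.+1 < D -> a < M -> digit M (push M (M ^ D) e a) i.+1 = digit M e i.
Proof.
move=> ltiD lta; have M0 : 0 < M by apply: leq_ltn_trans lta.
rewrite /digit /push -[D](subnK (ltnW ltiD)) expnD -modn_divl modn_dvdm; last first.
  by rewrite -(subnSK ltiD) expnS dvdn_mulr.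
by rewrite expnS divnMA divnMDl // (divn_small lta) addn0.
Qed.

Lemma push_lt (M E e a : nat) : 0 < E -> push M E e a < E.
Proof. exact: ltn_pmod. Qed.

Definition set_num (N : nat) (A : {set 'I_N}) : nat :=
  bits N (fun i => if insub i is Some x then x \in A else false).

Definition num_set (N a : nat) : {set 'I_N} := [set x : 'I_N | bit a x].

Lemma bit_set_num (N : nat) (A : {set 'I_N}) (x : 'I_N) : bit (set_num A) x = (x \in A).
Proof. by rewrite bit_bits // valK. Qed.

Lemma set_num_lt (N : nat) (A : {set 'I_N}) : set_num A < 2 ^ N.
Proof. exact: bits_lt. Qed.

Lemma set_numK (N : nat) : cancel (@set_num N) (@num_set N).
Proof. by move=> A; apply/setP => x; rewrite inE bit_set_num. Qed.

Lemma num_setK (N a : nat) : a < 2 ^ N -> set_num (num_set N a) = a.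
Proof.
move=> lta; rewrite -[RHS](bits_bit lta); apply: eq_bits => i ltiN.
by rewrite insubT /= inE.
Qed.

Section Evaluation.

Variables (N r D o : nat) (cst : 'I_r -> 'I_N).
Hypothesis cstE : forall i, cst i = i :> nat.

Local Notation M := (2 ^ N).
Local Notation E := ((2 ^ N) ^ D).

Definition opens_of : {set {set 'I_N}} := [set A | bit o (set_num A)].

Local Notation openset := {A : {set 'I_N} | A \in opens_of}.

Definition hist (ts : seq nat) : nat := foldr (step_history N o E) 0 ts.

Arguments hist : simpl never.

Lemma tok_hist (ts : seq nat) (d : nat) : tok (hist ts) d = nth 0 ts d.
Proof.
elim: ts d => [|x ts IHts] [|d]; rewrite /tok.
- by rewrite (code_nthE [::]).
- by rewrite (code_nthE [::]) nth_nil.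
- by rewrite muln0 code_nth_cons0.
by rewrite mulnS !code_nth_consS -/(tok _ _) IHts.
Qed.

Lemma len_hist_cons (x : nat) (ts : seq nat) :
  len (hist (x :: ts)) 0 = len_step x (hist ts).
Proof. by rewrite /len muln0 code_nth_consS code_nth_cons0. Qed.

Lemma len_hist_drop (ts : seq nat) (d : nat) :
  d <= size ts -> len (hist ts) d = len (hist (drop d ts)) 0.
Proof.
elim: ts d => [|x ts IHts] [|d] //= led.
by rewrite -IHts // /len mulnS !code_nth_consS.
Qed.

Lemma tab_hist_drop (ts : seq nat) (d : nat) :
  d <= size ts -> tab (hist ts) d = tab (hist (drop d ts)) 0.
Proof.
elim: ts d => [|x ts IHts] [|d] //= led.
by rewrite -IHts // /tab mulnS !code_nth_consS.
Qed.

Lemma tab_hist_cons (x : nat) (ts : seq nat) (e g : nat) : e < E -> g < E ->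
  bit (tab (hist (x :: ts)) 0) (e * E + g) = truth N o E x (hist ts) e g.
Proof.
move=> lte ltg; rewrite /tab muln0 !code_nth_consS code_nth_cons0.
have E0 : 0 < E by apply: leq_ltn_trans ltg.
rewrite bit_bits; last by nia.
by rewrite (divnMDl _ _ E0) (divn_small ltg) addn0 modnMDl (modn_small ltg).
Qed.

(** Polish notation is uniquely readable, so the tail [ts] does not affect parsing; it is arbitrary
    because a first operand is followed by the second. *)
Lemma len_hist (p u : nat) (phi : formula r p u) (ts : seq nat) :
  len (hist (enc_formula phi ++ ts)) 0 = size (enc_formula phi).
Proof.
elim: phi ts => {p u} //=.
- move=> p u s t ts; rewrite len_hist_cons /=.
  by case: s => i; case: t => j.
- by move=> p u i j ts; rewrite len_hist_cons.
- by move=> p u t i ts; rewrite len_hist_cons; case: t.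
- by move=> p u a IHa ts; rewrite len_hist_cons /len_step /= IHa.
- move=> p u a IHa b IHb ts; rewrite len_hist_cons /len_step /= -catA IHa size_cat.
  by rewrite len_hist_drop ?drop_size_cat ?IHb // size_cat leq_addr.
- move=> p u a IHa b IHb ts; rewrite len_hist_cons /len_step /= -catA IHa size_cat.
  by rewrite len_hist_drop ?drop_size_cat ?IHb // size_cat leq_addr.
- move=> p u a IHa b IHb ts; rewrite len_hist_cons /len_step /= -catA IHa size_cat.
  by rewrite len_hist_drop ?drop_size_cat ?IHb // size_cat leq_addr.
- by move=> p u a IHa ts; rewrite len_hist_cons /len_step /= IHa.
- by move=> p u a IHa ts; rewrite len_hist_cons /len_step /= IHa.
- by move=> p u a IHa ts; rewrite len_hist_cons /len_step /= IHa.
- by move=> p u a IHa ts; rewrite len_hist_cons /len_step /= IHa.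
Qed.

Lemma term_valueE (p : nat) (t : term r p) (e : nat) (v : 'I_p -> 'I_N) :
  (forall i : 'I_p, digit M e i = v i) ->
  term_value M (nth 0 (enc_term t) 0) (nth 0 (enc_term t) 1) e = eval_term cst v t.
Proof. by case: t => i vE; rewrite /term_value /= ?cstE ?vE. Qed.

Lemma size_enc_term (p : nat) (t : term r p) : size (enc_term t) = 2.
Proof. by case: t. Qed.

Lemma digit_env_cons (T : Type) (f : T -> nat) (p e : nat) (a : T) (v : 'I_p -> T) :
  p < D -> f a < M -> (forall i : 'I_p, digit M e i = f (v i)) ->
  forall i : 'I_p.+1, digit M (push M E e (f a)) i = f (env_cons a v i).
Proof.
move=> ltp lta vE i; rewrite /env_cons; case: unliftP => [j ->|->].
  by rewrite /= /bump leq0n add1n digit_pushS // -?vE //; apply: leq_trans ltp; rewrite ltnS.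
by rewrite digit_push0 //; apply: leq_ltn_trans ltp.
Qed.

(** A quantifier adds one variable and consumes one token, so the two sums bounded by [D] do not
    grow in subformulas, and [push] never truncates a variable in scope. *)
Lemma sat_hist (p u : nat) (phi : formula r p u) (ts : seq nat) (e g : nat)
    (v : 'I_p -> 'I_N) (w : 'I_u -> openset) :
  p + size (enc_formula phi) <= D -> u + size (enc_formula phi) <= D ->
  e < E -> g < E ->
  (forall i : 'I_p, digit M e i = v i) ->
  (forall i : 'I_u, digit M g i = set_num (val (w i))) ->
  bit (tab (hist (enc_formula phi ++ ts)) 0) (e * E + g) =
  sat (fun x (A : openset) => x \in val A) cst phi v w.
Proof.
have E0 : 0 < E by rewrite expn_gt0 expn_gt0.
have NM : N < M by apply: ltn_expl.
elim: phi ts e g v w => {p u} /=.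
- move=> p u s t ts e g v w _ _ lte ltg vE wE; rewrite (tab_hist_cons _ _ lte ltg) /truth /=.
  by rewrite !tok_hist -catA !nth_cat !size_enc_term /= !(term_valueE _ vE).
- move=> p u i j ts e g v w _ _ lte ltg vE wE; rewrite (tab_hist_cons _ _ lte ltg) /truth /=.
  rewrite !tok_hist /= !wE; apply/eqP/eqP => [|-> //].
  by move=> /(can_inj (@set_numK N))/val_inj.
- move=> p u t i ts e g v w _ _ lte ltg vE wE; rewrite (tab_hist_cons _ _ lte ltg) /truth /=.
  rewrite !tok_hist cat_rcons !nth_cat size_enc_term /= wE (term_valueE _ vE).
  by rewrite bit_set_num.
- move=> p u a IHa ts e g v w lep leu lte ltg vE wE.
  rewrite (tab_hist_cons _ _ lte ltg) /truth /= (IHa _ _ _ v w _ _ lte ltg vE wE) //; lia.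
- move=> p u a IHa b IHb ts e g v w; rewrite size_cat => lep leu lte ltg vE wE.
  have lea : size (enc_formula a) <= size (enc_formula a ++ (enc_formula b ++ ts)).
    by rewrite size_cat leq_addr.
  rewrite (tab_hist_cons _ _ lte ltg) /truth /= -catA len_hist (tab_hist_drop lea).
  rewrite (drop_size_cat _ erefl) (IHa _ _ _ v w _ _ lte ltg vE wE); try lia.
  by rewrite (IHb _ _ _ v w _ _ lte ltg vE wE); try lia.
- move=> p u a IHa b IHb ts e g v w; rewrite size_cat => lep leu lte ltg vE wE.
  have lea : size (enc_formula a) <= size (enc_formula a ++ (enc_formula b ++ ts)).
    by rewrite size_cat leq_addr.
  rewrite (tab_hist_cons _ _ lte ltg) /truth /= -catA len_hist (tab_hist_drop lea).
  rewrite (drop_size_cat _ erefl) (IHa _ _ _ v w _ _ lte ltg vE wE); try lia.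
  by rewrite (IHb _ _ _ v w _ _ lte ltg vE wE); try lia.
- move=> p u a IHa b IHb ts e g v w; rewrite size_cat => lep leu lte ltg vE wE.
  have lea : size (enc_formula a) <= size (enc_formula a ++ (enc_formula b ++ ts)).
    by rewrite size_cat leq_addr.
  rewrite (tab_hist_cons _ _ lte ltg) /truth /= -catA len_hist (tab_hist_drop lea).
  rewrite (drop_size_cat _ erefl) (IHa _ _ _ v w _ _ lte ltg vE wE); try lia.
  by rewrite (IHb _ _ _ v w _ _ lte ltg vE wE); try lia.
- move=> p u a IHa ts e g v w lep leu lte ltg vE wE; rewrite (tab_hist_cons _ _ lte ltg) /truth /=.
  have IH (x : 'I_N) :
      bit (tab (hist (enc_formula a ++ ts)) 0) (push M E e x * E + g) =
      sat (fun x (A : openset) => x \in val A) cst a (env_cons x v) w.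
    apply: IHa => //; [lia | lia | exact: push_lt |].
    apply: (digit_env_cons (f := @nat_of_ord N)) => //; first by lia.
    by apply: ltn_trans NM.
  apply/exists_belowP/existsP => [[x ltx]|[x]]; last by exists x => //; rewrite IH.
  by rewrite -[x]/(nat_of_ord (Ordinal ltx)) IH; exists (Ordinal ltx).
- move=> p u a IHa ts e g v w lep leu lte ltg vE wE; rewrite (tab_hist_cons _ _ lte ltg) /truth /=.
  have IH (x : 'I_N) :
      bit (tab (hist (enc_formula a ++ ts)) 0) (push M E e x * E + g) =
      sat (fun x (A : openset) => x \in val A) cst a (env_cons x v) w.
    apply: IHa => //; [lia | lia | exact: push_lt |].
    apply: (digit_env_cons (f := @nat_of_ord N)) => //; first by lia.
    by apply: ltn_trans NM.
  rewrite -[RHS]negbK negb_forall; congr (~~ _).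
  apply/exists_belowP/existsP => [[x ltx]|[x]]; last by exists x => //; rewrite IH.
  by rewrite -[x]/(nat_of_ord (Ordinal ltx)) IH; exists (Ordinal ltx).
- move=> p u a IHa ts e g v w lep leu lte ltg vE wE; rewrite (tab_hist_cons _ _ lte ltg) /truth /=.
  have IH (A : openset) :
      bit (tab (hist (enc_formula a ++ ts)) 0) (e * E + push M E g (set_num (val A))) =
      sat (fun x (A : openset) => x \in val A) cst a v (env_cons A w).
    apply: IHa => //; [lia | lia | exact: push_lt |].
    apply: (digit_env_cons (f := fun A : openset => set_num (val A))) => //.
      by lia.
    exact: set_num_lt.
  apply/exists_belowP/existsP => [[x ltx /andP[ox]]|[A]].
    have xO : num_set N x \in opens_of by rewrite inE num_setK.
    rewrite -{1}(num_setK ltx) -[num_set N x]/(val (exist (fun A => A \in opens_of) _ xO)) IH.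
    by exists (exist (fun A => A \in opens_of) _ xO).
  exists (set_num (val A)); first exact: set_num_lt.
  by rewrite IH; have := valP A; rewrite inE => ->.
- move=> p u a IHa ts e g v w lep leu lte ltg vE wE; rewrite (tab_hist_cons _ _ lte ltg) /truth /=.
  have IH (A : openset) :
      bit (tab (hist (enc_formula a ++ ts)) 0) (e * E + push M E g (set_num (val A))) =
      sat (fun x (A : openset) => x \in val A) cst a v (env_cons A w).
    apply: IHa => //; [lia | lia | exact: push_lt |].
    apply: (digit_env_cons (f := fun A : openset => set_num (val A))) => //.
      by lia.
    exact: set_num_lt.
  rewrite -[RHS]negbK negb_forall; congr (~~ _).
  apply/exists_belowP/existsP => [[x ltx /andP[ox]]|[A]].
    have xO : num_set N x \in opens_of by rewrite inE num_setK.
    rewrite -{1}(num_setK ltx) -[num_set N x]/(val (exist (fun A => A \in opens_of) _ xO)) IH.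
    by exists (exist (fun A => A \in opens_of) _ xO).
  exists (set_num (val A)); first exact: set_num_lt.
  by rewrite IH; have := valP A; rewrite inE => ->.
Qed.

End Evaluation.

Lemma bits_true (N : nat) : bits N xpredT = (2 ^ N).-1.
Proof.
elim: N => [|N IHN]; first by rewrite /bits big_geq.
rewrite bits_recl IHN expnS mul2n; have : 0 < 2 ^ N by rewrite expn_gt0.
by rewrite -!addnn; lia.
Qed.

Lemma set_numE (N : nat) (A : {set 'I_N}) (P : nat -> bool) :
  (forall x : 'I_N, (x \in A) = P x) -> set_num A = bits N P.
Proof. by move=> AP; apply: eq_bits => i ltiN; rewrite insubT AP. Qed.

Lemma topology_codeE (N o : nat) : topology_code N o = is_topology (opens_of N o).
Proof.
have num0 : set_num (set0 : {set 'I_N}) = 0.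
  rewrite (@set_numE _ _ xpred0) => [|x]; last by rewrite inE.
  by rewrite /bits big1 // => i _; rewrite muln0.
have numT : set_num [set: 'I_N] = (2 ^ N).-1.
  by rewrite -bits_true; apply: set_numE => x; rewrite inE.
have numU (A B : {set 'I_N}) :
    set_num (A :|: B) = bits N (fun i => bit (set_num A) i || bit (set_num B) i).
  by apply: set_numE => x; rewrite inE !bit_set_num.
have numI (A B : {set 'I_N}) :
    set_num (A :&: B) = bits N (fun i => bit (set_num A) i && bit (set_num B) i).
  by apply: set_numE => x; rewrite inE !bit_set_num.
have closedP : ~~ exists_below (2 ^ N) (fun a => exists_below (2 ^ N) (fun b =>
      [&& bit o a, bit o b &
        ~~ (bit o (bits N (fun i => bit a i || bit b i)) &&
            bit o (bits N (fun i => bit a i && bit b i)))])) <->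
    {in opens_of N o &, forall A B, (A :|: B \in opens_of N o) && (A :&: B \in opens_of N o)}.
  split=> [/negP nex A B AO BO|cl].
    apply/negPn/negP => nAB; apply: nex; apply/exists_belowP.
    exists (set_num A); first exact: set_num_lt.
    apply/exists_belowP; exists (set_num B); first exact: set_num_lt.
    by move: AO BO nAB; rewrite !inE numU numI => -> ->.
  apply/negP => /exists_belowP[a lta /exists_belowP[b ltb /and3P[oa ob /negP[]]]].
  rewrite -(num_setK lta) -(num_setK ltb) -numU -numI.
  by have := cl (num_set N a) (num_set N b); rewrite !inE !num_setK //; apply.
rewrite /topology_code /is_topology [set0 \in _]inE [setT \in _]inE num0 numT.
apply/and3P/and4P => [[o0 oT /closedP cl]|[o0 oT /forallP oU /forall_inP oI]].
  split=> //.
    apply/forallP => S; apply/implyP => /subsetP SO; rewrite /cover.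
    elim/big_ind: _ => [|A B AO BO|A /SO //]; first by rewrite inE num0.
    by have /andP[] := cl A B AO BO.
  apply/forall_inP => A AO; apply/forall_inP => B BO.
  by have /andP[] := cl A B AO BO.
split=> //; apply/closedP => A B AO BO; apply/andP; split.
  have -> : A :|: B = cover [set A; B] by rewrite /cover bigcup_setU !big_set1.
  by apply: (implyP (oU _)); rewrite subUset !sub1set AO.
exact: (forall_inP (oI A AO)).
Qed.

Lemma sum_opens_of (N : nat) (P : pred {set {set 'I_N}}) :
  #|[set O | P O]| = \sum_(0 <= o < 2 ^ (2 ^ N)) P (opens_of N o).
Proof.
pose num O := bits (2 ^ N) (fun a => num_set N a \in (O : {set {set 'I_N}})).
have ltnum O : num O < 2 ^ (2 ^ N) by apply: bits_lt.
have -> : #|[set O | P O]| = \sum_O (P O : nat).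
  by rewrite -sum1_card big_mkcond; apply: eq_bigr => O _; rewrite inE; case: (P O).
rewrite big_mkord (reindex (fun o : 'I_(2 ^ (2 ^ N)) => opens_of N o)) //=.
exists (fun O => Ordinal (ltnum O)) => [o _|O _].
  apply: val_inj => /=; rewrite -[RHS](bits_bit (ltn_ord o)).
  by apply: eq_bits => a lta; rewrite inE num_setK.
apply/setP => A; rewrite inE /= bit_bits ?set_numK //; exact: set_num_lt.
Qed.

Lemma foldr_iteri (f : nat -> nat -> nat) (s : seq nat) (n : nat) : n <= size s ->
  iteri n (fun j H => f (nth 0 s (size s - j.+1)) H) 0 = foldr f 0 (drop (size s - n) s).
Proof.
elim: n => [|n IHn] len; first by rewrite subn0 drop_size.
have lt : size s - n.+1 < size s by lia.
by rewrite (drop_nth 0 lt) /= IHn 1?ltnW //; congr (f _ (foldr _ _ (drop _ _))); lia.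
Qed.

Lemma eq_iteri_lt (f g : nat -> nat -> nat) (n x : nat) :
  (forall i y, i < n -> f i y = g i y) -> iteri n f x = iteri n g x.
Proof.
elim: n => //= n IHn fg; rewrite IHn => [|i y ltin]; first exact: fg.
by apply: fg; apply: ltnW.
Qed.

Lemma size_enc_formula (r p u : nat) (phi : formula r p u) : 3 <= size (enc_formula phi).
Proof.
elim: phi => {p u} //=.
- by move=> p u s t; rewrite size_cat !size_enc_term.
- by move=> p u t i; rewrite size_rcons size_enc_term.
- by move=> p u a IHa; apply: leqW.
- by move=> p u a IHa b IHb; rewrite size_cat; lia.
- by move=> p u a IHa b IHb; rewrite size_cat; lia.
- by move=> p u a IHa b IHb; rewrite size_cat; lia.
- by move=> p u a IHa; apply: leqW.
- by move=> p u a IHa; apply: leqW.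
- by move=> p u a IHa; apply: leqW.
- by move=> p u a IHa; apply: leqW.
Qed.

Lemma count_modelsE (m r n : nat) (phi : sentence r) :
  count_models (r + n) (CodeSeq.code (rot 4 (m :: r :: enc_formula phi))) =
  topcount phi n.
Proof.
set w := m :: r :: enc_formula phi; set K := CodeSeq.code _.
have w4 : 4 <= size w by have := size_enc_formula phi; rewrite /w /=; lia.
have KE : code_size K = size w by rewrite code_sizeE size_rot.
rewrite /topcount sum_opens_of; apply: eq_bigr => o _.
rewrite topology_codeE; congr (nat_of_bool (_ && _)).
have -> : history (r + n) o ((2 ^ (r + n)) ^ code_size K) K =
    hist (r + n) (size w) o (enc_formula phi).
  rewrite /history KE /hist.
  set f := step_history _ _ _.
  rewrite (@eq_iteri_lt _ (fun j H => f (nth 0 w (size w - j.+1)) H)); last first.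
    by move=> j H ltj; rewrite token_rot //; lia.
  rewrite foldr_iteri ?leq_subr //; have -> : size w - (size w - 2) = 2 by lia.
  by rewrite /w /= drop0.
rewrite -[enc_formula phi]cats0.
(* A sentence has no free variables, so both environments may be coded by 0. *)
set T := tab _ _; have -> : bit T 0 = bit T (0 * (2 ^ (r + n)) ^ size w + 0).
  by rewrite mul0n.
by apply: sat_hist => [i||||||] //=; try lia; rewrite ?expn_gt0 // => -[].
Qed.

(** * Bounding the threshold by a tower *)

Lemma leq_tower (a b : nat) : a <= b -> tower a <= tower b.
Proof.
move=> /subnK <-; elim: (b - a) => // k IHk; rewrite addSn.
by apply: leq_trans IHk _; apply: ltnW; apply: ltn_expl.
Qed.

Lemma tower_ge (a : nat) : a <= tower a.
Proof. by elim: a => // a IHa; apply: leq_ltn_trans IHa _; apply: ltn_expl. Qed.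

Lemma towerS (a : nat) : tower a.+1 = 2 ^ tower a.
Proof. by []. Qed.

Lemma tower_gt0 (a : nat) : 0 < tower a.
Proof. by case: a => // a; rewrite towerS expn_gt0. Qed.

Arguments tower : simpl never.

Lemma double_leq_exp2 (t : nat) : 0 < t -> 2 * t <= 2 ^ t.
Proof.
case: t => // t _; rewrite expnS leq_pmul2l //; exact: ltn_expl.
Qed.

Lemma mul_leq_tower (a b h : nat) :
  a <= tower h -> b <= tower h -> a * b <= tower h.+2.
Proof.
move=> ah bh; apply: leq_trans (leq_mul ah bh) _.
have t0 := tower_gt0 h; rewrite !towerS.
apply: (@leq_trans (2 ^ tower h * 2 ^ tower h)).
  by apply: leq_mul; apply/ltnW/ltn_expl.
by rewrite -expnD leq_exp2l // addnn -mul2n double_leq_exp2.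
Qed.

Lemma exp_leq_tower (a b h : nat) :
  a <= tower h -> b <= tower h -> a ^ b <= tower h.+3.
Proof.
move=> ah bh; rewrite towerS.
apply: (@leq_trans ((2 ^ tower h) ^ b)).
  by apply: leq_exp2r_le; apply: leq_trans ah _; apply/ltnW/ltn_expl.
by rewrite -expnM leq_exp2l // mul_leq_tower.
Qed.

Lemma tower4_ge : 32 * (8 * (8 * (8 * 2))) <= tower 4.
Proof. by have -> : tower 4 = 2 ^ 16 by []; rewrite (_ : 32 * _ = 2 ^ 15) // leq_exp2l. Qed.

Lemma transitive_bound_tower : transitive_bound <= tower 7.
Proof. by rewrite /transitive_bound -lock !towerS !leq_exp2l // tower4_ge. Qed.

(** Three levels per symbol: two for a product, one for the exponential of a quantifier. *)
Lemma tfol_bound_tower (r p u : nat) (phi : formula r p u) :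
  tfol_bound phi <= tower (3 * size (enc_formula phi)).
Proof.
have tower9 h : 3 <= h -> 32 <= tower (3 * h).
  move=> h3; apply: leq_trans (leq_tower (_ : 4 <= 3 * h)); last by lia.
  by apply: leq_trans tower4_ge; rewrite leq_pmulr.
have base x : 3 <= x -> 2 <= tower (3 * x) by move=> /tower9; apply: leq_trans.
have mulP x y a b : a <= tower (3 * x) -> b <= tower (3 * y) ->
    a * b <= tower (3 * (x + y).+1).
  move=> ax bY; apply: (@leq_trans (tower (3 * (x + y)).+2)); last by apply: leq_tower; lia.
  apply: mul_leq_tower; [apply: leq_trans ax _ | apply: leq_trans bY _]; apply: leq_tower; lia.
have exP c x a : c <= 32 -> 3 <= x -> a <= tower (3 * x) -> 2 ^ (c * a) <= tower (3 * x.+1).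
  move=> c32 x3 ax; have -> : 3 * x.+1 = (3 * x).+3 by lia.
  rewrite towerS leq_exp2l //; apply: mul_leq_tower => //.
  exact: leq_trans c32 (tower9 x x3).
elim: phi => {p u}.
- by move=> p u s t; apply: base; apply: size_enc_formula.
- by move=> p u i j; apply: base.
- by move=> p u t i; apply: base; apply: size_enc_formula.
- by move=> p u a IHa; apply: leq_trans IHa _; apply: leq_tower; rewrite leq_mul2l leqnSn orbT.
- by move=> p u a IHa b IHb /=; rewrite size_cat; apply: mulP.
- by move=> p u a IHa b IHb /=; rewrite size_cat; apply: mulP.
- by move=> p u a IHa b IHb /=; rewrite size_cat; apply: mulP.
- by move=> p u a IHa; apply: exP => //; apply: size_enc_formula.
- by move=> p u a IHa; apply: exP => //; apply: size_enc_formula.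
- by move=> p u a IHa; apply: exP => //; apply: size_enc_formula.
- by move=> p u a IHa; apply: exP => //; apply: size_enc_formula.
Qed.

(** The code of the input exceeds [m] and the length of the formula, so one number known to the
    machine controls the bound. The products and exponentials use ten levels; 20 leaves slack. *)
Lemma topcount_bound_tower (m r : nat) (phi : sentence r) :
  topcount_bound phi m <=
  tower (3 * CodeSeq.code (rot 4 (m :: r :: enc_formula phi)) + 20).
Proof.
set w := m :: r :: enc_formula phi; set K := CodeSeq.code _.
have ltm : m < K.
  by have /allP := CodeSeq.ltn_code (rot 4 w); apply; rewrite mem_rot mem_head.
have les : size w <= K by rewrite -(size_rot 4 w); apply: size_code.
have s3 := size_enc_formula phi.
have sE : size w = (size (enc_formula phi)).+2 by [].
pose h := 3 * K; have lem : m.+1 <= tower h.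
  by apply: leq_trans (tower_ge h); rewrite /h; lia.
have leb : transitive_bound * tfol_bound phi <= tower h.+2.
  apply: mul_leq_tower.
    by apply: leq_trans transitive_bound_tower _; apply: leq_tower; rewrite /h; lia.
  by apply: leq_trans (tfol_bound_tower phi) _; apply: leq_tower; rewrite /h; lia.
have le4 : m * m.+1 * m <= tower h.+4.
  apply: mul_leq_tower; first by apply: mul_leq_tower => //; apply: ltnW.
  by apply: leq_trans (ltnW lem) _; apply: leq_tower; lia.
have le7 : (m * m.+1 * m) ^ (transitive_bound * tfol_bound phi) <= tower h.+4.+3.
  apply: exp_leq_tower => //; apply: leq_trans leb _; apply: leq_tower; lia.
apply: (@leq_trans (tower h.+4.+3.+3)); last by apply: leq_tower; rewrite /h; lia.
apply: exp_leq_tower => //; apply: leq_trans (ltnW lem) _; apply: leq_tower; lia.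
Qed.

(** * Ultimate periodicity, MC-finiteness and tractability *)

Lemma ultimately_periodic_topcount (r : nat) (phi : sentence r) (m : nat) :
  0 < m -> ultimately_periodic (fun n => topcount phi n %% m).
Proof.
move=> m0; exists (topcount_bound phi m)`!, (topcount_bound phi m).
split=> [|n len]; first exact: fact_gt0.
exact: topcount_periodic.
Qed.

Lemma mc_finite_periodic (s : nat -> nat) :
  (forall m, 0 < m -> ultimately_periodic (fun n => s n %% m)) ->
  mc_finite (fun n => Posz (s n)).
Proof.
move=> per m /per[p [q [p0 pP]]].
(* The recurrence is [s (n + p) = s n]: only the coefficient of index 0 is 1. The successor makes
   the threshold positive. *)
exists p, q.+1, (fun i : 'I_p => (nat_of_ord i == 0 : int)); split=> // n /ltnW leqn.
rewrite (bigD1 (Ordinal p0)) //= big1 => [|i ni].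
  by rewrite GRing.addr0 GRing.mul1r addn0 !modz_nat pP.
have /negPf -> : nat_of_ord i != 0 by apply: contra ni => /eqP i0; apply/eqP/val_inj.
by rewrite GRing.mul0r.
Qed.

Theorem theorem2 :
  (forall (r : nat) (phi : sentence r),
     (forall m : nat, 0 < m ->
        ultimately_periodic (fun n => topcount phi n %% m)) /\
     mc_finite (fun n => Posz (topcount phi n)))
  /\
  fpt_computable enc_params
    (fun (k : params) (n : nat) => topcount (par_phi k) n %% par_m k).
Proof.
split.
  move=> r phi; split; first exact: ultimately_periodic_topcount.
  by apply: mc_finite_periodic; apply: ultimately_periodic_topcount.
(* The height in [topcount_bound_tower]: the tower is the threshold [S], its factorial the period
   [Q]. *)
have dK : definable (fun rho => 3 * rho 0 + 20) by definability.
have dS := definable_tower dK.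
have [eS eSE] := dS; have [eQ eQE] := definable_fact dS.
have [eT eTE] := definable_add dS (definable_fact dS).
have [eF eFE] := definable_count_mod.
apply: (@periodic_fpt_computable _ _ _ eS eQ eT eF) => [k|k|k|k n|k y].
- by have := size_enc_formula (par_phi k); rewrite /enc_params /=; lia.
- by rewrite eQE fact_gt0.
- by rewrite eTE eSE eQE.
- rewrite eSE eQE => len; apply: topcount_periodic len; first exact: par_m_gt0.
  exact: topcount_bound_tower.
rewrite eFE /count_mod /scons /= !token_rot //; last 2 first.
- by have := size_enc_formula (par_phi k); rewrite /enc_params /=; lia.
- by have := size_enc_formula (par_phi k); rewrite /enc_params /=; lia.
by rewrite count_modelsE.
Qed.
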